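(* Let $0<d<1/2$, let $p,q\in\mathbb{N}\cup\{0\}$, and let $\{X_n\}_{n\in\mathbb{Z}}$ be a FARIMA$(p,d,q)$ process with Verblunsky coefficients (partial autocorrelation function) $\{\alpha(n)\}_{n\ge1}$. Then $$n\,\alpha(n)=d+O(n^{-d}),\qquad n\to\infty.$$
   Context: A stationary process is a real, zero-mean, weakly stationary process $\{X_n:n\in\mathbb{Z}\}$ on a probability space $(\Omega,\mathcal{F},P)$ whose spectral measure on $(-\pi,\pi]$ is not of finite support. Write $\gamma(n)=E[X_nX_0]$. It has spectral density $\Delta$ if $\gamma(n)=\int_{-\pi}^\pi e^{in\theta}\Delta(\theta)\,d\theta$ for all $n\in\mathbb{Z}$. A stationary process is a FARIMA$(p,d,q)$ process ($d\in(-1/2,1/2)$, $p,q\in\mathbb{N}\cup\{0\}$) if it has a spectral density of the form $$\Delta(\theta)=\frac1{2\pi}\frac{|\Theta(e^{i\theta})|^2}{|\Phi(e^{i\theta})|^2}|1-e^{i\theta}|^{-2d},\qquad -\pi<\theta\le\pi,$$ where $\Phi(z)$ and $\Theta(z)$ are polynomials with real coefficients of degrees $p$ and $q$, respectively, which have no common zeros and have no zeros in the closed unit disk $\{z\in\mathbb{C}:|z|\le1\}$. Let $H$ be the closed real linear span of $\{X_k:k\in\mathbb{Z}\}$ in $L^2(\Omega,\mathcal{F},P)$, with inner product $(Y_1,Y_2)=E[Y_1Y_2]$ and norm $\|Y\|=(Y,Y)^{1/2}$. For an interval $I\subset\mathbb{Z}$, $H_I$ is the closed subspace spanned by $\{X_k:k\in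 I\}$, and $P_I^\perp$ is the orthogonal projection of $H$ onto the orthogonal complement of $H_I$ in $H$. The Verblunsky coefficients are $\alpha(1)=\gamma(1)/\gamma(0)$ and $\alpha(n)=\dfrac{(P^\perp_{[1,n-1]}X_n,\,P^\perp_{[1,n-1]}X_0)}{\|P^\perp_{[1,n-1]}X_n\|^2}$ for $n\ge2$. *)

(* Defs.v *)
From HB Require Import structures.
From mathcomp Require Import all_boot all_order all_algebra.
From mathcomp Require Import complex.
From mathcomp Require Import all_classical all_reals all_analysis.

Set Implicit Arguments.
Unset Strict Implicit.
Unset Printing Implicit Defensive.

Import Order.TTheory GRing.Theory Num.Theory.
Import numFieldNormedType.Exports.

Local Open Scope classical_set_scope.
Local Open Scope complex_scope.
Local Open Scope ring_scope.

Section complex_valued.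
Context {R : realType}.

Definition expi (t : R) : R[i] := cos t +i* sin t.

Definition Cintegral (mu : {measure set (measurableTypeR R) -> \bar R})
    (D : set R) (f : R -> R[i]) : R[i] :=
  (\int[mu]_(t in D) complex.Re (f t)) +i* (\int[mu]_(t in D) complex.Im (f t)).

(* Evaluation of a real polynomial at a complex point. *)
Definition ceval (p : {poly R}) (z : R[i]) : R[i] :=
  (map_poly (real_complex R) p).[z].

(* Here normc is the R-valued modulus; the generic norm of R[i] takes its
   values in R[i] itself. *)
Definition modulus (z : R[i]) : R := ComplexField.Normc.normc z.

Definition circle : set R := `]-pi, pi]%classic.

End complex_valued.

Section L2.
Context {disp : measure_display} {T : measurableType disp} {R : realType}.
Variable P : probability T R.

(* Elements of L^2(P) are handled through representatives: functions in
   Lfun P 2. All the notions below are invariant under almost sure equality. *)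

Definition inner (Y Z : T -> R) : R := fine ('E_P[Y \* Z])%E.

Definition l2norm (Y : T -> R) : R := Num.sqrt (inner Y Y).

Definition orth_proj (M : set (T -> R)) (Y Z : T -> R) : Prop :=
  M Z /\ forall V, M V -> inner (Y \- Z) V = 0.

Section process.
Variable X : int -> {RV P >-> R}.

Definition lin_span (I : set int) : set (T -> R) :=
  [set Y | exists (s : seq int) (c : int -> R),
     (forall k, k \in s -> I k) /\
     Y = (fun w => \sum_(k <- s) c k * X k w)].

Definition closed_span (I : set int) : set (T -> R) :=
  [set Y | Y \in Lfun P 2%:E /\
     forall e : R, 0 < e -> exists2 Z, lin_span I Z & l2norm (Y \- Z) < e].

Definition orth_compl (I : set int) : set (T -> R) :=
  [set Y | closed_span setT Y /\ forall Z, closed_span I Z -> inner Y Z = 0].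

(* A representative of the projection of Y on the orthogonal complement of
   H_I in H; for Y in H it exists and is unique up to almost sure equality. *)
Definition Pperp (I : set int) (Y : T -> R) : T -> R :=
  xget (cst 0) [set Z | orth_proj (orth_compl I) Y Z].

Definition gamma (n : int) : R := inner (X n) (X 0).

(* The value at n = 0 is a dummy: the coefficients are indexed by n >= 1. *)
Definition verblunsky (n : nat) : R :=
  match n with
  | 0 => 0
  | 1 => gamma 1 / gamma 0
  | _ => let I := [set k : int | 1 <= k <= n%:Z - 1] in
         inner (Pperp I (X n%:Z)) (Pperp I (X 0))
           / l2norm (Pperp I (X n%:Z)) ^+ 2
  end.

Definition weakly_stationary : Prop :=
  (forall n, (X n : T -> R) \in Lfun P 2%:E) /\
  (forall n m k : int, inner (X (n + k)) (X (m + k)) = inner (X n) (X m)).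

Definition zero_mean : Prop := forall n, ('E_P[X n] = 0)%E.

Definition spectral_measure
    (mu : {finite_measure set (measurableTypeR R) -> \bar R}) : Prop :=
  mu (~` circle) = 0%E /\
  forall n : int,
    (gamma n)%:C = Cintegral mu circle (fun t => expi (n%:~R * t)).

Definition finitely_supported
    (mu : {finite_measure set (measurableTypeR R) -> \bar R}) : Prop :=
  exists2 F : set R, finite_set F & mu (~` F) = 0%E.

(* By Herglotz' theorem the spectral measure of a weakly stationary process
   exists and is unique. *)
Definition stationary_process : Prop :=
  [/\ weakly_stationary, zero_mean &
      exists2 mu, spectral_measure mu & ~ finitely_supported mu].

Definition has_spectral_density (Delta : R -> R) : Prop :=
  (@lebesgue_measure R).-integrable circle (EFin \o Delta) /\
  forall n : int,
    (gamma n)%:C =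
    Cintegral lebesgue_measure circle
      (fun t => expi (n%:~R * t) * (Delta t)%:C).

End process.

(* At t = 0 the density is infinite if d > 0, while powR gives 0 there; this is
   immaterial since densities only matter almost everywhere. *)
Definition farima_density (d : R) (Phi Theta : {poly R}) (t : R) : R :=
  (2 * pi)^-1 *
  (modulus (ceval Theta (expi t)) ^+ 2 / modulus (ceval Phi (expi t)) ^+ 2) *
  modulus (1 - expi t) `^ (- 2 * d).

Definition no_zero_in_closed_disk (p : {poly R}) : Prop :=
  forall z : R[i], modulus z <= 1 -> ceval p z != 0.

Definition no_common_zero (p1 p2 : {poly R}) : Prop :=
  forall z : R[i], ~ (ceval p1 z = 0 /\ ceval p2 z = 0).

Definition farima (p : nat) (d : R) (q : nat) (X : int -> {RV P >-> R}) : Prop :=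
  [/\ - 2^-1 < d < 2^-1, stationary_process X &
      exists Phi Theta : {poly R},
        [/\ size Phi = p.+1 /\ size Theta = q.+1,
            no_common_zero Phi Theta,
            no_zero_in_closed_disk Phi,
            no_zero_in_closed_disk Theta &
            has_spectral_density X (farima_density d Phi Theta)]].

End L2.

(* Main.v *)
Require Import Defs.
From HB Require Import structures.
From mathcomp Require Import all_boot all_order all_algebra.
From mathcomp Require Import complex.
From mathcomp Require Import all_classical all_reals all_analysis.
From mathcomp Require Import measurable_realfun.
From mathcomp Require Import ring lra zify.

Set Implicit Arguments.
Unset Strict Implicit.
Unset Printing Implicit Defensive.

Import Order.TTheory GRing.Theory Num.Theory.
Import numFieldNormedType.Exports.

Local Open Scope classical_set_scope.
Local Open Scope ring_scope.

(** A causal sequence [c] with causal summable inverse [a] is a spectral factor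
    of [gamma = K (rev c * c)]; put [phi = rev c * a]. If [B] is the Hankel
    matrix [phi (n + i + j)] and [y+ = (1 - B)^-1 e0], [y- = (1 + B)^-1 e0], then
    [alpha(n) = (y-_0 - y+_0) / (y+_0 + y-_0)]: the n-th predictor polynomial is
    a two-sided combination of [a] and [rev a] with coefficients [y+ + y-] and
    [y+ - y-].

    For the pure process (1 - z)^-d one has [phi0 k = - s / (k - d)] with
    [s = sin (pi d) / pi], and the Durbin--Levinson recursion is explicit:
    [alpha0(n) = d / (n - d)]. For a FARIMA process [phi k = phi0 k + O(1/k^2)].
    Generalized Hilbert matrices have explicit positive eigenvectors, which
    serve as weights making both [B] and [B0] uniformly contracting for the
    weighted sup norm; a perturbation argument then yields
    [y_0 - y0_0 = O(1/n^2)], whence [n alpha(n) = d + O(1/n)]. *)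

(** * Unconditional sums *)

(** The obstacle is that [c] is only known to be square summable and [phi] decays only like 1/k. So
    [B] is of Hilbert matrix type: its norm does not tend to 0 as n grows, and only its first column
    is O(1/n). The eigenvector belonging to [d] itself would give a contraction constant of about 1,
    with no room for a perturbation; an exponent [e] strictly between [d] and 1/2 leaves room
    because sin (pi d) / pi increases up to 1/2. No asymptotics of y+ or y- are computed. The pure
    process is solved by another route, and uniqueness of predictors transfers its answer to y0+ and
    y0-. For E = B - B0 the first-order term E e0 is O(1/n^2), and E (y0 - e0) is a product of two
    factors O(1/n). The rate 1/k^2 comes from phi = phi0 * tau, where tau has sum 1, being the phase
    of a real rational function evaluated at z = 1. The moments of |1 - z|^(-2d) are never
    evaluated: integrating a derivative gives them the same first-order recursion as the
    autocorrelation of (1 - z)^-d, and the unknown scalar cancels in alpha(n). *)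

Section tsum.
Context {R : realType}.
Implicit Types I J : choiceType.

(** Summation without an order, over any index type, so that two-sided sequences and double sums can
    be reindexed and exchanged freely. *)
Definition nsum I (f : I -> R) : \bar R := esum setT (EFin \o f).

Definition summ I (f : I -> R) : Prop := (nsum (fun i => `|f i|)%R < +oo)%E.

(* A junk value unless [summ f]. *)
Definition tsum I (f : I -> R) : R :=
  fine (nsum (fun i => Num.max (f i) 0)) - fine (nsum (fun i => Num.max (- f i) 0)).

Lemma nsum_ge0 I (f : I -> R) : (forall i, 0 <= f i) -> (0 <= nsum f)%E.
Proof. by move=> f0; apply: esum_ge0 => i _; rewrite lee_fin. Qed.

Lemma le_nsum I (f g : I -> R) : (forall i, f i <= g i) -> (nsum f <= nsum g)%E.
Proof. by move=> fg; apply: le_esum => i _; rewrite lee_fin. Qed.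

Lemma nsumD I (f g : I -> R) : (forall i, 0 <= f i) -> (forall i, 0 <= g i) ->
  (nsum (fun i => f i + g i)%R = nsum f + nsum g)%E.
Proof.
move=> f0 g0; rewrite /nsum -esumD; last 2 first.
- by move=> i _; rewrite lee_fin.
- by move=> i _; rewrite lee_fin.
by apply: eq_esum => i _; rewrite EFinD.
Qed.

Lemma nsum_fin I (f : I -> R) : (forall i, 0 <= f i) -> (nsum f < +oo)%E ->
  nsum f \is a fin_num.
Proof. by move=> f0 foo; rewrite ge0_fin_numE// nsum_ge0. Qed.

Lemma nsum0 I : nsum (fun _ : I => 0) = 0%E.
Proof. by rewrite /nsum esum1. Qed.

Lemma summ_ge0 I (f : I -> R) : (forall i, 0 <= f i) ->
  summ f <-> (nsum f < +oo)%E.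
Proof.
by move=> f0; rewrite /summ (_ : (fun i => `|f i|) = f)//; apply/funext => i; rewrite ger0_norm.
Qed.

Lemma summ_le I (f g : I -> R) : (forall i, `|f i| <= `|g i|) -> summ g -> summ f.
Proof. by move=> fg; apply: le_lt_trans; exact: le_nsum. Qed.

Lemma summ_norm I (f : I -> R) : summ f -> summ (fun i => `|f i|).
Proof. by apply: summ_le => i; rewrite normr_id. Qed.

Lemma summN I (f : I -> R) : summ f -> summ (fun i => - f i).
Proof. by apply: summ_le => i; rewrite normrN. Qed.

Lemma summD I (f g : I -> R) : summ f -> summ g -> summ (fun i => f i + g i).
Proof.
move=> sf sg; apply: (@le_lt_trans _ _ (nsum (fun i => `|f i|)%R + nsum (fun i => `|g i|)%R)%E).
  rewrite -nsumD//; apply: le_nsum => i; exact: ler_normD.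
by rewrite lte_add_pinfty.
Qed.

Lemma summB I (f g : I -> R) : summ f -> summ g -> summ (fun i => f i - g i).
Proof. by move=> sf sg; apply: summD => //; exact: summN. Qed.

Lemma nsumZ I (f : I -> R) c : 0 <= c -> (forall i, 0 <= f i) -> (nsum f < +oo)%E ->
  (nsum (fun i => (c * f i)%R) <= c%:E * nsum f)%E.
Proof.
move=> c0 f0 foo; apply: ge_ereal_sup => _ [A fA <-].
have -> : (\sum_(x \in A) (c * f x)%:E = c%:E * \sum_(x \in A) (f x)%:E)%E.
  by rewrite ge0_mule_fsumr// => i; rewrite lee_fin.
apply: lee_wpmul2l; first by rewrite lee_fin.
by apply: ereal_sup_ubound; exists A.
Qed.

Lemma summZ I (f : I -> R) c : summ f -> summ (fun i => c * f i).
Proof.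
move=> sf; rewrite /summ (_ : (fun i => `|c * f i|) = (fun i => `|c| * `|f i|)); last first.
  by apply/funext => i; rewrite normrM.
apply: le_lt_trans (nsumZ _ _ sf) _ => //.
by rewrite -(fineK (nsum_fin _ sf))// -EFinM ltry.
Qed.

Lemma summZr I (f : I -> R) c : summ f -> summ (fun i => f i * c).
Proof. by move=> /(summZ c); under eq_fun do rewrite mulrC. Qed.

(** Any splitting into summable nonnegative parts may replace the positive and negative parts, since
    [fp + h = fm + g]; linearity of [tsum] rests on this. *)
Lemma tsum_sub I (f g h : I -> R) : (forall i, 0 <= g i) -> (forall i, 0 <= h i) ->
  (nsum g < +oo)%E -> (nsum h < +oo)%E -> (forall i, f i = g i - h i) ->
  tsum f = fine (nsum g) - fine (nsum h).
Proof.
move=> g0 h0 goo hoo fE.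
set fp := (fun i => Num.max (f i) 0); set fm := (fun i => Num.max (- f i) 0).
have fp0 i : 0 <= fp i by rewrite /fp le_max lexx orbT.
have fm0 i : 0 <= fm i by rewrite /fm le_max lexx orbT.
have fpoo : (nsum fp < +oo)%E.
  apply: le_lt_trans goo; apply: le_nsum => i; rewrite /fp ge_max g0 andbT fE.
  by rewrite lerBlDr lerDl.
have fmoo : (nsum fm < +oo)%E.
  apply: le_lt_trans hoo; apply: le_nsum => i; rewrite /fm ge_max h0 andbT fE.
  by rewrite opprB lerBlDr lerDl.
have : (nsum fp + nsum h = nsum fm + nsum g)%E.
  rewrite -!nsumD//; congr nsum; apply/funext => i.
  rewrite /fp /fm; have := fE i; case: (leP (f i) 0); case: (leP (- f i) 0); lra.
rewrite -(fineK (nsum_fin fp0 fpoo)) -(fineK (nsum_fin fm0 fmoo)).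
rewrite -(fineK (nsum_fin g0 goo)) -(fineK (nsum_fin h0 hoo)) -!EFinD => -[].
rewrite /tsum -/fp -/fm; lra.
Qed.

Lemma max0_ge0 (x : R) : 0 <= Num.max x 0.
Proof. by rewrite le_max lexx orbT. Qed.

Lemma max0_le_norm (x : R) : Num.max x 0 <= `|x|.
Proof. by rewrite ge_max normr_ge0 ler_norm. Qed.

Lemma max0_subN (x : R) : x = Num.max x 0 - Num.max (- x) 0.
Proof. case: (leP x 0); case: (leP (- x) 0); lra. Qed.

Lemma summ_pos I (f : I -> R) : summ f -> (nsum (fun i => Num.max (f i) 0)%R < +oo)%E.
Proof. by apply: le_lt_trans; apply: le_nsum => i; exact: max0_le_norm. Qed.

Lemma summ_neg I (f : I -> R) : summ f -> (nsum (fun i => Num.max (- f i) 0)%R < +oo)%E.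
Proof. by move=> /summN /summ_pos. Qed.

Lemma tsum_ge0E I (f : I -> R) : (forall i, 0 <= f i) -> summ f ->
  (tsum f)%:E = nsum f.
Proof.
move=> f0 sf; have foo := (summ_ge0 f0).1 sf.
rewrite (@tsum_sub _ f f (fun=> 0)) ?nsum0 ?subr0 ?fineK ?nsum_fin// => i.
by rewrite subr0.
Qed.

Lemma tsum0 I : tsum (fun _ : I => 0) = 0.
Proof. by rewrite /tsum oppr0 subrr. Qed.

Lemma eq_tsum I (f g : I -> R) : f =1 g -> tsum f = tsum g.
Proof. by move=> /funext ->. Qed.

Lemma tsumD I (f g : I -> R) : summ f -> summ g ->
  tsum (fun i => f i + g i) = tsum f + tsum g.
Proof.
move=> sf sg.
pose p h := fun i : I => Num.max (h i : R) 0; pose m h := fun i : I => Num.max (- h i : R) 0.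
have p0 h i : 0 <= p h i by exact: max0_ge0.
have m0 h i : 0 <= m h i by exact: max0_ge0.
have pf : (nsum (p f) < +oo)%E by exact: summ_pos.
have pg : (nsum (p g) < +oo)%E by exact: summ_pos.
have mf : (nsum (m f) < +oo)%E by exact: summ_neg.
have mg : (nsum (m g) < +oo)%E by exact: summ_neg.
rewrite (@tsum_sub _ _ (fun i => p f i + p g i) (fun i => m f i + m g i)).
- rewrite !nsumD// !fineD ?nsum_fin// /tsum -/(p f) -/(p g) -/(m f) -/(m g); lra.
- by move=> i; rewrite addr_ge0.
- by move=> i; rewrite addr_ge0.
- by rewrite nsumD ?lte_add_pinfty.
- by rewrite nsumD ?lte_add_pinfty.
- move=> i; rewrite /p /m {1}(max0_subN (f i)) {1}(max0_subN (g i)); lra.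
Qed.

Lemma tsumN I (f : I -> R) : tsum (fun i => - f i) = - tsum f.
Proof.
rewrite /tsum opprB; congr (_ - fine (nsum _)).
by apply/funext => i; rewrite opprK.
Qed.

Lemma tsumB I (f g : I -> R) : summ f -> summ g ->
  tsum (fun i => f i - g i) = tsum f - tsum g.
Proof. by move=> sf sg; rewrite tsumD ?tsumN//; exact: summN. Qed.

Lemma tsum_ge0 I (f : I -> R) : summ f -> (forall i, 0 <= f i) -> 0 <= tsum f.
Proof. by move=> sf f0; rewrite -lee_fin tsum_ge0E ?nsum_ge0. Qed.

Lemma le_tsum I (f g : I -> R) : summ f -> summ g -> (forall i, f i <= g i) ->
  tsum f <= tsum g.
Proof.
move=> sf sg fg; rewrite -subr_ge0 -tsumB//; apply: tsum_ge0; first exact: summB.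
by move=> i; rewrite subr_ge0.
Qed.

Lemma tsum_norm I (f : I -> R) : summ f -> `|tsum f| <= tsum (fun i => `|f i|).
Proof.
move=> sf; rewrite ler_norml -tsumN; apply/andP; split; apply: le_tsum => //.
- exact/summN/summ_norm.
- by move=> i; rewrite lerNl -normrN ler_norm.
- exact: summ_norm.
- by move=> i; exact: ler_norm.
Qed.

Lemma tsumZ I (f : I -> R) c : summ f -> tsum (fun i => c * f i) = c * tsum f.
Proof.
move=> sf.
wlog c0 : c / 0 < c => [hw|].
  have [c0|/hw//|->] := ltrgtP c 0.
  - have := hw (- c); rewrite oppr_gt0 => /(_ c0).
    by under eq_fun do rewrite mulNr; rewrite tsumN mulNr => /oppr_inj.
  - by rewrite mul0r; under eq_fun do rewrite mul0r; rewrite tsum0.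
(* [nsumZ] is one inequality; the reverse is the same lemma applied to [c * g] with the factor
   [c^-1]. *)
have key (g : I -> R) : (forall i, 0 <= g i) -> (nsum g < +oo)%E ->
    nsum (fun i => c * g i) = (c%:E * nsum g)%E.
  move=> g0 goo; apply/eqP; rewrite eq_le nsumZ ?(ltW c0)//=.
  have g0' i : 0 <= c * g i by rewrite mulr_ge0 ?(ltW c0).
  have cgoo : (nsum (fun i => c * g i)%R < +oo)%E.
    by apply: (summ_ge0 g0').1; apply: summZ; apply/summ_ge0.
  have := @nsumZ _ (fun i => c * g i) c^-1 _ g0' cgoo.
  rewrite (_ : (fun i => c^-1 * (c * g i)) = g); last first.
    by apply/funext => i; rewrite mulKf// gt_eqF.
  rewrite invr_ge0 (ltW c0) => /(_ isT).
  rewrite -(fineK (nsum_fin g0 goo)) -(fineK (nsum_fin g0' cgoo)) -!EFinM !lee_fin.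
  by rewrite mulrC ler_pdivlMr// mulrC.
pose p := fun i : I => Num.max (f i : R) 0; pose m := fun i : I => Num.max (- f i : R) 0.
have p0 i : 0 <= p i by exact: max0_ge0.
have m0 i : 0 <= m i by exact: max0_ge0.
have pf : (nsum p < +oo)%E by exact: summ_pos.
have mf : (nsum m < +oo)%E by exact: summ_neg.
rewrite (@tsum_sub _ _ (fun i => c * p i) (fun i => c * m i)).
- by rewrite (key p)// (key m)// !fineM ?nsum_fin// /tsum -/p -/m /= mulrBr.
- by move=> i; rewrite mulr_ge0 ?(ltW c0).
- by move=> i; rewrite mulr_ge0 ?(ltW c0).
- by rewrite key// -(fineK (nsum_fin p0 pf)) -EFinM ltry.
- by rewrite key// -(fineK (nsum_fin m0 mf)) -EFinM ltry.
- by move=> i; rewrite -mulrBr -max0_subN.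
Qed.

(** Reindexing along an injection whose range contains the support covers bijections, the successor
    on [nat] and the embedding of [nat] in [int] at once. *)
Lemma nsum_supp I J (h : I -> J) (f : J -> R) : injective h ->
  (forall j, 0 <= f j) -> (forall j, (forall i, h i != j) -> f j = 0) ->
  nsum f = nsum (fun i => f (h i)).
Proof.
move=> ih f0 supp; rewrite /nsum.
rewrite (esumID (range h)); last by move=> j _; rewrite lee_fin.
rewrite setTI [X in (_ + X)%E]esum1 ?adde0; last first.
  move=> j [_ nj] /=; rewrite supp// => i; apply/eqP => hij; apply: nj.
  by exists i.
rewrite (@reindex_esum R I J setT (range h) h)//; split => //.
  by move=> x y _ _; exact: ih.
Qed.

Lemma summ_supp I J (h : I -> J) (f : J -> R) : injective h ->
  (forall j, (forall i, h i != j) -> f j = 0) ->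
  summ f <-> summ (fun i => f (h i)).
Proof.
by move=> ih f0; rewrite /summ (nsum_supp ih)// => j /f0 ->; rewrite normr0.
Qed.

Lemma tsum_supp I J (h : I -> J) (f : J -> R) : injective h ->
  (forall j, (forall i, h i != j) -> f j = 0) ->
  tsum f = tsum (fun i => f (h i)).
Proof.
move=> ih f0; rewrite /tsum !(nsum_supp ih)//; do ?by move=> j; exact: max0_ge0.
- by move=> j /f0 ->; rewrite oppr0 maxxx.
- by move=> j /f0 ->; rewrite maxxx.
Qed.

Lemma bij_surj_supp I J (h : I -> J) (f : J -> R) : bijective h ->
  forall j, (forall i, h i != j) -> f j = 0.
Proof. by case=> g _ hg j /(_ (g j)); rewrite hg eqxx. Qed.

Lemma summ_bij I J (h : I -> J) (f : J -> R) : bijective h ->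
  summ f <-> summ (fun i => f (h i)).
Proof. by move=> bh; apply: (summ_supp (bij_inj bh)); exact: bij_surj_supp. Qed.

Lemma tsum_bij I J (h : I -> J) (f : J -> R) : bijective h ->
  tsum f = tsum (fun i => f (h i)).
Proof. by move=> bh; apply: (tsum_supp (bij_inj bh)); exact: bij_surj_supp. Qed.

Lemma nsum_seq I (f : I -> R) (s : seq I) : uniq s -> (forall i, 0 <= f i) ->
  (forall i, i \notin s -> f i = 0) -> nsum f = (\sum_(i <- s) f i)%:E.
Proof.
move=> us f0 fs; rewrite /nsum (esumID [set` s]); last by move=> j _; rewrite lee_fin.
rewrite setTI [X in (_ + X)%E]esum1 ?adde0; last first.
  by move=> j [_ /negP nj] /=; rewrite fs.
rewrite esum_fset//; last by move=> i _; rewrite lee_fin.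
by rewrite -sumEFin -fsbig_seq.
Qed.

Lemma summ_seq I (f : I -> R) (s : seq I) : uniq s ->
  (forall i, i \notin s -> f i = 0) -> summ f.
Proof.
by move=> us fs; rewrite /summ (nsum_seq us) ?ltry// => i /fs ->; rewrite normr0.
Qed.

Lemma tsum_seq I (f : I -> R) (s : seq I) : uniq s ->
  (forall i, i \notin s -> f i = 0) -> tsum f = \sum_(i <- s) f i.
Proof.
move=> us fs; rewrite /tsum !(nsum_seq us)//; do ?by move=> i; exact: max0_ge0.
- rewrite /= -sumrB; apply: eq_bigr => i _; exact/esym/max0_subN.
- by move=> i /fs ->; rewrite oppr0 maxxx.
- by move=> i /fs ->; rewrite maxxx.
Qed.

Lemma tsum1 I (f : I -> R) (j : I) : (forall i, i != j -> f i = 0) -> tsum f = f j.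
Proof.
move=> fj; rewrite (@tsum_seq _ f [:: j])// ?big_seq1// => i.
by rewrite inE => /fj.
Qed.

Lemma nsum_pair I J (f : I * J -> R) : (forall p, 0 <= f p) ->
  nsum f = esum setT (fun i => nsum (fun j => f (i, j))).
Proof.
move=> f0; rewrite /nsum (@esum_esum R I J setT (fun=> setT) (fun i j => (f (i, j))%:E)).
  rewrite (_ : setT `*`` (fun=> setT) = setT :> set (I * J)).
    by apply: eq_esum => -[i j].
  by apply/seteqP; split.
by move=> i j _ _; rewrite lee_fin.
Qed.

Lemma summ_row I J (f : I * J -> R) i : summ f -> summ (fun j => f (i, j)).
Proof.
move=> sf; apply: le_lt_trans sf; rewrite nsum_pair//.
set F := (X in (_ <= esum _ X)%E); rewrite -[leLHS]/(F i).
apply: esum_ge; exists [set i]; first by split=> //; exact: finite_set1.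
by rewrite fsbig_set1.
Qed.

Lemma nsum_pair_fin I J (f : I * J -> R) : (forall p, 0 <= f p) -> summ f ->
  nsum f = nsum (fun i => tsum (fun j => f (i, j))).
Proof.
move=> f0 sf; rewrite nsum_pair//; apply: eq_esum => i _ /=.
by rewrite tsum_ge0E//; exact: summ_row.
Qed.

Lemma summ_tsum I J (f : I * J -> R) : summ f ->
  summ (fun i => tsum (fun j => f (i, j))).
Proof.
move=> sf; have sf' := summ_norm sf.
apply: (le_lt_trans _ sf); rewrite [leRHS]nsum_pair_fin//.
by apply: le_nsum => i; apply: tsum_norm; exact: summ_row.
Qed.

Lemma tsum_pair I J (f : I * J -> R) : summ f ->
  tsum f = tsum (fun i => tsum (fun j => f (i, j))).
Proof.
move=> sf.
pose p := fun i => Num.max (f i : R) 0; pose m := fun i => Num.max (- f i : R) 0.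
have p0 i : 0 <= p i by exact: max0_ge0.
have m0 i : 0 <= m i by exact: max0_ge0.
have sp : summ p by apply/summ_ge0 => //; exact: summ_pos.
have sm : summ m by apply/summ_ge0 => //; exact: summ_neg.
have P0 i : 0 <= tsum (fun j => p (i, j)) by apply: tsum_ge0 => //; exact: summ_row.
have M0 i : 0 <= tsum (fun j => m (i, j)) by apply: tsum_ge0 => //; exact: summ_row.
rewrite [RHS](@tsum_sub _ _ (fun i => tsum (fun j => p (i, j))) (fun i => tsum (fun j => m (i, j)))) => //.
- by rewrite -!nsum_pair_fin.
- by rewrite -nsum_pair_fin//; exact: summ_pos.
- by rewrite -nsum_pair_fin//; exact: summ_neg.
- move=> i; rewrite -tsumB; [|exact: summ_row..].
  by apply: eq_tsum => j; rewrite /p /m -max0_subN.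
Qed.

Lemma summ_pair I J (f : I * J -> R) : (forall i, summ (fun j => f (i, j))) ->
  summ (fun i => tsum (fun j => `|f (i, j)|)) -> summ f.
Proof.
move=> srow stot; rewrite /summ nsum_pair//.
rewrite (eq_esum (b := fun i => (tsum (fun j => `|f (i, j)|))%:E)).
  apply/(summ_ge0 _).1; last exact: stot.
  by move=> i; apply: tsum_ge0 => //; exact: summ_norm.
by move=> i _; rewrite tsum_ge0E//; exact: summ_norm.
Qed.

Lemma summ_prod I J (f : I -> R) (g : J -> R) : summ f -> summ g ->
  summ (fun p : I * J => f p.1 * g p.2).
Proof.
move=> sf sg; apply: summ_pair => /= [i|]; first exact: summZ.
have -> : (fun i => tsum (fun j => `|f i * g j|)) =
    (fun i => `|f i| * tsum (fun j => `|g j|)).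
  apply/funext => i; rewrite -tsumZ; last exact: summ_norm.
  by apply: eq_tsum => j; rewrite normrM.
by apply: summZr; exact: summ_norm.
Qed.

Lemma swap_bij I J : bijective (fun p : I * J => (p.2, p.1)).
Proof. by exists (fun p => (p.2, p.1)) => -[]. Qed.

Lemma tsum_exchange I J (f : I -> J -> R) : summ (fun p : I * J => f p.1 p.2) ->
  tsum (fun i => tsum (f i)) = tsum (fun j => tsum (f ^~ j)).
Proof.
move=> sf; rewrite -(tsum_pair sf) (tsum_bij _ (swap_bij J I)) tsum_pair//.
by apply: (summ_bij _ (swap_bij J I)).1 sf.
Qed.

Lemma tsum_nat (f : nat -> R) : summ f -> series f @ \oo --> tsum f.
Proof.
move=> sf.
have key (g : nat -> R) : (forall i, 0 <= g i) -> summ g ->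
    series g @ \oo --> tsum g.
  move=> g0 sg.
  have sg' : summable [set: nat] (EFin \o g) by [].
  have cg : cvgn (series g).
    have := @summable_cvg R xpredT (EFin \o g).
    apply => [i _|]; first by rewrite lee_fin.
    by rewrite -[X in summable X _]/[set` xpredT] set_true.
  suff -> : tsum g = limn (series g) by [].
  apply: EFin_inj; rewrite tsum_ge0E//.
  rewrite /nsum -nneseries_esumT; last by move=> i; rewrite lee_fin.
  by rewrite -EFin_lim//; congr (limn _); apply/funext => n /=; rewrite /series/= sumEFin.
pose p := fun i => Num.max (f i : R) 0; pose m := fun i => Num.max (- f i : R) 0.
have p0 i : 0 <= p i by exact: max0_ge0.
have m0 i : 0 <= m i by exact: max0_ge0.
have sp : summ p by apply/summ_ge0 => //; exact: summ_pos.
have sm : summ m by apply/summ_ge0 => //; exact: summ_neg.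
have -> : f = p \- m by apply/funext => i; exact: max0_subN.
have -> : series (p \- m) = series p \- series m.
  by apply/funext => n; rewrite /series /= sumrB.
by rewrite tsumB//; apply: cvgB; exact: key.
Qed.

Lemma summ_nat_bound (f : nat -> R) (M : R) :
  (forall n, \sum_(0 <= i < n) `|f i| <= M) -> summ f.
Proof.
move=> fM; rewrite /summ /nsum -nneseries_esumT; last by move=> i; rewrite lee_fin.
apply: (@le_lt_trans _ _ M%:E); last exact: ltry.
apply: lime_le; first by apply: is_cvg_nneseries => i _ _; rewrite lee_fin.
by apply: nearW => n; rewrite sumEFin lee_fin.
Qed.

Lemma tsum_telescope (f g : nat -> R) : summ f -> (forall i, f i = g i.+1 - g i) ->
  g @ \oo --> 0 -> tsum f = - g 0%N.
Proof.
move=> sf fE g0; have := tsum_nat sf.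
have -> : series f = (fun n => g n - g 0%N).
  by apply/funext => n; rewrite /series /= (eq_bigr _ (fun i _ => fE i)) telescope_sumr.
move=> h; have h2 : (fun n => g n - g 0%N) @ \oo --> 0 - g 0%N.
  by apply: cvgB => //; exact: cvg_cst.
by rewrite sub0r in h2; exact: (cvg_unique _ h h2).
Qed.

Lemma le_seq_tsum I (f : I -> R) (s : seq I) : uniq s -> summ f -> (forall i, 0 <= f i) ->
  \sum_(i <- s) f i <= tsum f.
Proof.
move=> us sf f0; rewrite -lee_fin tsum_ge0E// -sumEFin.
apply: esum_ge; exists [set` s]; first by split=> //; exact: finite_seq.
by rewrite -fsbig_seq.
Qed.

Lemma term_le_tsum I (f : I -> R) (i : I) : summ f -> (forall i, 0 <= f i) ->
  f i <= tsum f.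
Proof. by move=> sf f0; have := @le_seq_tsum I f [:: i] isT sf f0; rewrite big_seq1. Qed.

End tsum.

(** * Convolution of two-sided sequences *)

Section conv.
Context {R : realType}.
Implicit Types x y z : int -> R.

(** A sequence stands for its Fourier series: [conv] is the product, [rev] is conjugation on the
    unit circle, and [causal] means that only nonnegative powers occur. *)
Definition conv x y (k : int) : R := tsum (fun i => x i * y (k - i)).

Definition rev x (k : int) : R := x (- k).

Definition delta (k : int) : R := (k == 0)%:R.

Definition causal x := forall k : int, k < 0 -> x k = 0.

Definition l2 x := summ (fun k => x k ^+ 2).

Lemma shift_bij (k : int) : bijective (fun i : int => i + k).
Proof. by exists (fun i => i - k) => i; rewrite ?addrK ?subrK. Qed.

Lemma refl_bij (k : int) : bijective (fun i : int => k - i).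
Proof. by exists (fun i => k - i) => i; rewrite subKr. Qed.

Lemma opp_bij : bijective (fun i : int => - i).
Proof. by exists (fun i => - i) => i; rewrite opprK. Qed.

Lemma revK x : rev (rev x) = x.
Proof. by apply/funext => k; rewrite /rev opprK. Qed.

Lemma convC x y : conv x y = conv y x.
Proof.
apply/funext => k; rewrite /conv (tsum_bij _ (refl_bij k)).
by apply: eq_tsum => i; rewrite subKr mulrC.
Qed.

Lemma rev_conv x y : rev (conv x y) = conv (rev x) (rev y).
Proof.
apply/funext => k; rewrite /rev /conv (tsum_bij _ opp_bij).
by apply: eq_tsum => i; rewrite opprB addrC opprK.
Qed.

Lemma conv_delta x : conv delta x = x.
Proof.
apply/funext => k; rewrite /conv (@tsum1 _ _ _ 0).
  by rewrite /delta eqxx mul1r subr0.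
by move=> i /negPf i0; rewrite /delta i0 mul0r.
Qed.

Lemma summ_mul_l2 (I : choiceType) (f g : I -> R) :
  summ (fun i => f i ^+ 2) -> summ (fun i => g i ^+ 2) -> summ (fun i => f i * g i).
Proof.
move=> sf sg; apply: (summ_le (g := fun i => f i ^+ 2 + g i ^+ 2)).
  move=> i; rewrite [leRHS]ger0_norm ?addr_ge0 ?sqr_ge0// ler_norml; nra.
exact: summD.
Qed.

Lemma l2_shift x k : l2 x -> l2 (fun i => x (i + k)).
Proof. by move=> hx; apply: (summ_bij _ (shift_bij k)).1 hx. Qed.

Lemma l2_rev x : l2 x -> l2 (rev x).
Proof. by move=> hx; apply: (summ_bij _ opp_bij).1 hx. Qed.

Lemma summ_rev x : summ x -> summ (rev x).
Proof. by move=> hx; apply: (summ_bij _ opp_bij).1 hx. Qed.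

Lemma l2_refl x k : l2 x -> l2 (fun i => x (k - i)).
Proof. by move=> hx; apply: (summ_bij _ (refl_bij k)).1 hx. Qed.

Lemma summ_conv_term x y k : l2 x -> l2 y -> summ (fun i => x i * y (k - i)).
Proof. by move=> hx hy; apply: summ_mul_l2 => //; exact: l2_refl. Qed.

Lemma summ_mul_bounded (I : choiceType) (f g : I -> R) M :
  summ f -> (forall i, `|g i| <= M) -> summ (fun i => f i * g i).
Proof.
move=> sf gM; apply: (summ_le (g := fun i => f i * M)); last exact: summZr.
by move=> i; rewrite !normrM ler_wpM2l// (le_trans (gM i))// ler_norm.
Qed.

Lemma summ_bounded (I : choiceType) (f : I -> R) : summ f ->
  exists2 M, 0 <= M & forall i, `|f i| <= M.
Proof.
move=> sf; exists (tsum (fun i => `|f i|)).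
  by apply: tsum_ge0 => //; exact: summ_norm.
by move=> i; apply: (@term_le_tsum R I (fun i => `|f i|)) => //; exact: summ_norm.
Qed.

Lemma summ_l2 x : summ x -> l2 x.
Proof. by move=> sx; have [M _ xM] := summ_bounded sx; exact: summ_mul_bounded xM. Qed.

(** Joint absolute summability of a triple convolution at [k]. Products of square summable sequences
    are merely bounded, so associativity is not automatic; this condition is invariant under
    permuting the factors. *)
Definition tri x y z k := summ (fun p : int * int => x p.1 * y p.2 * z (k - p.1 - p.2)).

Lemma shear_bij : bijective (fun p : int * int => (p.2, p.1 - p.2)).
Proof. by exists (fun p => (p.1 + p.2, p.1)) => -[i j] /=; congr (_, _); ring. Qed.

Lemma conv_assoc_at x y z k : tri x y z k ->
  (forall i, summ (fun j => y j * z (k - i - j))) ->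
  (forall m, summ (fun i => x i * y (m - i))) ->
  conv (conv x y) z k = conv x (conv y z) k.
Proof.
move=> h hyz hxy; rewrite /conv.
have h' : summ (fun p : int * int => x p.2 * y (p.1 - p.2) * z (k - p.1)).
  have := (summ_bij _ shear_bij).1 h.
  congr summ; apply/funext => -[i j] /=; congr (_ * z _); ring.
rewrite (eq_tsum (g := fun m => tsum (fun i => x i * y (m - i) * z (k - m)))); last first.
  move=> m; rewrite mulrC -tsumZ//; apply: eq_tsum => i; ring.
rewrite (tsum_exchange h') /=; apply: eq_tsum => i.
rewrite -tsumZ// (tsum_bij _ (shift_bij i)).
by apply: eq_tsum => j; rewrite addrK opprD mulrA (addrC (- j)) addrA.
Qed.

(** For fixed [j] the absolute sum over [i] of [x i * z (k - i - j)] is at most [M], uniformly in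
    [j], because |u w| <= u^2 + w^2; the summable factor [y] is summed last. *)
Lemma tri_l1_mid x y z k : l2 x -> summ y -> l2 z -> tri x y z k.
Proof.
move=> hx hy hz; apply: (summ_bij _ (swap_bij _ _)).2 => /=.
have hrow j : summ (fun i => x i * z (k - j - i)) by exact: summ_conv_term.
apply: summ_pair => /=.
  move=> j; have := summZ (y j) (hrow j); congr summ; apply/funext => i.
  by rewrite (_ : k - j - i = k - i - j); [ring|ring].
pose M := tsum (fun i => x i ^+ 2) + tsum (fun i => z i ^+ 2).
apply: (summ_le (g := fun j => y j * M)); last exact: summZr.
move=> j; rewrite ger0_norm; last first.
  apply: tsum_ge0 => //; apply: summ_norm; have := summZ (y j) (hrow j); congr summ; apply/funext => i.
  by rewrite (_ : k - j - i = k - i - j); [ring|ring].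
rewrite (eq_tsum (g := fun i => `|y j| * `|x i * z (k - j - i)|)); last first.
  move=> i; rewrite -normrM; congr `|_|; rewrite (_ : k - j - i = k - i - j); ring.
rewrite tsumZ; last exact/summ_norm.
rewrite normrM ler_wpM2l// (le_trans _ (ler_norm _))//.
rewrite /M (tsum_bij (fun i => z i ^+ 2) (refl_bij (k - j))) -tsumD//; last exact: (l2_refl (k - j) hz).
apply: le_tsum; first exact/summ_norm.
  by apply: summD => //; exact: (l2_refl (k - j) hz).
move=> i; rewrite ler_norml; nra.
Qed.

Lemma tri_swap12 x y z k : tri x y z k -> tri y x z k.
Proof.
move=> h; apply: (summ_bij _ (swap_bij _ _)).2 => /=.
by move: h; congr summ; apply/funext => -[i j] /=; rewrite (mulrC (x i)) addrAC.
Qed.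

Lemma tri_swap23 x y z k : tri x y z k -> tri x z y k.
Proof.
have bij : bijective (fun p : int * int => (p.1, k - p.1 - p.2)).
  by exists (fun p => (p.1, k - p.1 - p.2)) => -[i j] /=; congr (_, _); ring.
move=> h; apply: (summ_bij _ bij).2 => /=.
by move: h; congr summ; apply/funext => -[i j] /=; rewrite subKr mulrAC.
Qed.

Lemma tri_l1_left x y z k : summ x -> l2 y -> l2 z -> tri x y z k.
Proof. by move=> hx hy hz; exact/tri_swap12/tri_l1_mid. Qed.

Lemma tri_l1_right x y z k : l2 x -> l2 y -> summ z -> tri x y z k.
Proof. by move=> hx hy hz; exact/tri_swap23/tri_l1_mid. Qed.

Lemma summ_delta : summ delta.
Proof.
by apply: (summ_seq (s := [:: 0])) => // i; rewrite inE /delta => /negPf ->.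
Qed.

Lemma convA_tri x y z : (forall k, tri x y z k) -> l2 x -> l2 y -> l2 z ->
  conv (conv x y) z = conv x (conv y z).
Proof.
move=> h hx hy hz; apply/funext => k; apply: conv_assoc_at => //.
- by move=> i; exact: summ_conv_term.
- by move=> i; exact: summ_conv_term.
Qed.

Lemma convA_mid x y z : l2 x -> summ y -> l2 z ->
  conv (conv x y) z = conv x (conv y z).
Proof.
move=> hx hy hz; apply: convA_tri => // [k|]; first exact: tri_l1_mid.
exact: summ_l2.
Qed.

Lemma convA_left x y z : summ x -> l2 y -> l2 z ->
  conv (conv x y) z = conv x (conv y z).
Proof.
move=> hx hy hz; apply: convA_tri => // [k|]; last exact: summ_l2.
exact: tri_l1_left.
Qed.

Lemma convA_right x y z : l2 x -> l2 y -> summ z ->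
  conv (conv x y) z = conv x (conv y z).
Proof.
move=> hx hy hz; apply: convA_tri => // [k|]; last exact: summ_l2.
exact: tri_l1_right.
Qed.

Lemma convA_l1_bounded x y z M : summ x -> summ y -> (forall i, `|z i| <= M) ->
  conv (conv x y) z = conv x (conv y z).
Proof.
move=> hx hy hz; apply/funext => k; apply: conv_assoc_at.
- apply: (summ_le (g := fun p : int * int => x p.1 * y p.2 * M)).
    by move=> p; rewrite !normrM ler_wpM2l ?mulr_ge0// (le_trans (hz _))// ler_norm.
  by apply: summZr; exact: summ_prod.
- by move=> i; apply: summ_mul_bounded => // j.
- move=> m; apply: (@summ_conv_term x y m); exact: summ_l2.
Qed.

Lemma summ_conv x y : summ x -> summ y -> summ (conv x y).
Proof.
move=> hx hy; have h := summ_prod hx hy.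
have := summ_tsum ((summ_bij _ shear_bij).1 h) => /=; exact.
Qed.

Lemma conv_causal x y : causal x -> causal y -> causal (conv x y).
Proof.
move=> hx hy k k0; rewrite /conv -(tsum0 int); apply: eq_tsum => i.
have [i0|i0] := ltP i 0; first by rewrite hx ?mul0r.
by rewrite hy ?mulr0//; lia.
Qed.

Lemma conv_causal0 x y : causal x -> causal y -> conv x y 0 = x 0 * y 0.
Proof.
move=> hx hy; rewrite /conv (@tsum1 _ _ _ 0) ?subr0// => i i0.
have [i1|i1] := ltP i 0; first by rewrite hx ?mul0r.
by rewrite (hy (0 - i)) ?mulr0//; lia.
Qed.

Lemma conv_causalE x y (n : nat) : causal x -> causal y ->
  conv x y n%:Z = \sum_(0 <= i < n.+1) x i%:Z * y (n - i)%N%:Z.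
Proof.
move=> hx hy; rewrite /conv (@tsum_seq _ _ _ [seq (i%:Z : int) | i <- iota 0 n.+1]).
- rewrite big_map /index_iota subn0 !big_seq; apply: eq_bigr => i.
  by rewrite mem_iota => ilt; congr (_ * y _); lia.
- by rewrite map_inj_uniq ?iota_uniq// => i j [].
- move=> i; have [i1|i1] := ltP i 0; first by rewrite hx ?mul0r.
  have [ni|ni] := ltP n%:Z i; first by rewrite (hy (_ - _)) ?mulr0//; lia.
  move=> /mapP; case; exists `|i|%N; last lia.
  by rewrite mem_iota; lia.
Qed.

Lemma convDr x y z k : summ (fun i => z i * x (k - i)) -> summ (fun i => z i * y (k - i)) ->
  conv z (fun i => x i + y i) k = conv z x k + conv z y k.
Proof. by move=> hx hy; rewrite /conv -tsumD//; apply: eq_tsum => i; rewrite mulrDr. Qed.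

Lemma convZr x y c k : summ (fun i => x i * y (k - i)) ->
  conv x (fun i => c * y i) k = c * conv x y k.
Proof. by move=> h; rewrite /conv -tsumZ//; apply: eq_tsum => i; rewrite mulrCA. Qed.

Lemma conv_phase a c : summ a -> l2 c -> conv a c = delta ->
  conv c (conv (rev c) a) = rev c.
Proof.
move=> sa sc ac; have src := l2_rev sc.
by rewrite (convC (rev c)) -convA_mid// (convC c a) ac conv_delta.
Qed.

Lemma conv_rev_nat x y k : causal x ->
  conv (rev x) y k = tsum (fun n : nat => x n * y (k + n)).
Proof.
move=> hx; rewrite /conv (tsum_bij _ opp_bij) /rev.
rewrite (tsum_supp (h := Posz)); first by apply: eq_tsum => n; rewrite !opprK.
  by move=> i j [].
by move=> [j /(_ j)|j _]; [rewrite eqxx|rewrite opprK hx ?mul0r].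
Qed.

End conv.

Arguments delta {R}.

(** * Predictors from a pair of one-sided sequences *)

Section predictor.
Context {R : realType}.
Implicit Types x y z : int -> R.

Lemma conv_bounded x y : l2 x -> l2 y -> exists M, forall k, `|conv x y k| <= M.
Proof.
move=> hx hy; exists (tsum (fun i => x i ^+ 2) + tsum (fun i => y i ^+ 2)) => k.
apply: le_trans (tsum_norm (summ_conv_term k hx hy)) _.
rewrite (tsum_bij (fun i => y i ^+ 2) (refl_bij k)) -tsumD//; last exact: (l2_refl k hy).
apply: le_tsum; first exact/summ_norm/summ_conv_term.
  by apply: summD => //; exact: (l2_refl k hy).
move=> i; rewrite ler_norml; nra.
Qed.

Lemma tri_summ_conv x y z k : tri x y z k ->
  (forall i, summ (fun j => y j * z (k - i - j))) ->
  summ (fun i => x i * conv y z (k - i)).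
Proof.
move=> h hyz; have := summ_tsum h => /=; congr summ; apply/funext => i.
by rewrite /conv -tsumZ//; apply: eq_tsum => j; rewrite mulrA.
Qed.

Lemma convDr_tri x y z y' z' : l2 x -> l2 y -> l2 z -> l2 y' -> l2 z' ->
  (forall k, tri x y z k) -> (forall k, tri x y' z' k) ->
  conv x (fun k => conv y z k + conv y' z' k) =
  (fun k => conv x (conv y z) k + conv x (conv y' z') k).
Proof.
move=> hx hy hz hy' hz' t t'; apply/funext => k; rewrite convDr//.
- by apply: tri_summ_conv => // i; exact: summ_conv_term.
- by apply: tri_summ_conv => // i; exact: summ_conv_term.
Qed.

(* With [a], [c], [F], [G] read as Fourier series and [c = 1 / a], the sequence
   [p = G / c + F / conj c] is at once [a U], hence causal, and [V / conj c],
   hence supported below [n]. *)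
Variables (a c F G : int -> R) (n : nat).
Hypotheses (ca : causal a) (cc : causal c) (sa : summ a) (sc : l2 c).
Hypothesis ac : conv a c = delta.
Let phi := conv (rev c) a.
Hypotheses (sphi : l2 phi) (sF : l2 F) (sG : l2 G).
(** None of these three sequences is assumed summable, so this associativity cannot come from an l1
    factor. *)
Hypothesis tF : forall k, tri (rev c) (rev phi) F k.
Hypothesis suppG : forall k, 0 < k -> G k = 0.
Hypothesis suppF : forall k, k < n%:Z -> F k = 0.
Let U k := G k + conv (rev phi) F k.
Let V k := conv phi G k + F k.
Hypothesis hU : causal U.
Hypothesis hV : forall k, n%:Z <= k -> V k = 0.
Let p k := conv a G k + conv (rev a) F k.

Let la : l2 a := summ_l2 sa.
Let lra : l2 (rev a) := l2_rev la.

Let rev_phiE : rev phi = conv c (rev a).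
Proof. by rewrite /phi rev_conv revK. Qed.

Let a_rev_phi : conv a (rev phi) = rev a.
Proof. by rewrite rev_phiE -convA_left// ac conv_delta. Qed.

Let rev_a_phi : conv (rev a) phi = a.
Proof. by rewrite -[phi]revK -rev_conv a_rev_phi revK. Qed.

Let l2phir : l2 (rev phi) := l2_rev sphi.

Let p_aU : p = conv a U.
Proof.
have -> : U = fun k => conv delta G k + conv (rev phi) F k by rewrite conv_delta.
rewrite convDr_tri//; last 3 first.
- exact/summ_l2/summ_delta.
- by move=> k; apply: tri_l1_left => //; exact/summ_l2/summ_delta.
- by move=> k; exact: tri_l1_left.
by rewrite conv_delta -[conv a (conv _ F)]convA_left// a_rev_phi.
Qed.

Let p_aV : p = conv (rev a) V.
Proof.
have -> : V = fun k => conv phi G k + conv delta F k by rewrite conv_delta.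
rewrite convDr_tri//; last 3 first.
- exact/summ_l2/summ_delta.
- by move=> k; apply: tri_l1_left => //; exact: summ_rev.
- by move=> k; apply: tri_l1_left => //; [exact: summ_rev|exact/summ_l2/summ_delta].
by rewrite conv_delta -convA_left//; [rewrite rev_a_phi|exact: summ_rev].
Qed.

Lemma predictor_causal : causal p.
Proof. by rewrite p_aU; exact: conv_causal. Qed.

Lemma predictor_supp k : n%:Z <= k -> p k = 0.
Proof.
move=> nk; rewrite p_aV /conv -(tsum0 int); apply: eq_tsum => i.
have [i0|i0] := leP i 0; last by rewrite /rev ca ?mul0r//; lia.
by rewrite hV ?mulr0//; lia.
Qed.

Lemma predictor0 : p 0 = a 0 * U 0.
Proof. by rewrite p_aU conv_causal0. Qed.

Let sp : summ p.
Proof.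
apply: (summ_seq (s := [seq (i%:Z : int) | i <- iota 0 n])).
  by rewrite map_inj_uniq ?iota_uniq// => i j [].
move=> i; have [i0 _|i0] := ltP i 0; first by rewrite predictor_causal.
have [ni _|ni] := leP n%:Z i; first by rewrite predictor_supp.
by move=> /mapP; case; exists `|i|%N; [rewrite mem_iota|]; lia.
Qed.

Let c_p : conv c p = U.
Proof.
rewrite /p convDr_tri//.
- rewrite -!convA_mid//; last exact: summ_rev.
  by rewrite (convC c a) ac conv_delta -rev_phiE.
- by move=> k; exact: tri_l1_mid.
- by move=> k; apply: tri_l1_mid => //; exact: summ_rev.
Qed.

Let lrc : l2 (rev c) := l2_rev sc.

Let c_phi : conv c phi = rev c.
Proof.
rewrite /phi (convC (rev c)) -convA_mid// (convC c a) ac.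
exact: conv_delta.
Qed.

Let rev_c_phi : conv (rev c) (rev phi) = c.
Proof. by rewrite -rev_conv c_phi revK. Qed.

(** [rev c] and [G] live on nonpositive indices, [c] on nonnegative ones and [F] on indices >= n.
    Hence the first term vanishes for k > 0 and the second for k < n, which yields the normal
    equations strictly between 0 and n and single products at both ends. *)
Lemma gamma_predictor k :
  conv (conv (rev c) c) p k = conv (rev c) G k + conv c F k.
Proof.
rewrite convA_right// c_p.
have -> : U = fun k => conv delta G k + conv (rev phi) F k by rewrite conv_delta.
rewrite convDr_tri//; last 2 first.
- exact/summ_l2/summ_delta.
- by move=> j; apply: tri_l1_mid => //; exact: summ_delta.
by rewrite conv_delta -[conv (rev c) (conv _ F)]convA_tri// rev_c_phi.
Qed.

Lemma gamma_predictor0 : (0 < n)%N -> conv (conv (rev c) c) p 0 = c 0 * G 0.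
Proof.
move=> n0; rewrite gamma_predictor /conv [X in X + _](@tsum1 _ _ _ 0); last first.
  move=> i i0; have [i1|i1] := ltP i 0; first by rewrite suppG ?mulr0//; lia.
  by rewrite /rev cc ?mul0r//; lia.
rewrite /rev subr0 oppr0 -[RHS]addr0; congr (_ + _).
rewrite -(tsum0 int); apply: eq_tsum => i.
have [i1|i1] := ltP i 0; first by rewrite cc ?mul0r.
by rewrite suppF ?mulr0//; lia.
Qed.

Lemma gamma_predictor_in k : 0 < k -> k < n%:Z -> conv (conv (rev c) c) p k = 0.
Proof.
move=> k0 kn; rewrite gamma_predictor /conv -[RHS]addr0; congr (_ + _).
  rewrite -(tsum0 int); apply: eq_tsum => i.
  have [i1|i1] := ltP 0 i; first by rewrite /rev cc ?mul0r//; lia.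
  by rewrite suppG ?mulr0//; lia.
rewrite -(tsum0 int); apply: eq_tsum => i.
have [i1|i1] := ltP i 0; first by rewrite cc ?mul0r.
by rewrite suppF ?mulr0//; lia.
Qed.

Lemma gamma_predictor_n : (0 < n)%N ->
  conv (conv (rev c) c) p n%:Z = c 0 * F n%:Z.
Proof.
move=> n0; rewrite gamma_predictor /conv -[RHS]add0r; congr (_ + _).
  rewrite -(tsum0 int); apply: eq_tsum => i.
  have [i1|i1] := ltP 0 i; first by rewrite /rev cc ?mul0r//; lia.
  by rewrite suppG ?mulr0//; lia.
rewrite (@tsum1 _ _ _ 0) ?subr0// => i i0.
have [i1|i1] := ltP i 0; first by rewrite cc ?mul0r.
by rewrite suppF ?mulr0//; lia.
Qed.

End predictor.

(** * Contractions for a weighted sup norm *)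

Section fixpoint.
Context {R : realType}.
Implicit Types (b : nat -> nat -> R) (x y v r : nat -> R).

Lemma tsum_natS (f : nat -> R) : summ f -> tsum f = f 0%N + tsum (fun i => f i.+1).
Proof.
move=> sf.
have s1 : summ (fun i => if i is 0%N then f 0%N else 0).
  by apply: (summ_seq (s := [:: 0%N])) => // -[|i].
have s2 : summ (fun i => if i is 0%N then 0 else f i).
  by apply: summ_le sf => -[|i] //; rewrite normr0.
rewrite (eq_tsum (g := fun i => (if i is 0%N then f 0%N else 0) + (if i is 0%N then 0 else f i))); last first.
  by case=> [|i]; rewrite ?addr0 ?add0r.
rewrite tsumD// (@tsum1 _ _ _ 0%N); last by case.
congr (_ + _); rewrite (tsum_supp (h := S))//; first by move=> i j [].
by move=> [|j] // /(_ j); rewrite eqxx.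
Qed.

Lemma sum_geometric_le (q : R) n : 0 <= q < 1 -> \sum_(0 <= i < n) q ^+ i <= (1 - q)^-1.
Proof.
move=> /andP[q0 q1]; have q1' : 0 < 1 - q by rewrite subr_gt0.
rewrite -(ler_pM2l q1') mulfV ?gt_eqF//.
have -> : (1 - q) * \sum_(0 <= i < n) q ^+ i = 1 - q ^+ n.
  elim: n => [|n ih]; first by rewrite big_geq// mulr0 expr0 subrr.
  by rewrite big_nat_recr//= mulrDr ih exprS; ring.
by rewrite gerBl exprn_ge0.
Qed.

Lemma summ_geometric (q : R) : 0 <= q < 1 -> summ (fun i : nat => q ^+ i).
Proof.
move=> hq; apply: (@summ_nat_bound _ _ (1 - q)^-1) => n.
rewrite (eq_bigr (fun i => q ^+ i)) ?sum_geometric_le// => i _.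
by rewrite ger0_norm// exprn_ge0//; case/andP: hq.
Qed.

Definition kap b x i : R := tsum (fun j => b i j * x j).

(** As in Schur's test: the kernel |b| has operator norm at most [q] for the norm sup |x i| / v
    i. *)
Definition schur (q : R) b v := forall i,
  summ (fun j => b i j * v j) /\ tsum (fun j => `|b i j * v j|) <= q * v i.

Variable v : nat -> R.
Hypothesis v0 : forall i, 0 < v i.

Lemma summ_kap q b x K i : schur q b v -> (forall i, `|x i| <= K * v i) ->
  summ (fun j => b i j * x j).
Proof.
move=> hb hx; apply: (summ_le (g := fun j => K * (b i j * v j))); last first.
  by apply: summZ; case: (hb i).
move=> j; rewrite mulrCA !normrM ler_wpM2l// (le_trans (hx j))//.
by rewrite (gtr0_norm (v0 j)) ler_wpM2r ?ler_norm// ltW.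
Qed.

Lemma kap_le q b x K : 0 <= K -> schur q b v -> (forall i, `|x i| <= K * v i) ->
  forall i, `|kap b x i| <= q * K * v i.
Proof.
move=> K0 hb hx i; have [sb tb] := hb i.
apply: le_trans (tsum_norm (summ_kap _ hb hx)) _.
apply: (@le_trans _ _ (tsum (fun j => K * `|b i j * v j|))).
  apply: le_tsum.
  - exact/summ_norm/(summ_kap _ hb hx).
  - exact/summZ/summ_norm.
  - move=> j; rewrite !normrM mulrCA ler_wpM2l// (gtr0_norm (v0 j)); exact: hx.
rewrite tsumZ; last exact: summ_norm.
by rewrite (mulrC q) -mulrA ler_wpM2l.
Qed.

Lemma kapB q b x y K L i : schur q b v -> (forall i, `|x i| <= K * v i) ->
  (forall i, `|y i| <= L * v i) ->
  kap b (fun j => x j - y j) i = kap b x i - kap b y i.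
Proof.
move=> hb hx hy; rewrite /kap -tsumB.
- by apply: eq_tsum => j; rewrite mulrBr.
- exact: (summ_kap _ hb hx).
- exact: (summ_kap _ hb hy).
Qed.

Variables (q : R) (b : nat -> nat -> R).
Hypothesis hq : 0 <= q < 1.
Hypothesis hb : schur q b v.

Let q0 : 0 <= q. Proof. by case/andP: hq. Qed.
Let q1 : 0 < 1 - q. Proof. by rewrite subr_gt0; case/andP: hq. Qed.

Section solve.
Variables (r : nat -> R) (K : R).
Hypotheses (K0 : 0 <= K) (hr : forall i, `|r i| <= K * v i).

Let t m := iter m (kap b) r.

Let ht m i : `|t m i| <= q ^+ m * K * v i.
Proof.
elim: m i => [|m ih] i; first by rewrite expr0 mul1r; exact: hr.
by rewrite exprS -(mulrA q); apply: kap_le => //; rewrite mulr_ge0// exprn_ge0.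
Qed.

Let st i : summ (fun m => t m i).
Proof.
apply: (summ_le (g := fun m => q ^+ m * (K * v i))).
  by move=> m; rewrite mulrA; apply: le_trans (ht m i) (ler_norm _).
by apply: summZr; exact: summ_geometric.
Qed.

(** Neumann series, whose m-th term is bounded by q^m K v. *)
Lemma fixpoint_ex : exists2 y, (forall i, y i = r i + kap b y i) &
  exists L, 0 <= L /\ forall i, `|y i| <= L * v i.
Proof.
exists (fun i => tsum (fun m => t m i)); last first.
  exists (K / (1 - q)); split; first by rewrite divr_ge0// ltW.
  move=> i; apply: le_trans (tsum_norm (st i)) _.
  apply: (@le_trans _ _ (tsum (fun m => K * v i * q ^+ m))).
    apply: le_tsum.
    - exact/summ_norm/st.
    - exact/summZ/summ_geometric.
    - by move=> m; rewrite mulrC mulrA; exact: ht.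
  rewrite tsumZ; last exact: summ_geometric.
  rewrite [leRHS]mulrAC ler_wpM2l ?mulr_ge0 ?(ltW (v0 i))//.
  have /cvg_lim := tsum_nat (summ_geometric hq).
  move=> <-//; apply: limr_le.
    by apply/cvg_ex; eexists; exact: (tsum_nat (summ_geometric hq)).
  by apply: nearW => n; exact: sum_geometric_le.
move=> i; rewrite tsum_natS; last exact: st.
congr (_ + _); rewrite /kap.
(* Absolute summability over pairs allows [kap b] to be applied to the Neumann series term by
   term. *)
have sp : summ (fun p : nat * nat => b i p.1 * t p.2 p.1).
  apply: (summ_le (g := fun p : nat * nat => (b i p.1 * v p.1) * (q ^+ p.2 * K))).
    move=> -[j m] /=; rewrite -mulrA !normrM ler_wpM2l//.
    apply: le_trans (ht m j) _.
    by rewrite (gtr0_norm (v0 j)) normrX !ger0_norm// mulrC.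
  apply: (@summ_prod _ _ _ (fun j => b i j * v j) (fun m => q ^+ m * K)).
    by case: (hb i).
  by apply: summZr; exact: summ_geometric.
transitivity (tsum (fun j => tsum (fun m => b i j * t m j))).
  by rewrite (tsum_exchange sp).
by apply: eq_tsum => j; rewrite tsumZ//; exact: st.
Qed.

End solve.

Lemma fixpoint_bound r K y L : 0 <= K -> 0 <= L -> (forall i, `|r i| <= K * v i) ->
  (forall i, `|y i| <= L * v i) -> (forall i, y i = r i + kap b y i) ->
  forall i, `|y i| <= K / (1 - q) * v i.
Proof.
move=> K0 L0 hr hy yE.
(* the bound L improves to K + q L, whose iterates tend to K / (1 - q) *)
have H m i : `|y i| <= (K / (1 - q) + q ^+ m * L) * v i.
  elim: m i => [|m ih] i.
    rewrite expr0 mul1r; apply: le_trans (hy i) _; rewrite ler_wpM2r ?(ltW (v0 i))//.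
    by rewrite lerDr divr_ge0// ltW.
  rewrite yE; apply: le_trans (ler_normD _ _) _.
  apply: (@le_trans _ _ (K * v i + q * (K / (1 - q) + q ^+ m * L) * v i)).
    apply: lerD; first exact: hr.
    by apply: kap_le => //; rewrite addr_ge0 ?mulr_ge0 ?exprn_ge0 ?invr_ge0 ?(ltW q1).
  rewrite -mulrDl ler_wpM2r ?(ltW (v0 i))// exprS.
  rewrite le_eqVlt; apply/orP; left; apply/eqP; field.
  exact: lt0r_neq0.
move=> i.
have : (fun m => q ^+ m * (L * v i)) @ \oo --> 0 * (L * v i).
  apply: cvgMl; apply: cvg_expr; rewrite ger0_norm//; by case/andP: hq.
rewrite mul0r => h; rewrite -subr_le0 -(cvg_lim _ h)//; apply: limr_ge.
  by apply/cvg_ex; eexists; exact: h.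
by apply: nearW => m; rewrite mulrA lerBlDl -mulrDl.
Qed.

End fixpoint.

(** * Second-order perturbation of the solution of y = e0 + b y *)

Section perturbation.
Context {R : realType}.
Implicit Types (b : nat -> nat -> R) (v y : nat -> R).

Definition e0 (i : nat) : R := (i == 0%N)%:R.

Lemma kap_e0 b i : kap b e0 i = b i 0%N.
Proof.
rewrite /kap (@tsum1 _ _ _ 0%N) /e0 ?mulr1// => j /negPf ->.
by rewrite mulr0.
Qed.

Variables (v : nat -> R) (q eta eta' : R).
Hypotheses (v_gt0 : forall i, 0 < v i) (v01 : 1 <= v 0%N).
Hypotheses (hq : 0 <= q < 1) (eta0 : 0 <= eta) (eta'0 : 0 <= eta').

(** The growth condition selects the solution to which the contraction bound applies. *)
Definition solves b y := (forall i, y i = e0 i + kap b y i) /\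
  exists L, 0 <= L /\ forall i, `|y i| <= L * v i.

Lemma e0_le i : `|e0 i| <= 1 * v i.
Proof.
rewrite mul1r /e0; case: i => [|i] /=; first by rewrite normr1.
by rewrite normr0 ltW.
Qed.

Lemma solves_ex b : schur q b v -> exists y, solves b y.
Proof.
move=> hb; have [y yE yL] := fixpoint_ex v_gt0 hq hb ler01 e0_le.
by exists y.
Qed.

(** [y - e0] solves the same equation with the first column of [b] as source term. *)
Lemma solves_sub_e0 b y : schur q b v -> (forall i, `|b i 0%N| <= eta * v i) ->
  solves b y -> forall i, `|y i - e0 i| <= eta / (1 - q) * v i.
Proof.
move=> hb b0 [yE [L [L0 yL]]].
apply: (@fixpoint_bound _ _ v_gt0 q b hq hb (fun i => b i 0%N) eta _ (L + 1)) => //.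
- by rewrite addr_ge0.
- move=> i; apply: le_trans (ler_normB _ _) _.
  by rewrite mulrDl lerD// e0_le.
- move=> i; rewrite (kapB v_gt0 _ hb yL e0_le) kap_e0 {1}yE; ring.
Qed.

(** With E = b - b', the difference u solves u = E y' + b u, and E y' = E e0 + E (y' - e0). The
    first summand is a column of E, of size [eta']; the second is a product of two quantities of
    size [eta]. Later [eta] is of order 1/n and [eta'] of order 1/n^2. *)
Lemma perturbation b b' y y' : schur q b v -> schur q b' v ->
  (forall i, `|b' i 0%N| <= eta * v i) ->
  schur eta (fun i j => b i j - b' i j) v ->
  (forall i, `|b i 0%N - b' i 0%N| <= eta' * v i) ->
  solves b y -> solves b' y' ->
  forall i, `|y i - y' i| <= (eta' + eta * (eta / (1 - q))) / (1 - q) * v i.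
Proof.
move=> hb hb' b'0 hE E0 sy sy'; have [yE [L [L0 yL]]] := sy.
have [y'E [L' [L'0 y'L]]] := sy'.
pose E := fun i j => b i j - b' i j.
have hE' : schur eta E v := hE.
have q1 : 0 < 1 - q by rewrite subr_gt0; case/andP: hq.
have ye := solves_sub_e0 hb' b'0 sy'.
have eta1 : 0 <= eta / (1 - q) by rewrite divr_ge0// ltW.
apply: (@fixpoint_bound _ _ v_gt0 q b hq hb (kap E y') _ _ (L + L')).
- by rewrite addr_ge0// mulr_ge0.
- by rewrite addr_ge0.
- move=> i; have -> : kap E y' i = E i 0%N + kap E (fun j => y' j - e0 j) i.
    by rewrite (kapB v_gt0 _ hE' y'L e0_le) kap_e0; ring.
  apply: le_trans (ler_normD _ _) _; rewrite mulrDl; apply: lerD; first exact: E0.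
  exact: (kap_le v_gt0 eta1 hE' ye).
- by move=> i; apply: le_trans (ler_normB _ _) _; rewrite mulrDl lerD.
- move=> i; rewrite (kapB v_gt0 _ hb yL y'L) {1}yE {1}y'E.
  have -> : kap E y' i = kap b y' i - kap b' y' i.
    rewrite /kap -tsumB; first by apply: eq_tsum => j; rewrite mulrBl.
    + exact: (summ_kap v_gt0 _ hb y'L).
    + exact: (summ_kap v_gt0 _ hb' y'L).
  ring.
Qed.

End perturbation.

(** * Polynomial decay *)

Section decay.
Context {R : realType}.
Implicit Types x y z : int -> R.

Lemma Posz_inj : injective Posz. Proof. by move=> i j []. Qed.
Lemma Negz_inj : injective Negz. Proof. by move=> i j []. Qed.

Lemma summ_int (f : int -> R) : summ (fun n : nat => f n) -> summ (fun n : nat => f (Negz n)) ->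
  summ f.
Proof.
move=> sp sn.
have s1 : summ (fun i : int => if i is Posz _ then f i else 0).
  apply: (summ_supp Posz_inj _).2 => // -[j|j] //= /(_ j); by rewrite eqxx.
have s2 : summ (fun i : int => if i is Negz _ then f i else 0).
  apply: (summ_supp Negz_inj _).2 => // -[j|j] //= /(_ j); by rewrite eqxx.
have := summD s1 s2; congr summ; apply/funext => -[j|j]; by rewrite ?addr0 ?add0r.
Qed.

Lemma tsum_causal (f : int -> R) : (forall k, k < 0 -> f k = 0) ->
  tsum f = tsum (fun n : nat => f n).
Proof.
move=> f0; apply: (tsum_supp Posz_inj) => -[j /(_ j)|j _]; first by rewrite eqxx.
by rewrite f0.
Qed.

Lemma summ_causal (f : int -> R) : (forall k, k < 0 -> f k = 0) ->
  summ f <-> summ (fun n : nat => f n).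
Proof.
move=> f0; apply: (summ_supp Posz_inj) => -[j /(_ j)|j _]; first by rewrite eqxx.
by rewrite f0.
Qed.

(** The 1 makes the weight submultiplicative, which drives all the convolution estimates. *)
Definition wt (k : int) : R := 1 + `|k|%:~R.

Lemma wt_ge1 k : 1 <= wt k. Proof. by rewrite lerDl ler0z. Qed.
Lemma wt_gt0 k : 0 < wt k. Proof. exact: lt_le_trans (wt_ge1 k). Qed.
Lemma wt_ge0 k : 0 <= wt k. Proof. exact/ltW/wt_gt0. Qed.
Lemma wtN k : wt (- k) = wt k. Proof. by rewrite /wt normrN. Qed.

Lemma wtM i j : wt (i + j) <= wt i * wt j.
Proof.
have h : (`|i + j|%:~R : R) <= `|i|%:~R + `|j|%:~R.
  by rewrite -intrD ler_int ler_normD.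
have i0 : (0 : R) <= `|i|%:~R by rewrite ler0z.
have j0 : (0 : R) <= `|j|%:~R by rewrite ler0z.
by rewrite /wt; nra.
Qed.

Lemma wtN_nat (n : nat) : wt n = n.+1%:R.
Proof. by rewrite /wt -natr1 addrC. Qed.

Definition dec (s : R) x := exists2 C, 0 <= C & forall k, `|x k| <= C * wt k `^ (- s).

Lemma powRDp (a r s : R) : 0 < a -> a `^ (r + s) = a `^ r * a `^ s.
Proof. by move=> a0; rewrite powRD// (gt_eqF a0); apply/implyP. Qed.

Lemma powR_pow (a r : R) : 0 < a -> a `^ (- r) ^+ 2 = a `^ (- (2 * r)).
Proof. by move=> a0; rewrite (_ : - (2 * r) = - r + - r) ?powRDp// ?expr2//; ring. Qed.

Lemma ln_succ_ge (x : R) : 0 < x -> (1 + x)^-1 <= ln (1 + x^-1).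
Proof.
move=> x0; have -> : 1 + x^-1 = (1 - (1 + x)^-1)^-1.
  field; rewrite (_ : 1 + x - 1 = x); last ring.
  by rewrite !gt_eqF// addr_gt0.
have y1 : (1 + x)^-1 < 1 by rewrite invf_lt1 ?ltrDl// addr_gt0.
rewrite lnV ?posrE ?subr_gt0//.
have := @le_ln1Dx R (- (1 + x)^-1); rewrite ltrN2 => /(_ y1); lra.
Qed.

(** A discrete form of comparing the sum of x^(-1-t) with its integral: the right-hand side
    telescopes. It follows from (1 + 1/x)^t >= 1 + t / (1 + x). *)
Lemma powR_telescope (t : R) (n : nat) : 0 < t ->
  t * n.+2%:R `^ (- (1 + t)) <= n.+1%:R `^ (- t) - n.+2%:R `^ (- t).
Proof.
move=> t0; have x0 : (0 : R) < n.+1%:R by rewrite ltr0n.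
have -> : (n.+2%:R : R) = 1 + n.+1%:R by rewrite -[n.+2]add1n natrD.
set x : R := n.+1%:R in x0 *.
have x1 : 0 < 1 + x by rewrite addr_gt0.
have -> : x `^ (- t) = (1 + x) `^ (- t) * (1 + x^-1) `^ t.
  have -> : 1 + x = x * (1 + x^-1) by rewrite mulrDr mulr1 mulfV ?gt_eqF// addrC.
  have u0 : 0 < 1 + x^-1 by rewrite addr_gt0 ?invr_gt0.
  by rewrite powRM ?ltW// -mulrA -powRDp// addNr powRr0 mulr1.
have -> : (1 + x) `^ (- (1 + t)) = (1 + x) `^ (- t) * (1 + x)^-1.
  by rewrite (_ : - (1 + t) = - t + - 1) ?powRDp// ?powR_inv1 ?ltW//; ring.
have h : 1 + t * (1 + x)^-1 <= (1 + x^-1) `^ t.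
  rewrite /powR gt_eqF ?addr_gt0 ?invr_gt0//.
  apply: le_trans (expR_ge1Dx _); rewrite lerD2l ler_pM2l//; exact: ln_succ_ge.
have p0 : 0 <= (1 + x) `^ (- t) by exact: powR_ge0.
nra.
Qed.

Lemma summ_powR (t : R) : 1 < t -> summ (fun n : nat => n.+1%:R `^ (- t) : R).
Proof.
move=> t1; pose e := t - 1; have e0 : 0 < e by rewrite subr_gt0.
apply: (@summ_nat_bound _ _ (1 + e^-1)) => n.
under eq_bigr do rewrite ger0_norm ?powR_ge0//.
case: n => [|n]; first by rewrite big_geq// addr_ge0// invr_ge0 ltW.
have H m : \sum_(0 <= i < m) i.+2%:R `^ (- t) <= e^-1 * (1 - m.+1%:R `^ (- e)).
  elim: m => [|m ih]; first by rewrite big_geq// powR1 subrr mulr0.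
  rewrite big_nat_recr//=; apply: le_trans (lerD ih (lexx _)) _.
  have := powR_telescope m e0; rewrite (_ : 1 + e = t); last by rewrite /e; ring.
  move=> h; rewrite -lerBrDl -mulrBr ler_pdivlMl//; apply: le_trans h _; lra.
rewrite big_nat_recl//= powR1 lerD2l; apply: le_trans (H _) _.
rewrite -[leRHS]mulr1 ler_pM2l ?invr_gt0// gerBl; exact: powR_ge0.
Qed.

Lemma summ_wt (t : R) : 1 < t -> summ (fun k => wt k `^ (- t)).
Proof.
move=> t1; apply: summ_int.
  by under eq_fun do rewrite wtN_nat; exact: summ_powR.
apply: summ_le (summ_powR t1) => n; rewrite !ger0_norm ?powR_ge0//.
rewrite NegzE wtN wtN_nat !powRN lef_pV2 ?posrE ?powR_gt0// ge0_ler_powR ?nnegrE ?ler_nat//.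
exact/ltW/(lt_trans ltr01).
Qed.

Lemma dec_summ s x : 1 < s -> dec s x -> summ x.
Proof.
move=> s1 [C C0 xC]; apply: (summ_le (g := fun k => C * wt k `^ (- s))).
  by move=> k; apply: le_trans (xC k) (ler_norm _).
by apply: summZ; exact: summ_wt.
Qed.

Lemma dec_l2 s x : 1 / 2 < s -> dec s x -> l2 x.
Proof.
move=> s1 [C C0 xC]; apply: (dec_summ (s := 2 * s)); first by lra.
exists (C ^+ 2); first exact: sqr_ge0.
move=> k; rewrite normrX -powR_pow ?wt_gt0// -exprMn lerXn2r ?nnegrE//.
by rewrite mulr_ge0 ?powR_ge0.
Qed.

Lemma dec_rev s x : dec s x -> dec s (rev x).
Proof. by move=> [C C0 xC]; exists C => // k; rewrite -[wt k]wtN; exact: xC. Qed.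

Lemma dec_weaken s s' x : s' <= s -> dec s x -> dec s' x.
Proof.
move=> ss' [C C0 xC]; exists C => // k; apply: le_trans (xC k) _.
by rewrite ler_wpM2l// ler_powR ?wt_ge1// lerN2.
Qed.

(* The weight is submultiplicative, so half of the slack of [x] and [z] turns
   the kernel 1 / (1 + |j|) into a summable one. *)
Lemma dec_tri s x y z k : 1 / 2 < s -> dec s x -> dec 1 y -> dec s z -> tri x y z k.
Proof.
move=> s1 [C C0 xC] [D D0 yD] [E E0 zE].
have [t t0 tE] : exists2 t, 0 < t & 2 * t = s - 1 / 2 by exists ((s - 1 / 2) / 2); lra.
pose x' k := C * wt k `^ (- (s - t)); pose z' k := E * wt k `^ (- (s - t)).
pose y' k := D * wt k `^ (- (1 + t)).
have st : 1 / 2 < s - t by lra.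
have hx' : l2 x'.
  by apply: (dec_l2 st); exists C => // j; rewrite /x' ger0_norm ?mulr_ge0 ?powR_ge0.
have hz' : l2 z'.
  by apply: (dec_l2 st); exists E => // j; rewrite /z' ger0_norm ?mulr_ge0 ?powR_ge0.
have hy' : summ y' by apply/summZ/summ_wt; lra.
have := tri_l1_mid k hx' hy' hz'.
move=> /(summZ (wt k `^ t)); apply: summ_le => -[i j] /=.
rewrite [leRHS]ger0_norm; last by rewrite ?mulr_ge0 ?powR_ge0.
rewrite !normrM.
have X := xC i; have Y := yD j; have Z := zE (k - i - j).
apply: le_trans (ler_pM _ _ (ler_pM _ _ X Y) Z) _ => //.
have e1 r l : wt r `^ (- (l - t)) = wt r `^ (- l) * wt r `^ t.
  by rewrite -powRDp ?wt_gt0// (_ : - (l - t) = - l + t)//; ring.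
have e2 r : wt r `^ (- (1 + t)) = wt r `^ (- 1) * wt r `^ (- t).
  by rewrite -powRDp ?wt_gt0// opprD.
(* The identity j = (k - i) - (k - i - j) bounds [wt j] by the product of the other three weights;
   this pays for the change of exponents. *)
have h : 1 <= wt k `^ t * wt i `^ t * wt (k - i - j) `^ t * wt j `^ (- t).
  rewrite powRN ler_pdivlMr ?powR_gt0 ?wt_gt0// mul1r.
  rewrite -!powRM ?mulr_ge0 ?wt_ge0//.
  rewrite ge0_ler_powR ?nnegrE ?mulr_ge0 ?wt_ge0 ?(ltW t0)//.
  rewrite {1}(_ : j = (k - i) - (k - i - j)); last ring.
  apply: le_trans (wtM _ _) _; rewrite wtN ler_pM ?wt_ge0//.
  by apply: le_trans (wtM _ _) _; rewrite wtN.
rewrite /x' /y' /z' !e1 e2.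
set A := wt i `^ (- s); set A' := wt i `^ t in h *; set B := wt j `^ (- 1).
set B' := wt j `^ (- t) in h *; set Z1 := _ `^ (- s); set Z2 := wt (k - i - j) `^ t in h *.
set W := wt k `^ t in h *.
have P : 0 <= C * A * (D * B) * (E * Z1) by rewrite !mulr_ge0 ?powR_ge0.
rewrite (_ : W * _ = C * A * (D * B) * (E * Z1) * (W * A' * Z2 * B')); last ring.
by rewrite ler_peMr.
Qed.

Lemma cvg_powRN (s : R) : 0 < s -> (fun n : nat => n.+1%:R `^ (- s) : R) @ \oo --> 0.
Proof.
move=> s0; apply/cvgrPdist_lt => /= e e0.
have [N hN] : exists N : nat, e^-1 `^ (s^-1) < N%:R.
  exists (Num.truncn (e^-1 `^ (s^-1))).+1; exact: truncnS_gt.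
near=> n; rewrite sub0r normrN ger0_norm ?powR_ge0// powRN invf_plt ?posrE ?powR_gt0//.
have -> : e^-1 = (e^-1 `^ (s^-1)) `^ s.
  by rewrite -powRrM mulVf ?gt_eqF// powRr1// invr_ge0 ltW.
apply: gt0_ltr_powR; rewrite ?nnegrE ?powR_ge0//; apply: (lt_le_trans hN).
by rewrite ler_nat; apply: leqW; near: n; exact: nbhs_infty_ge.
Unshelve. all: by end_near. Qed.

End decay.

(** * The pure process *)

Section binomial_sequence.
Context {R : realType}.
Implicit Types (d f : R) (x y : int -> R).

(* Coefficients of (1 - z)^(-f). *)
Definition binc f (k : int) : R :=
  if k is Posz n then \prod_(0 <= i < n) ((i%:R + f) / i.+1%:R) else 0.

Arguments binc : simpl never.

Lemma binc_causal f : causal (binc f). Proof. by case. Qed.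

Lemma binc0 f : binc f 0 = 1. Proof. by rewrite /binc /= big_geq. Qed.

Lemma bincSn f (n : nat) : binc f n.+1 = (n%:R + f) / n.+1%:R * binc f n.
Proof. by rewrite /binc big_nat_recr//= mulrC. Qed.

(** The recursion holds on all of [int]: at k = -1, where the sequence jumps from 0 to 1, the factor
    k + 1 vanishes. *)
Lemma bincS f (k : int) : (k + 1)%:~R * binc f (k + 1) = (k%:~R + f) * binc f k.
Proof.
case: k => [n|[|n]]; last 2 first.
- by rewrite NegzE addNr mul0r mulr0.
- by have -> : Negz n.+1 + 1 = Negz n by [rewrite !NegzE; lia]; rewrite !mulr0.
have -> : n%:Z + 1 = n.+1 by lia.
rewrite bincSn.
by rewrite -pmulrn mulrA (mulrC _ (_ / _)) mulfVK ?pnatr_eq0.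
Qed.

Lemma summ_causal_conv x y k : causal x -> causal y -> summ (fun i => x i * y (k - i)).
Proof.
move=> hx hy; apply: (summ_seq (s := [seq (i%:Z : int) | i <- iota 0 `|k|.+1])).
  by rewrite map_inj_uniq ?iota_uniq// => i j [].
move=> i; have [i1|i1] := ltP i 0; first by rewrite hx ?mul0r.
have [ki|ki] := ltP k i; first by rewrite (hy (_ - _)) ?mulr0//; lia.
by move=> /mapP; case; exists `|i|%N; [rewrite mem_iota|]; lia.
Qed.

(** Write m + 1 as i + (m + 1 - i) and apply the recursion to the corresponding factor: [-d] and [d]
    cancel, so that m times the m-th coefficient does not depend on m and is 0. *)
Lemma conv_binc d : conv (binc (- d)) (binc d) = delta.
Proof.
pose a := binc (- d); pose c := binc d.
have ha : causal a by exact: binc_causal.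
have hc : causal c by exact: binc_causal.
have step (m : int) : (m + 1)%:~R * conv a c (m + 1) = m%:~R * conv a c m.
  have s0 k : summ (fun i => a i * c (k - i)) by exact: summ_causal_conv.
  have s1 : summ (fun i => i%:~R * a i * c (m + 1 - i)).
    apply: (@summ_causal_conv (fun i => i%:~R * a i)) => // k k0.
    by rewrite ha ?mulr0.
  have s2 : summ (fun i => a i * ((m + 1 - i)%:~R * c (m + 1 - i))).
    apply: (@summ_causal_conv _ (fun i => i%:~R * c i)) => // k k0.
    by rewrite hc ?mulr0.
  have s3 : summ (fun i => (i%:~R - d) * a i * c (m - i)).
    apply: (@summ_causal_conv (fun i => (i%:~R - d) * a i)) => // k k0.
    by rewrite ha ?mulr0.
  have s4 : summ (fun i => a i * (((m - i)%:~R + d) * c (m - i))).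
    apply: (@summ_causal_conv _ (fun i => (i%:~R + d) * c i)) => // k k0.
    by rewrite hc ?mulr0.
  transitivity (tsum (fun i => i%:~R * a i * c (m + 1 - i)) +
      tsum (fun i => a i * ((m + 1 - i)%:~R * c (m + 1 - i)))).
    rewrite -tsumD// /conv -tsumZ//; apply: eq_tsum => i.
    have -> : (m + 1)%:~R = (m + 1 - i)%:~R + i%:~R :> R by rewrite -intrD subrK.
    ring.
  transitivity (tsum (fun i => (i%:~R - d) * a i * c (m - i)) +
      tsum (fun i => a i * (((m - i)%:~R + d) * c (m - i)))); last first.
    rewrite -tsumD// /conv -tsumZ//; apply: eq_tsum => i.
    have -> : m%:~R = (m - i)%:~R + i%:~R :> R by rewrite -intrD subrK.
    ring.
  congr (_ + _).
    rewrite (tsum_bij _ (shift_bij 1)); apply: eq_tsum => i.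
    by rewrite [X in X * _]bincS opprD addrACA subrr addr0.
  apply: eq_tsum => i; rewrite -bincS (_ : m - i + 1 = m + 1 - i)//; ring.
have pos (n : nat) : n%:~R * conv a c n = 0.
  elim: n => [|n ih]; first by rewrite mul0r.
  by have := step n; rewrite ih (_ : n%:Z + 1 = n.+1)//; lia.
apply/funext => -[[|n]|n].
- by rewrite conv_causal0// /a /c !binc0 mulr1.
- apply/eqP; have /eqP := pos n.+1.
  by rewrite mulf_eq0 -[(n.+1)%:~R]/(n.+1%:R) pnatr_eq0.
- by rewrite conv_causal.
Qed.

Section pure.
Variable d : R.
Hypothesis hd : 0 < d < 1.
Let d0 : 0 < d. Proof. by case/andP: hd. Qed.
Let d1 : d < 1. Proof. by case/andP: hd. Qed.

Lemma binc_gt0 (n : nat) : 0 < binc d n.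
Proof. by rewrite /binc prodr_gt0// => i _; rewrite divr_gt0// ltr_wpDl. Qed.

Lemma binc_ge0 k : 0 <= binc d k.
Proof. by case: k => n //; rewrite ltW// binc_gt0. Qed.

Lemma binc_decr (n : nat) : binc d n.+1 <= binc d n.
Proof.
rewrite bincSn -[leRHS]mul1r ler_wpM2r ?binc_ge0// ler_pdivrMr// mul1r.
by rewrite -natr1 lerD2l ltW.
Qed.

Lemma binc_incr (n m : nat) : (n <= m)%N -> n%:R * binc d n <= m%:R * binc d m.
Proof.
elim: m => [|m ih]; first by rewrite leqn0 => /eqP ->.
rewrite leq_eqVlt => /orP[/eqP ->//|]; rewrite ltnS => /ih /le_trans; apply.
by rewrite bincSn mulrA (mulrC m.+1%:R) mulfVK ?pnatr_eq0// ler_wpM2r ?binc_ge0// lerDl ltW.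
Qed.

Lemma bincN_le0 (n : nat) : binc (- d) n.+1 <= 0.
Proof.
elim: n => [|n ih]; first by rewrite bincSn binc0 mulr1 add0r divr1 oppr_le0 ltW.
rewrite bincSn mulr_ge0_le0// divr_ge0// subr_ge0 (le_trans (ltW d1))//.
by rewrite ler1n.
Qed.

(** The partial sums are the coefficients of (1 - z)^(d - 1). This form shows that they are
    nonnegative, which gives summability, and it yields the bound n |binc (- d) n| <= d. *)
Lemma sum_bincN (n : nat) :
  d * \sum_(0 <= i < n.+1) binc (- d) i = - (n.+1%:R * binc (- d) n.+1).
Proof.
elim: n => [|n ih].
  by rewrite big_nat1 bincSn binc0; field.
rewrite big_nat_recr//= mulrDr ih (bincSn _ n.+1).
by field; rewrite ?pnatr_eq0.
Qed.

Lemma sum_bincN_ge0 (n : nat) : 0 <= \sum_(0 <= i < n.+1) binc (- d) i.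
Proof.
by rewrite -(pmulr_rge0 _ d0) sum_bincN oppr_ge0 mulr_ge0_le0// bincN_le0.
Qed.

Lemma sum_bincN_le1 (n : nat) : \sum_(0 <= i < n.+1) binc (- d) i <= 1.
Proof.
elim: n => [|n ih]; first by rewrite big_nat1 binc0.
by rewrite big_nat_recr//=; apply: le_trans ih; rewrite gerDl bincN_le0.
Qed.

Lemma summ_bincN : summ (binc (- d)).
Proof.
apply/(summ_causal (@binc_causal _)); apply: (@summ_nat_bound _ _ 2) => -[|n].
  by rewrite big_geq.
have H : \sum_(0 <= i < n.+1) (`|binc (- d) i| + binc (- d) i) = 2.
  rewrite big_nat_recl//= big1 => [|i _].
    by rewrite binc0 normr1 addr0.
  by rewrite ler0_norm ?bincN_le0// addNr.
move: H; rewrite big_split /= => H; have := sum_bincN_ge0 n; lra.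
Qed.

Lemma bincN_dec : dec 1 (binc (- d)).
Proof.
exists 2 => // -[[|n]|n]; last by rewrite normr0 mulr_ge0// powR_ge0.
  by rewrite binc0 normr1 wtN_nat powR1 mulr1 ler1n.
rewrite wtN_nat powRN powRr1// ler_pdivlMr//.
have h : n.+1%:R * `|binc (- d) n.+1| <= 1.
  rewrite ler0_norm ?bincN_le0// mulrN -sum_bincN.
  rewrite -[leRHS]mulr1 ler_pM ?(ltW d0) ?(ltW d1) ?sum_bincN_ge0 ?sum_bincN_le1//.
have : `|binc (- d) n.+1| * n.+2%:R <= (n.+1%:R * `|binc (- d) n.+1|) * 2.
  rewrite mulrC [leRHS]mulrAC ler_wpM2r// -natrM ler_nat; lia.
by move=> /le_trans; apply; lra.
Qed.

(** The ratio of consecutive terms is 1 - (1 - d) / (n + 1) <= exp (- (1 - d) / (n + 1)), and 1 / (n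
    + 1) dominates ln (1 + 1 / (n + 1)). *)
Lemma binc_dec : dec (1 - d) (binc d).
Proof.
have H (n : nat) : binc d n <= n.+1%:R `^ (- (1 - d)).
  elim: n => [|n ih]; first by rewrite binc0 powR1.
  rewrite bincSn.
  have x0 : (0 : R) < n.+1%:R by rewrite ltr0n.
  apply: le_trans (ler_wpM2l _ ih) _; first by rewrite divr_ge0// addr_ge0// ltW.
  have -> : (n.+2%:R : R) = n.+1%:R * (1 + n.+1%:R^-1).
    by rewrite mulrDr mulr1 mulfV ?gt_eqF// natr1.
  have u0 : (0 : R) < 1 + n.+1%:R^-1 by rewrite addr_gt0 ?invr_gt0.
  rewrite powRM ?(ltW u0)// mulrC ler_wpM2l ?powR_ge0//.
  have -> : (n%:R + d) / n.+1%:R = 1 + - (1 - d) * n.+1%:R^-1.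
    by rewrite -natr1; field; rewrite natr1 gt_eqF.
  apply: le_trans (expR_ge1Dx _) _.
  rewrite /powR gt_eqF// ler_expR !mulNr lerN2 ler_wpM2l ?subr_ge0 ?(ltW d1)//.
  by apply: le_ln1Dx; rewrite (lt_trans (ltrN10 _))// invr_gt0.
exists 1 => // -[n|n]; last by rewrite normr0 mul1r powR_ge0.
by rewrite mul1r wtN_nat gtr0_norm ?binc_gt0.
Qed.

End pure.
End binomial_sequence.

(** * Contiguity relation for correlations of binomial sequences *)

Section cross_correlation.
Context {R : realType}.
Implicit Types (d f : R).

Lemma summ_sub_inj (I J : choiceType) (h : I -> J) (f : J -> R) : injective h ->
  summ f -> summ (fun i => f (h i)).
Proof.
move=> ih sf; apply: le_lt_trans sf.
pose F j : R := if `[< range h j >] then `|f j| else 0.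
have -> : nsum (fun i => `|f (h i)|) = nsum F.
  rewrite (nsum_supp ih).
  - by congr nsum; apply/funext => i; rewrite /F; case: asboolP => // nh; case: nh; exists i.
  - by move=> j; rewrite /F; case: ifP.
  - move=> j nj; rewrite /F; case: asboolP => // -[i _ hij].
    by have := nj i; rewrite hij eqxx.
by apply: le_nsum => j; rewrite /F; case: ifP.
Qed.

Lemma tsum_sub_inj (I J : choiceType) (h : I -> J) (f : J -> R) : injective h ->
  (forall j, 0 <= f j) -> summ f -> tsum (fun i => f (h i)) <= tsum f.
Proof.
move=> ih f0 sf.
rewrite -lee_fin !tsum_ge0E//; last exact: summ_sub_inj.
pose F j : R := if `[< range h j >] then f j else 0.
have -> : nsum (fun i => f (h i)) = nsum F.
  rewrite (nsum_supp ih (f := F)).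
  - by congr nsum; apply/funext => i; rewrite /F; case: asboolP => // nh; case: nh; exists i.
  - by move=> j; rewrite /F; case: ifP.
  - move=> j nj; rewrite /F; case: asboolP => // -[i _ hij].
    by have := nj i; rewrite hij eqxx.
by apply: le_nsum => j; rewrite /F; case: ifP.
Qed.

(** Written as one sum over n, the difference of the two sides telescopes with the certificate [g].
    The boundary term is of order n^(2 d - 1), and d < 1/2 sends it to 0. With f = -d this governs
    the phase, with f = d the autocovariance. *)
Lemma conv_rev_binc d f k : 0 < d < 1 / 2 -> dec (1 - d) (binc f) ->
  ((k + 1)%:~R - d) * conv (rev (binc d)) (binc f) (k + 1) =
  (k%:~R + f) * conv (rev (binc d)) (binc f) k.
Proof.
move=> /andP[d0 d2] hy; pose c := binc d; pose y := binc f.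
have d1 : 0 < d < 1 by lra.
have s1 : 1 / 2 < 1 - d by lra.
have hc : dec (1 - d) c by exact: binc_dec.
have lc := dec_l2 s1 hc; have ly := dec_l2 s1 hy.
rewrite !conv_rev_nat; do ?exact: binc_causal.
have sn (j : int) : summ (fun n : nat => c n * y (j + n)).
  apply: (summ_sub_inj (h := Posz) (f := fun i : int => c i * y (j + i))) => [i i' []//|].
  by apply: summ_mul_l2 => //; under eq_fun do rewrite addrC; exact: l2_shift.
apply/eqP; rewrite -subr_eq0 -!tsumZ// -tsumB; [|exact: summZ..].
pose g (n : nat) := - (n%:R * (c n * y (k + n))).
rewrite (@tsum_telescope _ _ g).
- by rewrite /g mul0r !oppr0.
- by apply: summB; exact: summZ.
- move=> n; rewrite /g -/c -/y.
  have e1 := bincSn d n; rewrite -/c in e1.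
  have e2 := bincS f (k + n); rewrite -/y in e2.
  have {}e1 : n.+1%:R * c n.+1 = (n%:R + d) * c n.
    by rewrite e1 mulrA (mulrC _ (_ / _)) mulfVK ?pnatr_eq0.
  have E1 : k + n.+1 = k + n + 1 by lia.
  have E2 : k + 1 + n = k + n + 1 by lia.
  rewrite E1 E2 [n.+1%:R * _]mulrA e1.
  have {}e2 : (k%:~R + n%:R + 1) * y (k + n + 1) = (k%:~R + n%:R + f) * y (k + n).
    by move: e2; rewrite !intrD -!pmulrn.
  rewrite intrD.
  transitivity (c n * ((k%:~R + n%:R + 1) * y (k + n + 1) - (n%:R + d) * y (k + n + 1) - (k%:~R + f) * y (k + n))).
    ring.
  rewrite e2; ring.
- have [C C0 hC] := hc; have [D D0 hD] := hy.
  pose M := C * D * wt k `^ (1 - d).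
  have M0 : 0 <= M by rewrite !mulr_ge0 ?powR_ge0.
  have bound (n : nat) : `|g n| <= M * n.+1%:R `^ (- (1 - 2 * d)).
    rewrite normrN !normrM normr_nat.
    have n0 : (0 : R) < n.+1%:R by rewrite ltr0n.
    have X : `|c n| <= C * n.+1%:R `^ (- (1 - d)) by rewrite -wtN_nat.
    have Y : `|y (k + n)| <= D * (wt k `^ (1 - d) * n.+1%:R `^ (- (1 - d))).
      apply: le_trans (hD _) _; rewrite ler_wpM2l// !powRN ler_pdivlMr ?powR_gt0//.
      rewrite mulrC ler_pdivrMr ?powR_gt0 ?wt_gt0// -powRM ?wt_ge0//.
      rewrite ge0_ler_powR ?nnegrE ?mulr_ge0 ?wt_ge0//; first lra.
      rewrite -wtN_nat {1}(_ : n%:Z = - k + (k + n)); last lia.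
      by apply: le_trans (wtM _ _) _; rewrite wtN.
    have N : (n%:R : R) <= n.+1%:R by rewrite ler_nat.
    apply: le_trans (ler_pM _ _ N (ler_pM _ _ X Y)) _ => //.
    rewrite (_ : - (1 - 2 * d) = - (1 - d) + (- (1 - d)) + 1); last ring.
    rewrite !(powRDp _ _ n0) powRr1 ?(ltW n0)// /M.
    by rewrite le_eqVlt; apply/orP; left; apply/eqP; ring.
  apply/cvgr0Pnorm_le => e e0 /=.
  have h : (fun n : nat => M * n.+1%:R `^ (- (1 - 2 * d))) @ \oo --> M * 0.
    by apply: cvgMr; apply: cvg_powRN; lra.
  rewrite mulr0 in h.
  have /cvgr0Pnorm_le/(_ e e0) := h.
  apply: filterS => n; apply: le_trans; apply: le_trans (bound n) (ler_norm _).
Qed.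

End cross_correlation.

(** * The phase of (1 - z)^-d and Hilbert matrices *)

Section pure_phase.
Context {R : realType}.
Implicit Types (d e : R).

(* Fourier coefficients of (1 - z)^d / (1 - z^-1)^d for |z| = 1. *)
Definition phase0 d : int -> R := conv (rev (binc d)) (binc (- d)).

(* This is sin (pi d) / pi; only its positivity and monotonicity in [d] matter. *)
Definition hilb d : R := d * phase0 d 0.

Lemma intr_neq d (k : int) : 0 < d < 1 -> (k%:~R - d : R) != 0.
Proof.
move=> /andP[d0 d1]; apply/eqP => /eqP; rewrite subr_eq0 => /eqP kd.
have : (0 < k)%R by rewrite -(ltr0z R) kd.
have : (k < 1)%R by rewrite -(ltr_int R) kd.
lia.
Qed.

Lemma wt_le_sub d (k : int) : 0 < d < 1 ->
  wt k <= (2 / d + 2 / (1 - d)) * `|k%:~R - d|.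
Proof.
move=> /andP[d0 d1]; have D1 : 0 < 1 - d by rewrite subr_gt0.
have a0 : 0 < 2 / d by rewrite divr_gt0.
have b0 : 0 < 2 / (1 - d) by rewrite divr_gt0.
have ad : 2 / d * d = 2 by rewrite mulfVK// gt_eqF.
have bd : 2 / (1 - d) * (1 - d) = 2 by rewrite mulfVK// gt_eqF.
set A := 2 / d in a0 ad *; set B := 2 / (1 - d) in b0 bd *.
have Bd : 0 <= B * d by rewrite mulr_ge0// ltW.
have Ad : 0 <= A * (1 - d) by rewrite mulr_ge0// ltW.
have A2 : 2 <= A by lra.
have B2 : 2 <= B by lra.
case: k => [[|n]|n].
- rewrite /wt normr0 addr0 sub0r normrN gtr0_norm//; lra.
- have n0 : (0 : R) <= n%:R by [].
  rewrite /wt ger0_norm// -!pmulrn -natr1 gtr0_norm; last lra.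
  have : 2 * n%:R <= B * n%:R by rewrite ler_wpM2r.
  have : 0 <= A * n%:R by rewrite mulr_ge0// ltW.
  lra.
- have n0 : (0 : R) <= n%:R by [].
  rewrite NegzE /wt normrN ger0_norm// mulrNz -!pmulrn -opprD normrN -natr1 gtr0_norm; last lra.
  have : 2 * n%:R <= A * n%:R by rewrite ler_wpM2r.
  have : 0 <= B * n%:R by rewrite mulr_ge0// ltW.
  lra.
Qed.

Section one.
Variable d : R.
Hypothesis hd : 0 < d < 1 / 2.
Let hd1 : 0 < d < 1. Proof. by case/andP: hd => *; lra. Qed.
Let hs : 1 / 2 < 1 - d. Proof. by case/andP: hd => *; lra. Qed.

Lemma binc_l2 : l2 (binc d). Proof. exact: dec_l2 hs (binc_dec hd1). Qed.
Lemma bincN_l2 : l2 (binc (- d)). Proof. exact/summ_l2/summ_bincN. Qed.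

(** For f = -d both coefficients of the contiguity relation have the form k - d, so k - d times the
    k-th phase coefficient is constant, with value [- hilb d] at k = 0. *)
Lemma phase0E k : phase0 d k = - hilb d / (k%:~R - d).
Proof.
suff H : (k%:~R - d) * phase0 d k = - hilb d.
  by rewrite -H mulrC mulKf// intr_neq.
have hy : dec (1 - d) (binc (- d)).
  by apply: dec_weaken (bincN_dec hd1); case/andP: hd => *; lra.
have step j : ((j + 1)%:~R - d) * phase0 d (j + 1) = (j%:~R - d) * phase0 d j.
  exact: conv_rev_binc.
have base : (0%:~R - d) * phase0 d 0 = - hilb d by rewrite sub0r mulNr.
case: k => n.
  elim: n => [|n ih] //.
  by rewrite -ih -(step n); have -> : n%:Z + 1 = n.+1 by lia.
rewrite NegzE; elim: n => [|n ih].
  by have := step (- 1%:Z); rewrite addNr base => ->.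
by rewrite -ih; have -> : - n.+1%:Z = - n.+2%:Z + 1 by [lia]; rewrite step.
Qed.

Lemma dec_phase0 : dec 1 (phase0 d).
Proof.
have [hd0 hd2] : 0 < d /\ 0 < 1 - d by case/andP: hd1 => *; lra.
pose M := 2 / d + 2 / (1 - d).
have M0 : 0 <= M by rewrite addr_ge0 ?divr_ge0 ?ltW.
exists (`|hilb d| * M); first by rewrite mulr_ge0.
move=> k; rewrite phase0E powRN powRr1 ?wt_ge0// -mulrA normrM normrN ler_wpM2l//.
rewrite normfV ler_pdivlMr ?wt_gt0// mulrC ler_pdivrMr ?normr_gt0 ?intr_neq//.
exact: wt_le_sub.
Qed.

(** This is [conv_phase] at index -m, where [phase0 d (- m - j)] equals hilb d / (m + j + d). *)
Lemma hilb_eigen (m : nat) :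
  summ (fun j : nat => binc d j * (hilb d / (m%:R + j%:R + d))) /\
  tsum (fun j : nat => binc d j * (hilb d / (m%:R + j%:R + d))) = binc d m.
Proof.
have lphi : l2 (phase0 d).
  by apply: dec_l2 dec_phase0; lra.
have := conv_phase (summ_bincN hd1) binc_l2 (conv_binc d).
move=> /(congr1 (fun h => h (- m%:Z))); rewrite -/(phase0 d) /rev opprK.
have sc := summ_conv_term (- m%:Z) binc_l2 lphi.
have E (j : nat) : binc d j * phase0 d (- m%:Z - j%:Z) = binc d j * (hilb d / (m%:R + j%:R + d)).
  congr (_ * _); rewrite phase0E !intrD !rmorphN /= -!pmulrn.
  rewrite (_ : - m%:R - j%:R - d = - (m%:R + j%:R + d)); last ring.
  by rewrite invrN mulrNN.
have c0 k : k < 0 -> binc d k * phase0 d (- m%:Z - k) = 0.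
  by move=> /binc_causal ->; rewrite mul0r.
rewrite /conv tsum_causal// => <-; split.
  by have := (summ_causal c0).1 sc; under eq_fun do rewrite E.
by apply: eq_tsum => j; rewrite E.
Qed.

Lemma hilb_gt0 : 0 < hilb d.
Proof.
have [_ E] := hilb_eigen 0; rewrite ltNge; apply/negP => h.
have : binc d 0 <= 0.
  rewrite -E -oppr_ge0 -tsumN; apply: tsum_ge0; first by apply: summN; case: (hilb_eigen 0).
  move=> j; rewrite oppr_ge0 mulr_ge0_le0//; first exact: binc_ge0.
  by rewrite mulr_le0_ge0// invr_ge0 add0r addr_ge0// ltW//; case/andP: hd1.
by rewrite binc0 ler10.
Qed.

End one.

(** A product for sin (pi d) / pi: n times it tends to [hilb d], and each factor depends on [d] only
    through d (1 - d), hence increases on (0, 1/2). *)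
Definition hilbQ d (n : nat) : R :=
  \prod_(0 <= k < n) ((k%:R + d) * (k%:R + 1 - d) / (k%:R + 1) ^+ 2).

Lemma hilbQS d n : hilbQ d n.+1 = hilbQ d n * ((n%:R + d) * (n%:R + 1 - d) / (n%:R + 1) ^+ 2).
Proof. by rewrite /hilbQ big_nat_recr. Qed.

Lemma binc_mulN d (n : nat) :
  binc d n.+1 * binc (- d) n.+1 = - d * hilbQ d n * ((n%:R + d) / (n%:R + 1) ^+ 2).
Proof.
have nz m : (m%:R + 1 : R) != 0 by rewrite natr1 pnatr_eq0.
elim: n => [|n ih].
  by rewrite !bincSn !binc0 /hilbQ big_geq//; field.
rewrite (bincSn _ n.+1) (bincSn (- d) n.+1) mulrACA ih hilbQS -!natr1.
by field; rewrite nz natr1 nz.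
Qed.

Lemma hilb_partial d (n : nat) :
  d * \sum_(0 <= i < n.+1) (binc d i * binc (- d) i) = hilbQ d n * (n%:R + d).
Proof.
have nz m : (m%:R + 1 : R) != 0 by rewrite natr1 pnatr_eq0.
elim: n => [|n ih]; first by rewrite big_nat1 !binc0 /hilbQ big_geq//; ring.
rewrite big_nat_recr//= mulrDr ih binc_mulN hilbQS -natr1.
by field.
Qed.

Lemma hilbQ_ge0 d n : 0 < d < 1 -> 0 <= hilbQ d n.
Proof.
move=> /andP[d0 d1]; apply: prodr_ge0 => k _; rewrite divr_ge0 ?sqr_ge0//.
have k0 : (0 : R) <= k%:R by []; apply: mulr_ge0; lra.
Qed.

(** The gain comes from the factor k = 0 alone, the others being monotone in the exponent. A fixed
    ratio, unlike a strict inequality, survives the limit in n. *)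
Lemma hilbQ_ratio d e n : 0 < d -> d < e -> e < 1 / 2 ->
  hilbQ d n.+1 <= d * (1 - d) / (e * (1 - e)) * hilbQ e n.+1.
Proof.
move=> d0 de e2; have ee : 0 < e * (1 - e) by nra.
elim: n => [|n ih].
  rewrite !hilbQS /hilbQ !big_geq// !mul1r !add0r expr1n !divr1 mulfVK//.
  by rewrite gt_eqF.
rewrite (hilbQS d) (hilbQS e) [leRHS]mulrA.
have Q0 := @hilbQ_ge0 d n.+1; have n0 : (0 : R) <= n.+1%:R by [].
apply: ler_pM.
- by apply: Q0; lra.
- by rewrite divr_ge0 ?sqr_ge0// mulr_ge0//; lra.
- exact: ih.
- by rewrite ler_wpM2r ?invr_ge0 ?sqr_ge0//; nra.
Qed.

Lemma hilb_ratio d e : 0 < d -> d < e -> e < 1 / 2 ->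
  hilb d <= d * (1 - d) / (e * (1 - e)) * hilb e.
Proof.
move=> d0 de e2; have e0 : 0 < e by lra.
have cv f : 0 < f < 1 / 2 ->
    (fun n => hilbQ f n * (n%:R + f)) @ \oo --> hilb f.
  move=> hf; have hf1 : 0 < f < 1 by lra.
  have s : summ (fun n : nat => binc f n * binc (- f) n).
    apply: (summ_sub_inj (h := Posz) (f := fun i : int => binc f i * binc (- f) i)) => [i i' []//|].
    by apply: summ_mul_l2; [exact: binc_l2|exact: bincN_l2].
  have E : hilb f = f * tsum (fun n : nat => binc f n * binc (- f) n).
    rewrite /hilb /phase0 conv_rev_nat; last exact: binc_causal.
    by under eq_tsum do rewrite add0r.
  have -> : (fun n => hilbQ f n * (n%:R + f)) =
      (fun n => f * series (fun n : nat => binc f n * binc (- f) n) n.+1).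
    by apply/funext => n; rewrite -hilb_partial.
  rewrite E; apply: cvgMr.
  by rewrite (@cvg_shiftS R (series _)); exact: tsum_nat.
have hd : 0 < d < 1 / 2 by lra.
have he : 0 < e < 1 / 2 by lra.
have c1 := cv _ hd.
have c2 : (fun n => d * (1 - d) / (e * (1 - e)) * (hilbQ e n * (n%:R + e))) @ \oo -->
    d * (1 - d) / (e * (1 - e)) * hilb e by apply: cvgMr; exact: cv.
rewrite -(cvg_lim _ c1)// -(cvg_lim _ c2)//; apply: ler_lim.
- by apply/cvg_ex; eexists; exact: c1.
- by apply/cvg_ex; eexists; exact: c2.
near=> n; have [m ->] : exists m, n = m.+1.
  by exists n.-1; rewrite prednK//; near: n; exact: nbhs_infty_gt.
rewrite [leRHS]mulrA; apply: ler_pM.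
- by apply: hilbQ_ge0; lra.
- by rewrite addr_ge0// ltW.
- exact: hilbQ_ratio.
- by rewrite lerD2l ltW.
Unshelve. all: by end_near. Qed.

End pure_phase.

(** * Weighted convolution and uniqueness of predictors *)

Section weighted.
Context {R : realType}.
Implicit Types x y r : int -> R.

(** Submultiplicativity gives wt (k - i)^(-s) <= wt k^(-s) wt i for 0 <= s <= 1, so a kernel with a
    finite first moment keeps the decay rate. *)
Lemma dec_conv s x r : 0 <= s <= 1 -> dec s x -> summ (fun k => wt k * r k) ->
  dec s (conv x r).
Proof.
move=> /andP[s0 s1] [C C0 hC] hr.
have hr' := summ_norm hr.
have sx k : summ (fun i => r i * x (k - i)).
  apply: (summ_mul_bounded (M := C)).
    by apply: (summ_le _ hr) => i; rewrite normrM ger0_norm ?wt_ge0// ler_peMl// wt_ge1.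
  move=> i; apply: le_trans (hC _) _; rewrite -[leRHS]mulr1 ler_wpM2l//.
  rewrite powRN invf_le1 ?powR_gt0 ?wt_gt0//.
  by rewrite -[leLHS](powRr0 (wt (k - i))) ler_powR ?wt_ge1.
exists (C * tsum (fun i => `|wt i * r i|)).
  by rewrite mulr_ge0// tsum_ge0.
move=> k; rewrite convC mulrAC -tsumZ//.
apply: le_trans (tsum_norm (sx k)) _; apply: le_tsum.
- exact: summ_norm (sx k).
- exact: summZ hr'.
- move=> i; rewrite !normrM (ger0_norm (wt_ge0 _)).
  have h : wt (k - i) `^ (- s) <= wt k `^ (- s) * wt i.
    rewrite !powRN ler_pdivlMl ?powR_gt0 ?wt_gt0// ler_pdivrMr ?powR_gt0 ?wt_gt0//.
    apply: (@le_trans _ _ ((wt i * wt (k - i)) `^ s)).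
      rewrite ge0_ler_powR ?nnegrE ?mulr_ge0 ?wt_ge0//.
      by rewrite {1}(_ : k = i + (k - i)) ?wtM//; ring.
    rewrite powRM ?wt_ge0// ler_wpM2r ?powR_ge0//.
    by rewrite -[leRHS]powRr1 ?wt_ge0// ler_powR ?wt_ge1.
  apply: (@le_trans _ _ (`|r i| * (C * wt (k - i) `^ (- s)))); first by rewrite ler_wpM2l.
  rewrite (_ : C * _ * _ = `|r i| * (C * (wt k `^ (- s) * wt i))); last ring.
  by rewrite ler_wpM2l// ler_wpM2l.
Qed.

Definition finsupp (n : nat) r := forall k, ~~ (0 <= k <= n%:Z) -> r k = 0.

Lemma finsupp_notin n r x : finsupp n r ->
  forall i, i \notin [seq (i%:Z : int) | i <- iota 0 n.+1] -> r i * x i = 0.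
Proof.
move=> hr i; have [/andP[i0 iN]|/hr ->] := boolP (0 <= i <= n%:Z); last by rewrite mul0r.
by move=> /mapP; case; exists `|i|%N; [rewrite mem_iota|]; lia.
Qed.

Lemma uniq_Posz m n : uniq [seq (i%:Z : int) | i <- iota m n].
Proof. by rewrite map_inj_uniq ?iota_uniq// => i j []. Qed.

Lemma summ_finsupp n r x : finsupp n r -> summ (fun i => r i * x i).
Proof. by move=> /finsupp_notin h; apply: summ_seq (uniq_Posz _ _) (h x). Qed.

Lemma tsum_finsupp n r x : finsupp n r ->
  tsum (fun i => r i * x i) = \sum_(0 <= i < n.+1) r i%:Z * x i%:Z.
Proof.
move=> /finsupp_notin h; rewrite (tsum_seq (uniq_Posz 0 n.+1) (h x)).
by rewrite big_map /index_iota subn0.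
Qed.

Lemma summ_finsupp1 n r : finsupp n r -> summ r.
Proof. by move=> /summ_finsupp-/(_ (fun=> 1)); under eq_fun do rewrite mulr1. Qed.

(** Positive definiteness: the difference r satisfies the normal equations with r 0 = 0, so its
    quadratic form, the squared l2 norm of [conv c r], vanishes; convolving with [a] returns r =
    0. *)
Lemma predictor_unique s a c (n : nat) p p' : 1 / 2 < s <= 1 -> dec s c -> summ a ->
  conv a c = delta -> finsupp n p -> finsupp n p' -> p 0 = p' 0 ->
  (forall k : int, 0 < k <= n%:Z -> conv (conv (rev c) c) p k = 0) ->
  (forall k : int, 0 < k <= n%:Z -> conv (conv (rev c) c) p' k = 0) -> p = p'.
Proof.
move=> /andP[s1 s2] dc sa ac hp hp' p0 Hp Hp'.
have lc := dec_l2 s1 dc; have lrc := l2_rev lc.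
pose r k := p k - p' k.
have hr : finsupp n r by move=> k hk; rewrite /r hp// hp'// subrr.
have sr := summ_finsupp1 hr.
have Hr (k : int) : 0 < k <= n%:Z -> conv (conv (rev c) c) r k = 0.
  move=> hk; have := Hp k hk; have := Hp' k hk; rewrite ![conv (conv _ _) _]convC.
  move=> E' E; rewrite /conv /r.
  rewrite (eq_tsum (g := fun i => p i * conv (rev c) c (k - i) - p' i * conv (rev c) c (k - i))).
    by rewrite tsumB; [rewrite -!/(conv _ _ k) E E' subrr|exact: (summ_finsupp _ hp)|exact: (summ_finsupp _ hp')].
  by move=> i; rewrite mulrBl.
pose u := conv c r.
have lu : l2 u.
  apply: (dec_l2 s1); apply: dec_conv => //; first by rewrite s2 andbT; lra.
  by under eq_fun do rewrite mulrC; exact: (summ_finsupp _ hr).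
have sr' : summ (rev r) by exact: summ_rev.
have E : conv (rev u) u 0 = 0.
  rewrite /u rev_conv (convC (rev c)) convA_left//.
  rewrite -(convA_right lrc lc sr) /conv -[RHS](tsum0 int); apply: eq_tsum => i.
  have [/andP[i0 i1]|/hr] := boolP (0 <= - i <= n%:Z); last by rewrite /rev => ->; rewrite mul0r.
  have [->|i2] := eqVneq i 0; first by rewrite /rev oppr0 /r p0 subrr mul0r.
  by rewrite -!/(conv _ _ _) sub0r Hr ?mulr0//; lia.
have u0 k : u k = 0.
  apply/eqP; rewrite -sqrf_eq0; apply/eqP/le_anti; rewrite sqr_ge0 andbT.
  rewrite -E /conv.
  have -> : tsum (fun i => rev u i * u (0 - i)) = tsum (fun i => u i ^+ 2).
    rewrite (tsum_bij _ opp_bij); apply: eq_tsum => i.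
    by rewrite /rev sub0r opprK expr2.
  by apply: (@term_le_tsum R int (fun i => u i ^+ 2)) => // i; exact: sqr_ge0.
have : r = fun=> 0.
  rewrite -[r]conv_delta -ac convA_left//; last exact: summ_l2.
  apply/funext => k; rewrite /conv -[RHS](tsum0 int); apply: eq_tsum => i.
  by rewrite -/(conv c r (k - i)) -/u u0 mulr0.
by move=> rE; apply/funext => k; apply/eqP; rewrite -subr_eq0 -[_ - _]/(r k) rE.
Qed.

End weighted.

(** * The Durbin--Levinson recursion in closed form *)

Section levinson.
Context {R : realType}.
Variable d : R.
Hypothesis hd : 0 < d < 1 / 2.
Let hd1 : 0 < d < 1. Proof. by case/andP: hd => *; lra. Qed.

Definition acov0 : int -> R := conv (rev (binc d)) (binc d).

Lemma acov_even (c : int -> R) k : conv (rev c) c (- k) = conv (rev c) c k.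
Proof. by rewrite -[LHS]/(rev (conv (rev c) c) k) rev_conv revK convC. Qed.

Lemma acov0S k : ((k + 1)%:~R - d) * acov0 (k + 1) = (k%:~R + d) * acov0 k.
Proof. by apply: conv_rev_binc => //; exact: binc_dec. Qed.

Lemma intrD_neq0 (k : int) : (k%:~R + d : R) != 0.
Proof.
have := intr_neq (- k) hd1; rewrite mulrNz -opprD oppr_eq0; exact.
Qed.

(* Durbin--Levinson recursion. The correlations [conv acov0 p] of the n-th
   predictor are those of the previous one multiplied by
   (n - 2 d) / (n - d) * (k - n) / (k - n + d). *)
Lemma levinson_ex (n : nat) : exists p : int -> R,
  [/\ finsupp n p, p 0 = 1,
      (forall k : int, 0 < k <= n%:Z -> conv acov0 p k = 0),
      (forall k : int, (k%:~R - n.+1%:R + d) * conv acov0 p (n.+1%:Z - k) = (k%:~R - d) * conv acov0 p k) &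
      (forall k : int, (k%:~R - d) * (k%:~R - n.+1%:R) * conv acov0 p k =
         (k%:~R - 1) * (k%:~R - n.+1%:R + d) * conv acov0 p (k - 1))].
Proof.
elim: n => [|n [p [hp p0 Hz HR HS]]].
  exists delta; split.
  - by move=> k hk; rewrite /delta; case: eqP => // k0; move: hk; rewrite k0.
  - by rewrite /delta eqxx.
  - by move=> k hk; lia.
  (* For n = 0 the correlations are [acov0] itself, and both identities are its first-order
     recursion. *)
  - move=> k; rewrite !(convC acov0) !conv_delta.
    have := acov0S (- k); rewrite (addrC (- k)) (acov_even (binc d) k : acov0 _ = _).
    rewrite !intrD !mulrNz -/acov0 => h.
    transitivity (- ((1%:~R - k%:~R - d) * acov0 (1 - k))); first by ring.
    by rewrite h; ring.
  - move=> k; rewrite !(convC acov0) !conv_delta.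
    have := acov0S (k - 1); rewrite subrK intrD mulrNz => h.
    by rewrite mulrAC h; ring.
have e1 : 1 + n%:R = n.+1%:R :> R by rewrite nat1r.
have e2 : 2 + n%:R = n.+2%:R :> R by rewrite -natrD.
(* The reflection coefficient: the ratio of the correlations at n + 1 and 0, as given by the
   reflection identity [HR] at k = 0. *)
pose al : R := d / (n.+1%:R - d).
have nd : (n.+1%:R - d : R) != 0 by exact: (intr_neq n.+1 hd1).
pose p' k := p k - al * p (n.+1%:Z - k).
have hp' : finsupp n.+1 p'.
  by move=> k hk; rewrite /p' !hp ?mulr0 ?subrr//; lia.
have sp : finsupp n.+1 p by move=> k hk; rewrite hp//; lia.
have sp1 : finsupp n.+1 (fun k => p (n.+1%:Z - k)).
  by move=> k hk; rewrite hp//; lia.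
have nz k : (k%:~R - n.+1%:R + d : R) != 0.
  by have := intrD_neq0 (k - n.+1%:Z); rewrite intrD mulrNz.
have q'E0 k : conv acov0 p' k = conv acov0 p k - al * conv acov0 p (n.+1%:Z - k).
  rewrite !(convC acov0) /conv [X in al * X](tsum_bij _ (refl_bij n.+1%:Z)).
  rewrite -tsumZ; last first.
    apply: (summ_finsupp (fun i => acov0 (n.+1%:Z - k - (n.+1%:Z - i))) sp1).
  rewrite -tsumB; first last.
  - by apply: summZ; apply: (summ_finsupp (fun i => acov0 (n.+1%:Z - k - (n.+1%:Z - i))) sp1).
  - exact: (summ_finsupp _ sp).
  apply: eq_tsum => i; rewrite /p' mulrBl; congr (_ - _); rewrite mulrA; congr (_ * _).
  rewrite -[LHS]acov_even -/acov0; congr (acov0 _); ring.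
have q'E k : conv acov0 p' k = (1 - al) * (k%:~R - n.+1%:R) / (k%:~R - n.+1%:R + d) * conv acov0 p k.
  rewrite q'E0; apply: (mulfI (nz k)); rewrite mulrBr mulrCA HR.
  by rewrite /al; field; rewrite e1 nd nz.
(* The new normal equation, at k = n + 1, holds because the factor k - n - 1 vanishes there. *)
have HZ' k : 0 < k <= n.+1%:Z -> conv acov0 p' k = 0.
  move=> hk; rewrite q'E; have [->|kn] := eqVneq k n.+1%:Z.
    by rewrite -pmulrn subrr mulr0 !mul0r.
  by rewrite Hz ?mulr0//; lia.
have HS' k : (k%:~R - d) * (k%:~R - n.+2%:R) * conv acov0 p' k =
         (k%:~R - 1) * (k%:~R - n.+2%:R + d) * conv acov0 p' (k - 1).
  have nz2 : (k%:~R - n.+2%:R + d : R) != 0.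
    by have := intrD_neq0 (k - n.+2%:Z); rewrite intrD mulrNz.
  rewrite !q'E intrD (_ : k%:~R + (-1)%:~R - n.+1%:R = k%:~R - n.+2%:R); last first.
    by rewrite mulrNz -[n.+2]add1n natrD; ring.
  transitivity ((1 - al) * (k%:~R - n.+2%:R) / (k%:~R - n.+1%:R + d) *
     ((k%:~R - d) * (k%:~R - n.+1%:R) * conv acov0 p k)); first by ring.
  by rewrite HS; field; rewrite e1 e2 nz nz2.
have p'0 : p' 0 = 1.
  by rewrite /p' subr0 p0 hp ?mulr0 ?subr0//; lia.
exists p'; split => // k.
have nz2 : (k%:~R - n.+2%:R + d : R) != 0.
  by have := intrD_neq0 (k - n.+2%:Z); rewrite intrD mulrNz.
have nz3 : (1 - k%:~R + d : R) != 0.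
  by have := intrD_neq0 (1 - k); rewrite intrD mulrNz.
(* The old reflection identity at k - 1 relates n + 2 - k to k - 1, and the shift identity [HS]
   relates k - 1 to k; together they give the new reflection identity. *)
have := HR (k - 1); rewrite (_ : n.+1%:Z - (k - 1) = n.+2%:Z - k); last by lia.
have := HS k; rewrite !q'E !intrD !mulrNz -!pmulrn.
set Q := conv _ _ (n.+2%:Z - k); set Q0 := conv _ _ k; set Q1 := conv _ _ (k - 1).
move=> E1 E2.
transitivity ((1 - al) * (1 - k%:~R) / (1 - k%:~R + d) * ((k%:~R - 1 - n.+1%:R + d) * Q)).
  by rewrite -e1 -e2; field.
rewrite E2.
transitivity ((1 - al) / (k%:~R - n.+1%:R + d) * ((k%:~R - d) * (k%:~R - n.+1%:R) * Q0)).
  by rewrite E1; field; rewrite e1 nz nz3.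
by field; rewrite e1 nz.
Qed.

(** The last claim is the reflection identity at k = 0. *)
Lemma pure_predictor (n : nat) : exists p : int -> R,
  [/\ finsupp n p, p 0 = 1,
      (forall k : int, 0 < k <= n%:Z -> conv acov0 p k = 0) &
      conv acov0 p n.+1%:Z = d / (n.+1%:R - d) * conv acov0 p 0].
Proof.
have [p [hp p0 Hz HR _]] := levinson_ex n; exists p; split => //.
have nd : (n.+1%:R - d : R) != 0 by exact: (intr_neq n.+1 hd1).
have := HR 0; rewrite subr0 !sub0r (_ : - n.+1%:R + d = - (n.+1%:R - d)); last ring.
rewrite !mulNr => /oppr_inj h.
by apply: (mulfI nd); rewrite h mulrA [_ * (d / _)]mulrC mulfVK.
Qed.

End levinson.

(** * Asymptotics of the predictors *)

Section predictor_of_solutions.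
Context {R : realType}.
Variables (a c : int -> R) (s : R) (n : nat).
Hypotheses (ca : causal a) (cc : causal c) (sa : summ a).
Hypotheses (hs : 1 / 2 < s) (hc : dec s c) (ac : conv a c = delta).
Let phi := conv (rev c) a.
Hypotheses (hphi : dec 1 phi) (n0 : (0 < n)%N).
Variables (v yp ym : nat -> R) (q : R).
Let b (i j : nat) := phi (n + i + j)%N.
Hypotheses (v0 : forall i, 0 < v i) (hb : schur q b v).
Hypothesis hv : exists2 C, 0 <= C & forall i : nat, v i <= C * i.+1%:R `^ (- s).
Hypotheses (hyp : solves v b yp) (hym : solves v (fun i j => - b i j) ym).

(** Once [G] is reflected and [F] is shifted by n, causality of [U] with U 0 = 1 and vanishing of
    [V] from n on form the system G + b F = e0, F + b G = 0. It decouples for G - F and G + F, which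
    are [yp] and [ym]. *)
Let Gn j := (yp j + ym j) / 2.
Let Fn j := - (yp j - ym j) / 2.
Let G (k : int) : R := if k <= 0 then Gn `|k| else 0.
Let F (k : int) : R := if n%:Z <= k then Fn `|k - n%:Z| else 0.

Let bounded_v : exists L, [/\ 0 <= L, forall i, `|Gn i| <= L * v i & forall i, `|Fn i| <= L * v i].
Proof.
have [_ [L [L0 hL]]] := hyp; have [_ [M [M0 hM]]] := hym.
exists ((L + M) / 2); split; first by rewrite divr_ge0// addr_ge0.
- move=> i; rewrite /Gn normrM [X in _ * X]ger0_norm// mulrAC ler_wpM2r// mulrDl.
  exact: le_trans (ler_normD _ _) (lerD (hL i) (hM i)).
- move=> i; rewrite /Fn mulNr normrN normrM [X in _ * X]ger0_norm// mulrAC ler_wpM2r// mulrDl.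
  exact: le_trans (ler_normB _ _) (lerD (hL i) (hM i)).
Qed.

Let kapNb x i : kap (fun i j => - b i j) x i = - kap b x i.
Proof. by rewrite /kap -tsumN; apply: eq_tsum => j; rewrite mulNr. Qed.

Let GE i : Gn i + kap b Fn i = e0 i.
Proof.
have [ypE [L [L0 hL]]] := hyp; have [ymE [M [M0 hM]]] := hym.
have -> : kap b Fn i = - (1 / 2) * (kap b yp i - kap b ym i).
  rewrite -(kapB v0 _ hb hL hM) /kap -tsumZ.
    by apply: eq_tsum => j; rewrite /Fn; ring.
  apply: (summ_kap v0 (K := L + M) _ hb) => j.
  by rewrite mulrDl (le_trans (ler_normB _ _))// lerD.
rewrite /Gn ypE ymE kapNb; lra.
Qed.

Let FE i : Fn i + kap b Gn i = 0.
Proof.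
have [ypE [L [L0 hL]]] := hyp; have [ymE [M [M0 hM]]] := hym.
have -> : kap b Gn i = (1 / 2) * (kap b yp i + kap b ym i).
  rewrite /kap -tsumD; [|exact: (summ_kap v0 _ hb hL)|exact: (summ_kap v0 _ hb hM)].
  rewrite -tsumZ.
    by apply: eq_tsum => j; rewrite /Gn; field.
  by apply: summD; [exact: (summ_kap v0 _ hb hL)|exact: (summ_kap v0 _ hb hM)].
rewrite /Fn ypE ymE kapNb; lra.
Qed.

Let decG : dec s G.
Proof.
have [L [L0 hG _]] := bounded_v; have [C C0 hC] := hv.
exists (L * C); first by rewrite mulr_ge0.
move=> k; rewrite /G; case: ifP => [k0|_]; last first.
  by rewrite normr0 !mulr_ge0// powR_ge0.
apply: le_trans (hG _) _; rewrite -mulrA ler_wpM2l//.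
by rewrite -wtN (_ : - k = `|k|%N) ?wtN_nat//; lia.
Qed.

Let decF : dec s F.
Proof.
have [L [L0 _ hF]] := bounded_v; have [C C0 hC] := hv.
have s0 : 0 <= s by apply: le_trans (ltW hs).
exists (L * C * wt n `^ s); first by rewrite !mulr_ge0// powR_ge0.
move=> k; rewrite /F; case: ifP => [nk|_]; last first.
  by rewrite normr0 !mulr_ge0// powR_ge0.
apply: le_trans (hF _) _; rewrite -!mulrA ler_wpM2l//.
apply: le_trans (hC _) _; rewrite ler_wpM2l// -wtN_nat.
rewrite !powRN ler_pdivlMr ?powR_gt0 ?wt_gt0// mulrC ler_pdivrMr ?powR_gt0 ?wt_gt0//.
rewrite -powRM ?wt_ge0// ge0_ler_powR ?nnegrE ?mulr_ge0 ?wt_ge0//.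
by rewrite {1}(_ : k = n%:Z + `|k - n%:Z|%N) ?wtM//; lia.
Qed.

Let convF k : conv (rev phi) F k = tsum (fun m : nat => phi (n%:Z + m - k) * Fn m).
Proof.
rewrite convC /conv (tsum_bij _ (shift_bij n%:Z)) tsum_causal; last first.
  by move=> i i0; rewrite /F; case: ifP; rewrite ?mul0r//; lia.
apply: eq_tsum => m; rewrite /F ifT; last lia.
by rewrite mulrC /rev; congr (phi _ * Fn _); lia.
Qed.

Let convG k : conv phi G k = tsum (fun m : nat => phi (k + m) * Gn m).
Proof.
rewrite convC /conv (tsum_bij _ opp_bij) tsum_causal; last first.
  by move=> i i0; rewrite /G; case: ifP; rewrite ?mul0r//; lia.
apply: eq_tsum => m; rewrite /G ifT; last lia.
by rewrite mulrC; congr (phi _ * Gn _); lia.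
Qed.

Let hU (j : nat) : G (- j%:Z) + conv (rev phi) F (- j%:Z) = e0 j.
Proof.
rewrite convF -GE /G ifT; last lia.
rewrite (_ : `|- j%:Z|%N = j); last lia.
congr (_ + _); apply: eq_tsum => m; congr (phi _ * _); lia.
Qed.

Lemma predictor_of_solutions : exists p K : _,
  [/\ K != 0 :> R, finsupp n.-1 p, p 0 = 1,
     forall k : int, 0 < k -> k < n%:Z -> conv (conv (rev c) c) p k = 0 &
     conv (conv (rev c) c) p 0 = K * (yp 0%N + ym 0%N) /\
     conv (conv (rev c) c) p n%:Z = K * (ym 0%N - yp 0%N)].
Proof.
have lc := dec_l2 hs hc.
have lG := dec_l2 hs decG; have lF := dec_l2 hs decF.
have lphi : l2 phi by apply: dec_l2 hphi; lra.
have tF k : tri (rev c) (rev phi) F k.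
  by apply: (dec_tri _ hs) => //; exact: dec_rev.
have suppG k : 0 < k -> G k = 0 by rewrite /G; case: ifP => //; lia.
have suppF k : k < n%:Z -> F k = 0 by rewrite /F; case: ifP => //; lia.
have cU : causal (fun k => G k + conv (rev phi) F k).
  move=> k k0; have := hU `|k|; rewrite (_ : - `|k|%N%:Z = k); last lia.
  by move=> ->; rewrite /e0; case: eqP => //; lia.
have V0 k : n%:Z <= k -> conv phi G k + F k = 0.
  move=> nk; rewrite convG /F nk -(FE `|k - n%:Z|) [RHS]addrC; congr (_ + _).
  apply: eq_tsum => m; congr (phi _ * _); lia.
have ac0 : a 0 * c 0 = 1 by rewrite -conv_causal0// ac /delta eqxx.
have [a0 c0] : a 0 != 0 /\ c 0 != 0.
  by split; apply: contra_eq_neq ac0 => ->; rewrite ?mul0r ?mulr0 eq_sym oner_neq0.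
pose p0 k := conv a G k + conv (rev a) F k.
have hp0 : finsupp n.-1 p0.
  move=> k; have [k0 _|k0] := ltP k 0.
    exact: (predictor_causal ca sa lc ac lphi lF lG cU).
  have [nk _|nk] := leP n%:Z k; last by lia.
  exact: (predictor_supp ca sa lc ac lphi lF lG V0).
have p00 : p0 0 = a 0.
  rewrite /p0 (predictor0 ca sa lc ac lphi lF lG cU).
  by have := hU 0; rewrite oppr0 => ->; rewrite mulr1.
(* Here [p0 0] is [a 0], so division by it normalizes; the same scalar c 0 / (2 a 0) multiplies both
   end correlations and cancels in their ratio. *)
exists (fun k => (a 0)^-1 * p0 k), (c 0 / (2 * a 0)).
have E k : conv (conv (rev c) c) (fun k => (a 0)^-1 * p0 k) k =
    (a 0)^-1 * conv (conv (rev c) c) p0 k.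
  rewrite convZr//; have := summ_finsupp (fun i => conv (rev c) c (k - i)) hp0.
  move=> /(summ_bij _ (refl_bij k)).1; congr summ; apply/funext => i.
  by rewrite subKr mulrC.
split.
- by rewrite mulf_neq0// invr_neq0// mulf_neq0// pnatr_eq0.
- by move=> k hk; rewrite hp0 ?mulr0.
- by rewrite p00 mulVf.
- move=> k k0 kn; rewrite E (gamma_predictor_in ca cc sa lc ac lphi lF lG tF suppG suppF)//.
  by rewrite mulr0.
rewrite !E (gamma_predictor0 ca cc sa lc ac lphi lF lG tF suppG suppF)//.
rewrite (gamma_predictor_n ca cc sa lc ac lphi lF lG tF suppG suppF)//.
rewrite /G /F lexx lexx subrr /Gn /Fn absz0.
by split; field.
Qed.

End predictor_of_solutions.

(** * Weights adapted to shifted Hilbert matrices *)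

Section weight.
Context {R : realType}.

Lemma sum_inv_sqr_le (m n : nat) : (1 < m)%N ->
  \sum_(0 <= j < n) (((m + j)%:R : R) ^+ 2)^-1 <= (m.-1%:R)^-1.
Proof.
move=> m1.
have H : \sum_(0 <= j < n) (((m + j)%:R : R) ^+ 2)^-1 <= (m.-1%:R)^-1 - ((m.-1 + n)%:R)^-1.
  elim: n => [|n ih]; first by rewrite big_geq// addn0 subrr.
  rewrite big_nat_recr//=; apply: le_trans (lerD ih (lexx _)) _.
  have -> : (m + n)%N = (m.-1 + n).+1 by lia.
  have -> : (m.-1 + n.+1)%N = (m.-1 + n).+1 by lia.
  have x0 : (0 : R) < (m.-1 + n)%:R by rewrite ltr0n; lia.
  rewrite -[(m.-1 + n).+1%:R]natr1; move: ((m.-1 + n)%:R) x0 => x x0.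
  have x1 : 0 < x + 1 by rewrite addr_gt0.
  suff : (x + 1)^-1 + ((x + 1) ^+ 2)^-1 <= x^-1 by lra.
  rewrite -subr_ge0 (_ : _ - _ = (x * (x + 1) ^+ 2)^-1).
    by rewrite invr_ge0 mulr_ge0 ?sqr_ge0// ltW.
  by field; rewrite !gt_eqF.
by apply: le_trans H _; rewrite gerBl invr_ge0.
Qed.

Variables (d e : R) (n : nat).
Hypotheses (d0 : 0 < d) (de : d < e) (e2 : e < 1 / 2) (n3 : (2 < n)%N).
(** Half of the shift goes to each index: (nu + i) + (nu + j) + 1 <= n + i + j, and the spare 1
    absorbs d + e < 1. *)
Let nu := n.-1./2.
Let he : 0 < e < 1 / 2. Proof. by apply/andP; split=> //; exact: lt_trans de. Qed.
Let he1 : 0 < e < 1. Proof. by case/andP: he => *; lra. Qed.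

(* A shifted eigenvector of the Hilbert matrix 1 / (i + j + e), see [hilb_eigen]:
   as [hilb] increases, an exponent [e > d] leaves room for a contraction. *)
Definition wgt (i : nat) : R := binc e (nu + i)%N / binc e nu.

Let nu0 : (0 < nu)%N. Proof. rewrite /nu; lia. Qed.
Let u0 : 0 < binc e nu. Proof. exact: binc_gt0. Qed.

Lemma wgt_gt0 i : 0 < wgt i. Proof. by rewrite divr_gt0// binc_gt0. Qed.

Lemma wgt0 : wgt 0%N = 1. Proof. by rewrite /wgt addn0 divff// gt_eqF. Qed.

Lemma wgt_le1 i : wgt i <= 1.
Proof.
rewrite ler_pdivrMr// mul1r; elim: i => [|i ih]; first by rewrite addn0.
by rewrite addnS; apply: le_trans (binc_decr he1 _) ih.
Qed.

(** As k times [binc e k] is nondecreasing, the weight falls no faster than 1 / (nu + i); this lets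
    it dominate the columns of the kernels. *)
Lemma wgt_ge i : nu%:R / (nu + i)%:R <= wgt i.
Proof.
rewrite ler_pdivrMr ?ltr0n ?addn_gt0 ?nu0// /wgt mulrAC ler_pdivlMr//.
by rewrite [leRHS]mulrC binc_incr// leq_addr.
Qed.

Lemma wgt_dec : exists2 C, 0 <= C & forall i, wgt i <= C * i.+1%:R `^ (- (1 - e)).
Proof.
have [C C0 hC] := binc_dec he1; exists (C / binc e nu); first by rewrite divr_ge0// ltW.
move=> i; rewrite mulrAC ler_wpM2r ?invr_ge0 ?(ltW u0)//.
have h j : binc e (j + i)%N <= binc e i.
  by elim: j => // j ih; apply: le_trans ih; rewrite addSn binc_decr.
by apply: le_trans (h _) _; rewrite -wtN_nat; apply: le_trans (hC i); exact: ler_norm.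
Qed.

Let sub_le (i j : nat) : 0 < (n + i + j)%:R - d /\
  ((n + i + j)%:R - d)^-1 <= ((nu + i)%:R + (nu + j)%:R + e)^-1.
Proof.
have h : ((nu + i)%:R + (nu + j)%:R + 1 : R) <= (n + i + j)%:R.
  by rewrite -!natrD natr1 ler_nat /nu; lia.
have p : (0 : R) <= (nu + i)%:R + (nu + j)%:R by rewrite addr_ge0.
by move: d0 de e2 h p => *; split; [|rewrite lef_pV2 ?posrE]; lra.
Qed.

(** The entries are dominated by multiples of those of the Hilbert matrix at the indices nu + i and
    nu + j. Omitting the indices below nu from the eigenvector identity only lowers the sum, so the
    eigenvalue 1 becomes the bound K / hilb e. *)
Lemma schur_wgt (b : nat -> nat -> R) K :
  0 <= K -> (forall i j, `|b i j| <= K / ((n + i + j)%:R - d)) ->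
  schur (K / hilb e) b wgt.
Proof.
move=> K0 hb i; have [sE tE] := hilb_eigen he (nu + i)%N.
have h0 := hilb_gt0 he.
pose f (j : nat) := binc e j * (hilb e / ((nu + i)%:R + j%:R + e)).
have f0 j : 0 <= f j.
  rewrite mulr_ge0 ?divr_ge0 ?(ltW h0) ?binc_ge0//.
  by rewrite !addr_ge0// ltW//; case/andP: he.
have sf : summ (fun j => f (nu + j)%N).
  by apply: (summ_sub_inj (h := addn nu)) => //; exact: addnI.
pose M := K / hilb e / binc e nu.
have M0 : 0 <= M by rewrite !divr_ge0// ltW.
have hbj j : `|b i j * wgt j| <= M * f (nu + j)%N.
  rewrite normrM (gtr0_norm (wgt_gt0 j)).
  have [_ h2] := sub_le i j.
  apply: (@le_trans _ _ (K * ((nu + i)%:R + (nu + j)%:R + e)^-1 * wgt j)).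
    apply: ler_wpM2r; first exact/ltW/wgt_gt0.
    by apply: le_trans (hb i j) _; rewrite ler_wpM2l.
  rewrite le_eqVlt; apply/orP; left; apply/eqP; rewrite /M /f /wgt.
  have : (nu + i)%:R + (nu + j)%:R + e != 0.
    by rewrite gt_eqF// ltr_wpDl ?addr_ge0//; case/andP: he.
  by move: (_ + _ + e) => A h; field; rewrite h !gt_eqF.
have s : summ (fun j => b i j * wgt j).
  apply: (summ_le _ (summZ M sf)) => j; apply: le_trans (hbj j) (ler_norm _).
split=> //.
apply: (@le_trans _ _ (M * tsum (fun j => f (nu + j)%N))).
  rewrite -tsumZ//; apply: le_tsum => //; [exact: summ_norm|exact: summZ].
rewrite /M -[leLHS]mulrA ler_wpM2l ?divr_ge0 ?(ltW h0)//.
rewrite /wgt mulrC ler_wpM2r ?invr_ge0 ?(ltW u0)// -tE.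
by apply: (@tsum_sub_inj _ _ _ (addn nu) f) => //; exact: addnI.
Qed.

Let inv_nu : (nu%:R : R)^-1 <= 4 / n%:R.
Proof.
have n0 : (0 : R) < n%:R by rewrite ltr0n; lia.
have nn : (0 : R) < nu%:R by rewrite ltr0n.
rewrite -[leLHS]mul1r ler_pdivrMr// mulrAC ler_pdivlMr// mul1r -natrM ler_nat /nu; lia.
Qed.

Let inv_nui i : ((nu + i)%:R : R)^-1 <= 4 / n%:R * wgt i.
Proof.
have nn : (0 : R) < nu%:R by rewrite ltr0n.
apply: (@le_trans _ _ ((nu%:R)^-1 * (nu%:R / (nu + i)%:R))).
  by rewrite mulrA mulVf ?gt_eqF// mul1r.
by rewrite ler_pM ?invr_ge0 ?divr_ge0 ?wgt_ge.
Qed.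

Lemma col_wgt (b : nat -> nat -> R) K :
  0 <= K -> (forall i j, `|b i j| <= K / ((n + i + j)%:R - d)) ->
  forall i, `|b i 0%N| <= K * (4 / n%:R) * wgt i.
Proof.
move=> K0 hb i; apply: le_trans (hb i 0%N) _; rewrite -mulrA ler_wpM2l//.
apply: le_trans (inv_nui i); have [_ h] := sub_le i 0; apply: le_trans h _.
have p : (0 : R) < (nu + i)%:R by rewrite ltr0n addn_gt0 nu0.
have q : (0 : R) <= (nu + 0)%:R by [].
by move: d0 de => *; rewrite lef_pV2 ?posrE//; lra.
Qed.

(** The weight is at most 1, so a row sums to at most K / (n + i - 1) by telescoping; this is at
    most K / (nu + i), and [inv_nui] converts it into the weight with the gain 4 / n. *)
Lemma schur_err (E : nat -> nat -> R) K :
  0 <= K -> (forall i j, `|E i j| <= K / (n + i + j)%:R ^+ 2) ->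
  schur (K * (4 / n%:R)) E wgt.
Proof.
move=> K0 hE i.
pose f (j : nat) : R := ((n + i + j)%:R ^+ 2)^-1.
have f0 j : 0 <= f j by rewrite invr_ge0 sqr_ge0.
have bnd N : \sum_(0 <= j < N) `|f j| <= ((n + i).-1%:R)^-1.
  under eq_bigr do rewrite ger0_norm//; apply: sum_inv_sqr_le; lia.
have sf : summ f by exact: summ_nat_bound bnd.
have tf : tsum f <= ((n + i).-1%:R)^-1.
  have /cvg_lim := tsum_nat sf => <-//; apply: limr_le.
    by apply/cvg_ex; eexists; exact: (tsum_nat sf).
  apply: nearW => N; apply: le_trans (bnd N); rewrite /series /=.
  by apply: ler_sum => j _; exact: ler_norm.
have hj j : `|E i j * wgt j| <= K * f j.
  rewrite normrM (gtr0_norm (wgt_gt0 j)) -[leRHS]mulr1.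
  by rewrite ler_pM ?wgt_le1 ?hE// ltW// wgt_gt0.
have s : summ (fun j => E i j * wgt j).
  by apply: (summ_le _ (summZ K sf)) => j; apply: le_trans (hj j) (ler_norm _).
split=> //; apply: (@le_trans _ _ (K * tsum f)).
  rewrite -tsumZ//; apply: le_tsum => //; [exact: summ_norm|exact: summZ].
rewrite -mulrA ler_wpM2l//; apply: le_trans tf _; apply: le_trans (inv_nui i).
by rewrite lef_pV2 ?posrE ?ltr0n ?ler_nat /nu; lia.
Qed.

Lemma col_err (E : nat -> nat -> R) K :
  0 <= K -> (forall i j, `|E i j| <= K / (n + i + j)%:R ^+ 2) ->
  forall i, `|E i 0%N| <= K * (4 / n%:R ^+ 2) * wgt i.
Proof.
move=> K0 hE i; apply: le_trans (hE i 0%N) _; rewrite -mulrA ler_wpM2l//.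
have n0 : (0 : R) < n%:R by rewrite ltr0n; lia.
apply: (@le_trans _ _ (n%:R^-1 * (nu + i)%:R^-1)); last first.
  rewrite (_ : 4 / _ * _ = n%:R^-1 * (4 / n%:R * wgt i)); last by field; rewrite gt_eqF.
  by rewrite ler_wpM2l// invr_ge0 ltW.
rewrite -invfM lef_pV2 ?posrE ?mulr_gt0 ?exprn_gt0 ?ltr0n//; try lia.
by rewrite addn0 expr2 -!natrM ler_nat leq_mul// /nu; lia.
Qed.

End weight.

(** * Comparison of the solutions for two nearby kernels *)

Section comparison.
Context {R : realType}.
Variables (d e K C : R) (n : nat).
Hypotheses (d0 : 0 < d) (de : d < e) (e2 : e < 1 / 2) (n3 : (2 < n)%N).
Hypotheses (K0 : 0 <= K) (KH : K < hilb e) (C0 : 0 <= C).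
Let he : 0 < e < 1 / 2. Proof. by apply/andP; split=> //; exact: lt_trans de. Qed.
Let H0 := hilb_gt0 he.
Let q := K / hilb e.
(** One constant for two roles in [perturbation]: [K * 4] bounds the first column and [C * 4] the
    difference of the kernels. *)
Let eta := K * 4 + C * 4.
Variables b b0 : nat -> nat -> R.
Hypothesis hb : forall i j, `|b i j| <= K / ((n + i + j)%:R - d).
Hypothesis hb0 : forall i j, `|b0 i j| <= K / ((n + i + j)%:R - d).
Hypothesis hE : forall i j, `|b i j - b0 i j| <= C / (n + i + j)%:R ^+ 2.
Hypothesis n_large : 2 * (eta / (1 - q)) <= n%:R.

Let hq : 0 <= q < 1.
Proof. by rewrite /q divr_ge0 ?(ltW H0)//= ltr_pdivrMr// mul1r. Qed.
Let q1 : 0 < 1 - q. Proof. by rewrite subr_gt0; case/andP: hq. Qed.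
Let eta0 : 0 <= eta. Proof. by rewrite /eta addr_ge0// mulr_ge0. Qed.
Let n0 : (0 : R) < n%:R. Proof. by rewrite ltr0n (ltn_trans _ n3). Qed.
Let v0 := wgt_gt0 n d0 de e2.
Let v01 : 1 <= wgt e n 0%N. Proof. by rewrite (wgt0 n d0 de e2). Qed.

Let col (B : nat -> nat -> R) :
  (forall i j, `|B i j| <= K / ((n + i + j)%:R - d)) ->
  forall i, `|B i 0%N| <= eta / n%:R * wgt e n i.
Proof.
move=> h i; apply: le_trans (col_wgt d0 de e2 n3 K0 h i) _.
rewrite ler_wpM2r ?(ltW (v0 _))// mulrA ler_wpM2r ?invr_ge0 ?(ltW n0)//.
by rewrite lerDl mulr_ge0.
Qed.

(** Keeps the first entries in [1/2, 3/2], so that the sums of two of them used as denominators are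
    at least 1. *)
Let near1 B y : (forall i j, `|B i j| <= K / ((n + i + j)%:R - d)) ->
  solves (wgt e n) B y -> `|y 0%N - 1| <= 1 / 2.
Proof.
move=> h sy.
have etan : 0 <= eta / n%:R by rewrite divr_ge0 ?(ltW n0).
have := solves_sub_e0 v0 v01 hq etan (schur_wgt d0 de e2 n3 K0 h) (col h) sy 0%N.
rewrite (wgt0 n d0 de e2) mulr1 => /le_trans; apply.
rewrite mulrAC ler_pdivrMr//; move: n_large; move: (eta / _) => x; lra.
Qed.

Lemma solves_compare : exists y y0,
  [/\ solves (wgt e n) b y, solves (wgt e n) b0 y0,
      `|y 0%N - 1| <= 1 / 2, `|y0 0%N - 1| <= 1 / 2 &
      `|y 0%N - y0 0%N| <= (C * 4 + eta * (eta / (1 - q))) / (1 - q) / n%:R ^+ 2].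
Proof.
have [y hy] := solves_ex v0 v01 hq (schur_wgt d0 de e2 n3 K0 hb).
have [y0 hy0] := solves_ex v0 v01 hq (schur_wgt d0 de e2 n3 K0 hb0).
exists y, y0; split => //; [exact: near1 hy|exact: near1 hy0|].
have etan : 0 <= eta / n%:R by rewrite divr_ge0 ?(ltW n0).
have Cn : 0 <= C * (4 / n%:R ^+ 2) by rewrite mulr_ge0// divr_ge0// exprn_ge0// ltW.
have SE : schur (eta / n%:R) (fun i j => b i j - b0 i j) (wgt e n).
  move=> i; have [s t] := schur_err d0 de e2 n3 C0 hE i; split => //.
  apply: le_trans t _; rewrite ler_wpM2r ?(ltW (v0 _))// mulrA.
  by rewrite ler_wpM2r ?invr_ge0 ?(ltW n0)// lerDr mulr_ge0.
have := perturbation v0 v01 hq etan Cn (schur_wgt d0 de e2 n3 K0 hb)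
  (schur_wgt d0 de e2 n3 K0 hb0) (col hb0) SE (col_err d0 de e2 n3 C0 hE) hy hy0 0%N.
rewrite (wgt0 n d0 de e2) mulr1 => /le_trans; apply.
rewrite le_eqVlt; apply/orP; left; apply/eqP.
move: eta (1 - q) q1 => E Q Q0; field.
by rewrite !gt_eqF.
Qed.

End comparison.

(** * Transfer from the pure process *)

Section asymptotics.
Context {R : realType}.
Variable d : R.
Hypothesis hd : 0 < d < 1 / 2.
Let d0 : 0 < d. Proof. by case/andP: hd. Qed.
Let d2 : d < 1 / 2. Proof. by case/andP: hd. Qed.
Let hd1 : 0 < d < 1. Proof. by move: d0 d2 => *; apply/andP; split; lra. Qed.

Variables (a c : int -> R) (C1 : R).
Hypotheses (ca : causal a) (cc : causal c) (sa : summ a).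
Hypotheses (hc : dec (1 - d) c) (ac : conv a c = delta).
Let phi := conv (rev c) a.
Hypothesis hphi : dec 1 phi.
Hypothesis C10 : 0 <= C1.
Hypothesis phi_phase0 : forall k : nat, (0 < k)%N ->
  `|phi k - phase0 d k| <= C1 / k%:R ^+ 2.

Lemma phase0_nat (k : nat) : (0 < k)%N -> 0 < k%:R - d /\ `|phase0 d k| = hilb d / (k%:R - d).
Proof.
move=> k0; have kd : 0 < k%:R - d.
  by rewrite subr_gt0; case/andP: hd1 => _ /lt_le_trans; apply; rewrite ler1n.
split=> //; rewrite phase0E// mulNr normrN ger0_norm// divr_ge0 ?ltW// hilb_gt0//.
Qed.

Lemma ratio_diff (x y x' y' D : R) : 1 <= x + y -> 1 <= x' + y' ->
  `|x - x'| <= D -> `|y - y'| <= D -> `|y' - x'| <= 1 ->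
  `|(y - x) / (x + y) - (y' - x') / (x' + y')| <= 4 * D.
Proof.
move=> g1 g2 hx hy h1.
have p1 : 0 < x + y by lra.
have p2 : 0 < x' + y' by lra.
rewrite (_ : _ - _ = ((y - y') - (x - x')) / (x + y) - (y' - x') * ((x - x') + (y - y')) / ((x + y) * (x' + y'))); last first.
  by field; rewrite !gt_eqF.
have D0 : 0 <= D by apply: le_trans hx.
have t1 : `|((y - y') - (x - x')) / (x + y)| <= 2 * D.
  rewrite normrM (ger0_norm (x := _^-1)) ?invr_ge0 ?(ltW p1)//.
  rewrite ler_pdivrMr//; apply: le_trans (ler_normB _ _) _.
  have : 2 * D * 1 <= 2 * D * (x + y) by rewrite ler_wpM2l// mulr_ge0.
  lra.
have t2 : `|(y' - x') * ((x - x') + (y - y')) / ((x + y) * (x' + y'))| <= 2 * D.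
  have P : 1 <= (x + y) * (x' + y') by rewrite -[leLHS]mulr1 ler_pM.
  rewrite normrM (ger0_norm (x := _^-1)) ?invr_ge0 ?mulr_ge0 ?(ltW p1) ?(ltW p2)//.
  rewrite ler_pdivrMr ?mulr_gt0// normrM.
  apply: (@le_trans _ _ (1 * (2 * D))).
    rewrite ler_pM//; apply: le_trans (ler_normD _ _) _; lra.
  rewrite mul1r -[leLHS]mulr1 ler_wpM2l// mulr_ge0//.
apply: le_trans (ler_normB _ _) _; lra.
Qed.

Lemma le_pred_lt (n : nat) (k : int) : (0 < n)%N -> k <= n.-1%:Z -> k < n%:Z.
Proof. by lia. Qed.

(** For the pure process the predictor built from [yp0] and [ym0] and the explicit one coincide by
    [predictor_unique]. The ratio formed from [yp0] and [ym0] is thus known exactly although neither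
    is computed. *)
Lemma predictor_ratio (e K : R) (n : nat) (b := fun i j => phi (n + i + j)%N)
    (b0 := fun i j => phase0 d (n + i + j)%N) (yp ym yp0 ym0 : nat -> R) :
  d < e -> e < 1 / 2 -> (2 < n)%N -> 0 <= K -> K < hilb e ->
  (forall i j, `|b i j| <= K / ((n + i + j)%:R - d)) ->
  (forall i j, `|b0 i j| <= K / ((n + i + j)%:R - d)) ->
  solves (wgt e n) b yp -> solves (wgt e n) (fun i j => - b i j) ym ->
  solves (wgt e n) b0 yp0 -> solves (wgt e n) (fun i j => - b0 i j) ym0 ->
  `|yp 0%N - 1| <= 1 / 2 -> `|ym 0%N - 1| <= 1 / 2 ->
  `|yp0 0%N - 1| <= 1 / 2 -> `|ym0 0%N - 1| <= 1 / 2 ->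
  exists p : int -> R,
  [/\ finsupp n.-1 p, p 0 = 1,
      forall k : int, 0 < k -> k < n%:Z -> conv (conv (rev c) c) p k = 0,
      conv (conv (rev c) c) p n%:Z / conv (conv (rev c) c) p 0 =
        (ym 0%N - yp 0%N) / (yp 0%N + ym 0%N) &
      (ym0 0%N - yp0 0%N) / (yp0 0%N + ym0 0%N) = d / (n%:R - d)].
Proof.
move=> de e2 n3 K0 KH hb hb0 hyp hym hyp0 hym0 nyp nym nyp0 nym0.
have he : 0 < e < 1 / 2 by apply/andP; split => //; apply: lt_trans de.
have He0 := hilb_gt0 he.
have v0 := wgt_gt0 n d0 de e2.
have hv := wgt_dec n d0 de e2.
have hq : K / hilb e < 1 by rewrite ltr_pdivrMr// mul1r.
(* The weights are only known to decay with the exponent 1 - e < 1 - d, so the factors are used with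
   this weaker exponent; it still exceeds 1/2 because e < 1/2. *)
have s1 : 1 / 2 < 1 - e by lra.
have de' : 1 - e <= 1 - d by lra.
have e1 : 0 < 1 - e < 1 by case/andP: he => *; apply/andP; split; lra.
have zp : yp 0%N + ym 0%N != 0.
  by rewrite gt_eqF//; move: nyp nym; rewrite !ler_norml => /andP[? ?] /andP[? ?]; lra.
have zp0 : yp0 0%N + ym0 0%N != 0.
  by rewrite gt_eqF//; move: nyp0 nym0; rewrite !ler_norml => /andP[? ?] /andP[? ?]; lra.
have npos : (0 < n)%N by exact: ltn_trans n3.
have hc' : dec (1 - e) c by exact: dec_weaken hc.
have bc : dec (1 - e) (binc d) by apply: dec_weaken (binc_dec hd1).
have [p [L [L0 hp p0 Hz [Hp0 Hpn]]]] :=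
  predictor_of_solutions ca cc sa s1 hc' ac hphi npos v0 (schur_wgt d0 de e2 n3 K0 hb) hv hyp hym.
have [p' [L' [L'0 hp' p'0 Hz' [Hp'0 Hp'n]]]] :=
  predictor_of_solutions (@binc_causal _ _) (@binc_causal _ _) (summ_bincN hd1) s1 bc (conv_binc d) (dec_phase0 hd) npos v0 (schur_wgt d0 de e2 n3 K0 hb0) hv hyp0 hym0.
have [p'' [hp'' p''0 Hz'' Hp''n]] := pure_predictor hd n.-1.
have pp : p' = p''.
  apply: (@predictor_unique R (1 - e) (binc (- d)) (binc d) n.-1) => //.
  - by rewrite s1 /= ltW//; case/andP: e1.
  - exact: summ_bincN.
  - exact: conv_binc.
  - by rewrite p'0 p''0.
  - by move=> k /andP[k0 k1]; apply: Hz' => //; exact: le_pred_lt.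
exists p; split => //.
  by rewrite Hp0 Hpn; field; rewrite L0 andbT.
move: Hp''n; rewrite prednK// -pp -/(acov0 d) => h.
rewrite /acov0 in h; rewrite Hp'0 Hp'n mulrCA in h.
by move/(mulfI L'0): h => ->; rewrite mulfK.
Qed.

Lemma ratio_bound (n : nat) (y z y0 z0 D : R) : (2 < n)%N -> 0 <= D ->
  `|y - 1| <= 1 / 2 -> `|z - 1| <= 1 / 2 -> `|y0 - 1| <= 1 / 2 -> `|z0 - 1| <= 1 / 2 ->
  `|y - y0| <= D / n%:R ^+ 2 -> `|z - z0| <= D / n%:R ^+ 2 ->
  (z0 - y0) / (y0 + z0) = d / (n%:R - d) ->
  `|n%:R * ((z - y) / (y + z)) - d| <= (4 * D + 2) / n%:R.
Proof.
move=> n3 D0 l1 l2 l3 l4 hy hz E.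
have n3' : (3 : R) <= n%:R by rewrite ler_nat.
have n0 : (0 : R) < n%:R by apply: lt_le_trans n3'.
move: n3' n0 hy hz E; move: (n%:R) => N n3' n0 hy hz E.
have h : `|(z - y) / (y + z) - d / (N - d)| <= 4 * (D / N ^+ 2).
  rewrite -E; apply: ratio_diff => //.
  - by move: l1 l2; rewrite !ler_norml => /andP[? ?] /andP[? ?]; clear hy hz E; lra.
  - by move: l3 l4; rewrite !ler_norml => /andP[? ?] /andP[? ?]; clear hy hz E; lra.
  - move: l3 l4; rewrite !ler_norml => /andP[? ?] /andP[? ?]; clear hy hz E.
    by apply/andP; split; lra.
move: h; set A := (_ - _) / _ => h.
have nd : 0 < N - d by move: d2 => ?; lra.
(* Since N d / (N - d) - d = d^2 / (N - d), the pure process already contributes an error of order 1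
   / N; the other part is N times O(1 / N^2). *)
rewrite (_ : N * A - d = N * (A - d / (N - d)) + d ^+ 2 / (N - d)); last first.
  by field; rewrite gt_eqF.
apply: le_trans (ler_normD _ _) _; rewrite mulrDl; apply: lerD.
  rewrite normrM (gtr0_norm n0).
  apply: (@le_trans _ _ (N * (4 * (D / N ^+ 2)))); first by rewrite ler_wpM2l// ltW.
  by rewrite le_eqVlt; apply/orP; left; apply/eqP; field; rewrite gt_eqF.
rewrite ger0_norm; last by rewrite divr_ge0 ?sqr_ge0// ltW.
rewrite ler_pdivrMr// mulrAC ler_pdivlMr//.
have dd : d ^+ 2 <= 1 / 4.
  have -> : 1 / 4 = (1 / 2) ^+ 2 :> R by field.
  by rewrite ler_pXn2r ?nnegrE ?(ltW d0) ?(ltW d2)//; lra.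
apply: (@le_trans _ _ (1 / 4 * N)); first by rewrite ler_wpM2r// ltW.
by move: d2 => ?; lra.
Qed.

(** The margin K - hilb d absorbs the perturbation C1 / n^2 once n is large; one [K] then serves
    both kernels. *)
Lemma kernel_bound (K : R) (n : nat) : hilb d < K -> (0 < n)%N ->
  C1 / (K - hilb d) < n%:R ->
  `|phi n| <= K / (n%:R - d) /\ `|phase0 d n| <= K / (n%:R - d).
Proof.
move=> hK n0 hn; have [nd E] := phase0_nat n0.
split; last by rewrite E ler_wpM2r ?invr_ge0 ?(ltW nd) ?(ltW hK).
rewrite -[phi n](subrK (phase0 d n)); apply: le_trans (ler_normD _ _) _.
rewrite E; apply: le_trans (lerD (phi_phase0 n0) (lexx _)) _.
rewrite -lerBrDr -mulrBl.
have x0 : (0 : R) < n%:R by rewrite ltr0n.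
rewrite ler_pdivrMr ?exprn_gt0// mulrAC ler_pdivlMr//.
have h : C1 <= (K - hilb d) * n%:R.
  by rewrite mulrC -ler_pdivrMr ?subr_gt0// ltW.
apply: (@le_trans _ _ (C1 * n%:R)); first by rewrite ler_wpM2l// gerBl ltW.
by rewrite expr2 mulrA ler_pM2r.
Qed.

Lemma predictor_asymptotics : exists C N, forall n : nat, (N <= n)%N -> exists p : int -> R,
  [/\ finsupp n.-1 p, p 0 = 1,
      forall k : int, 0 < k -> k < n%:Z -> conv (conv (rev c) c) p k = 0 &
      `|n%:R * (conv (conv (rev c) c) p n%:Z / conv (conv (rev c) c) p 0) - d| <= C / n%:R].
Proof.
(* Room on both sides: e lies between d and 1/2, and K between [hilb d] and [hilb e], above the
   first to dominate the perturbed kernel and below the second to contract. *)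
have [e [de e2]] : exists e, d < e /\ e < 1 / 2.
  by exists ((d + 1 / 2) / 2); move: d2 => ?; lra.
have he : 0 < e < 1 / 2 by apply/andP; split => //; apply: lt_trans de.
have Hd0 := hilb_gt0 hd; have He0 := hilb_gt0 he.
have Hde : hilb d < hilb e.
  apply: le_lt_trans (hilb_ratio d0 de e2) _.
  rewrite -[ltRHS]mul1r ltr_pM2r// ltr_pdivrMr; move: d0 d2 de e2 => *; nra.
have [K [K1 K2]] : exists K, hilb d < K /\ K < hilb e.
  by exists ((hilb d + hilb e) / 2); lra.
have K0 : 0 <= K by apply: ltW; exact: lt_trans K1.
have q1 : 0 < 1 - K / hilb e by rewrite subr_gt0 ltr_pdivrMr// mul1r.
have [N1 hN1] : exists N : nat, C1 / (K - hilb d) < N%:R.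
  exists (Num.truncn (C1 / (K - hilb d))).+1; exact: truncnS_gt.
have [N2 hN2] : exists N : nat, 2 * ((K * 4 + C1 * 4) / (1 - K / hilb e)) < N%:R.
  by eexists; exact: truncnS_gt.
pose D := (C1 * 4 + (K * 4 + C1 * 4) * ((K * 4 + C1 * 4) / (1 - K / hilb e))) / (1 - K / hilb e).
have D0 : 0 <= D.
  by rewrite divr_ge0 ?(ltW q1)// !(addr_ge0, mulr_ge0)// invr_ge0 ltW.
exists (4 * D + 2), (maxn 3 (maxn N1 N2)) => n.
rewrite !geq_max => /and3P[n3 nN1 nN2].
have nij i j : (n <= n + i + j)%N by rewrite -addnA leq_addr.
have n0 : (0 < n)%N by exact: ltn_trans n3.
have hx i j : C1 / (K - hilb d) < (n + i + j)%:R.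
  by apply: lt_le_trans hN1 _; rewrite ler_nat (leq_trans nN1)// nij.
have kb i j := kernel_bound K1 (leq_trans n0 (nij i j)) (hx i j).
have hb i j := (kb i j).1; have hb0 i j := (kb i j).2.
have hE i j := phi_phase0 (leq_trans n0 (nij i j)).
have nl : 2 * ((K * 4 + C1 * 4) / (1 - K / hilb e)) <= n%:R.
  by apply: le_trans (ltW hN2) _; rewrite ler_nat.
have [yp [yp0 [hyp hyp0 l1 l2 dp]]] := solves_compare d0 de e2 n3 K0 K2 C10 hb hb0 hE nl.
have hbN i j : `|- phi (n + i + j)%N| <= K / ((n + i + j)%:R - d) by rewrite normrN.
have hb0N i j : `|- phase0 d (n + i + j)%N| <= K / ((n + i + j)%:R - d) by rewrite normrN.
have hEN i j : `|- phi (n + i + j)%N - - phase0 d (n + i + j)%N| <= C1 / (n + i + j)%:R ^+ 2.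
  by rewrite -opprD normrN.
have [ym [ym0 [hym hym0 l3 l4 dm]]] := solves_compare d0 de e2 n3 K0 K2 C10 hbN hb0N hEN nl.
have [p [hp p0 Hz E E0]] :=
  predictor_ratio de e2 n3 K0 K2 hb hb0 hyp hym hyp0 hym0 l1 l3 l2 l4.
exists p; split => //; rewrite E.
exact: ratio_bound n3 D0 l1 l3 l2 l4 dp dm E0.
Qed.

End asymptotics.

(** * Spectral factors of FARIMA processes *)

Section poly_inverse.
Local Open Scope complex_scope.
Context {R : realType}.
Local Notation C := R[i].

Lemma modulus_ge0 (z : C) : 0 <= modulus z.
Proof. by case: z => x y; exact: sqrtr_ge0. Qed.

Lemma modulusM (z w : C) : modulus (z * w) = modulus z * modulus w.
Proof. exact: ComplexField.Normc.normcM. Qed.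

Lemma modulusV (z : C) : modulus z^-1 = (modulus z)^-1.
Proof. exact: ComplexField.Normc.normcV. Qed.

Lemma modulus_sub (z w : C) : modulus (z - w) <= modulus z + modulus w.
Proof.
by apply: le_trans (@le_normcD R z (- w)) _; rewrite /modulus (@normcN R).
Qed.

Lemma Re_le_modulus (z : C) : `|complex.Re z| <= modulus z.
Proof.
case: z => x y /=; rewrite /modulus /=.
by rewrite -[leLHS]sqrtr_sqr ler_wsqrtr// lerDl sqr_ge0.
Qed.

(* The recursion for v expresses ('X - z) * v = u, and stays geometrically
   bounded because |z| > 1. *)
Lemma roots_inverse (s : seq C) : (forall z, z \in s -> 1 < modulus z) ->
  exists (u : nat -> C) (K r : R), [/\ 0 <= K, 0 < r < 1,
    forall n : nat, \sum_(0 <= i < n.+1) (\prod_(z <- s) ('X - z%:P))`_i * u (n - i)%N = (n == 0%N)%:R &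
    forall n, modulus (u n) <= K * r ^+ n].
Proof.
elim: s => [|z s ih] hs.
  exists (fun n => (n == 0%N)%:R), 1, (1 / 2); split=> //; first by apply/andP; split; lra.
    move=> n; rewrite big_nil big_nat_recl//= subn0 coefC/= mul1r big1 ?addr0// => i _.
    by rewrite coefC mul0r.
  case=> [|n]; rewrite mul1r.
    by rewrite /modulus ComplexField.Normc.normc1 expr0.
  by rewrite /modulus ComplexField.Normc.normc0 exprn_ge0.
have [|u [K [r [K0 /andP[r0 r1] hu uK]]]] := ih.
  by move=> w ws; apply: hs; rewrite inE ws orbT.
have z1 : 1 < modulus z by apply: hs; rewrite inE eqxx.
have mz0 : 0 < modulus z by apply: lt_trans z1.
have z0 : z != 0.
  by apply: contraTneq z1 => ->; rewrite /modulus ComplexField.Normc.normc0 -leNgt ler01.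
have [v [vE vE0]] : exists v : nat -> C, (forall n, v n.+1 = (v n - u n.+1) / z) /\ v 0%N = - u 0%N / z.
  by exists (fix v n := if n is m.+1 then (v m - u n) / z else - u 0%N / z).
have vS n : v n - z * v n.+1 = u n.+1.
  by rewrite vE mulrC divfK// opprB addrC subrK.
have v0 : - (z * v 0%N) = u 0%N by rewrite vE0 mulrC divfK// opprK.
set q := \prod_(z <- s) ('X - z%:P) in hu.
(* A rate strictly between max (r, 1 / |z|) and 1. The strict gap above 1 / |z| makes [del]
   positive, and dividing [K] by [del] makes the recursive bound close exactly. *)
pose r' := (Num.max r (modulus z)^-1 + 1) / 2.
have zi1 : (modulus z)^-1 < 1 by rewrite invf_lt1.
have rm : r <= Num.max r (modulus z)^-1 by rewrite le_max lexx.
have zm : (modulus z)^-1 <= Num.max r (modulus z)^-1 by rewrite le_max lexx orbT.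
have m1 : Num.max r (modulus z)^-1 < 1 by rewrite gt_max r1.
have r'1 : 0 < r' < 1 by rewrite /r'; apply/andP; split; lra.
have rr' : r <= r' by rewrite /r'; lra.
have zr' : (modulus z)^-1 < r' by rewrite /r'; lra.
have r'0 : 0 < r' by case/andP: r'1.
pose del := 1 - (modulus z)^-1 / r'.
have del0 : 0 < del by rewrite subr_gt0 ltr_pdivrMr// mul1r.
have del1 : del <= 1 by rewrite gerBl divr_ge0 ?invr_ge0 ?ltW.
exists v, (K / del), r'; split=> //; first by rewrite divr_ge0// ltW.
- move=> n; rewrite big_cons -/q mulrBl mulrC [z%:P * _]mul_polyC.
  case: n => [|n].
    rewrite big_nat1 coefB coefMX coefZ /=.
    by have := hu 0%N; rewrite big_nat1 /= -v0 => <-; ring.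
  rewrite -(hu n.+1) big_nat_recl//= coefB coefMX coefZ /= sub0r subn0.
  under eq_bigr do rewrite coefB coefMX coefZ /= subSS.
  have -> : \sum_(0 <= i < n.+2) q`_i * u (n.+1 - i)%N =
     \sum_(0 <= i < n.+1) q`_i * v (n - i)%N - \sum_(0 <= i < n.+2) z * q`_i * v (n.+1 - i)%N.
    rewrite [LHS]big_nat_recr//= [X in _ - X]big_nat_recr//= opprD addrA subnn.
    rewrite -sumrB -v0; congr (_ + _); last by ring.
    rewrite !big_nat; apply: eq_bigr => i /andP[_ il].
    by rewrite subSn// -vS; ring.
  rewrite [X in _ = _ - X]big_nat_recl//= subn0.
  under eq_bigr do rewrite mulrBl.
  rewrite sumrB; ring.
- have KK : K <= K / del by rewrite ler_pdivlMr// ler_piMr.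
  elim=> [|n ihn].
    rewrite expr0 mulr1 vE0 modulusM modulusV.
    have := uK 0%N; rewrite expr0 mulr1 /modulus (@normcN R) -/(modulus _) -/(modulus _) => h.
    rewrite ler_pdivrMr//; apply: le_trans h _; apply: le_trans KK _.
    by rewrite ler_peMr ?(ltW z1)// divr_ge0// ltW.
  rewrite vE modulusM modulusV ler_pdivrMr//.
  apply: le_trans (modulus_sub _ _) _.
  apply: le_trans (lerD ihn (uK n.+1)) _.
  apply: (@le_trans _ _ (K / del * r' ^+ n + K * r' ^+ n.+1)).
    by rewrite lerD2l ler_wpM2l// lerXn2r// nnegrE ltW.
  rewrite exprS.
  have P : 0 <= r' ^+ n by rewrite exprn_ge0 ?ltW.
  set P' := r' ^+ n in P *.
  have D : r' * modulus z * del = r' * modulus z - 1.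
    by rewrite /del; field; rewrite !gt_eqF.
  have E : K / del * (r' * P') * modulus z = (K / del + K * r' * modulus z) * P'.
    rewrite [in RHS](_ : K * r' * modulus z = K / del * (r' * modulus z * del)); last first.
      by field; rewrite gt_eqF.
    by rewrite D; ring.
  by rewrite E mulrDl lerD2l mulrA ler_wpM2r// ler_peMr ?(ltW z1)// mulr_ge0// ltW.
Qed.

End poly_inverse.

(** * Inverses of real polynomials as weighted summable sequences *)

Section poly_sequences.
Local Open Scope complex_scope.
Context {R : realType}.
Implicit Types (p : {poly R}) (x y : int -> R).

Definition pseq p (k : int) : R := if k is Posz n then p`_n else 0.

Lemma pseq_causal p : causal (pseq p). Proof. by case. Qed.

Lemma pseq_finsupp p : finsupp (size p) (pseq p).
Proof.
case=> [n|n] // h; apply: nth_default; rewrite leqNgt; apply: contra h => h.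
by apply/andP; split=> //; rewrite lez_nat (ltnW h).
Qed.

(** Two powers of the weight: in [gen_phase_sub] one is spent on translating the phase by j, the
    other on the factor j that appears when 1 / (k - d) is differenced. *)
Definition wsumm x := summ (fun k => wt k ^+ 2 * x k).

Lemma wt2_ge1 k : (1 : R) <= wt k ^+ 2. Proof. by rewrite exprn_ege1// wt_ge1. Qed.

Lemma norm_wt2 k (y : R) : `|wt k ^+ 2 * y| = wt k ^+ 2 * `|y|.
Proof. by rewrite normrM [X in X * _]ger0_norm ?exprn_ge0 ?wt_ge0. Qed.

Lemma wsumm_summ x : wsumm x -> summ x.
Proof.
move=> h; apply: (summ_le _ h) => k.
by rewrite normrM ler_peMl// (le_trans (wt2_ge1 k))// ler_norm.
Qed.

Lemma wsumm_wt x : wsumm x -> summ (fun k => wt k * x k).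
Proof.
move=> h; apply: (summ_le _ h) => k; rewrite !normrM ler_wpM2r//.
by rewrite !ger0_norm ?wt_ge0// ler_peMl ?wt_ge0 ?wt_ge1.
Qed.

Lemma wsumm_rev x : wsumm x -> wsumm (rev x).
Proof.
move=> h; have := summ_rev h; congr summ; apply/funext => k.
by rewrite /rev wtN.
Qed.

Lemma wsumm_conv x y : wsumm x -> wsumm y -> wsumm (conv x y).
Proof.
move=> hx hy; have hxy := summ_conv (summ_norm hx) (summ_norm hy).
apply: (summ_le _ hxy) => k.
have sx := wsumm_summ hx; have sy := wsumm_summ hy.
have s := summ_conv_term k (summ_l2 sx) (summ_l2 sy).
have s' := summ_conv_term k (summ_l2 (summ_norm hx)) (summ_l2 (summ_norm hy)).
rewrite norm_wt2.
apply: le_trans (ler_wpM2l _ (tsum_norm s)) _; first by rewrite exprn_ge0 ?wt_ge0.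
rewrite -tsumZ; last exact: summ_norm.
apply: le_trans (ler_norm _); apply: le_tsum => //.
  exact/summZ/summ_norm.
move=> i; rewrite !norm_wt2 normrM [leRHS]mulrACA ler_wpM2r ?mulr_ge0// -exprMn lerXn2r ?nnegrE ?mulr_ge0 ?wt_ge0//.
by rewrite {1}(_ : k = i + (k - i)) ?wtM//; ring.
Qed.

Lemma wsumm_finsupp n x : finsupp n x -> wsumm x.
Proof.
by move=> h; have := summ_finsupp (fun k => wt k ^+ 2) h; under eq_fun do rewrite mulrC.
Qed.

Lemma summ_sq_geometric (r : R) : 0 < r < 1 -> summ (fun n : nat => n.+1%:R ^+ 2 * r ^+ n).
Proof.
move=> /andP[r0 r1].
pose s := Num.sqrt r; pose t := Num.sqrt s.
have s0 : 0 < s by rewrite sqrtr_gt0.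
have t0 : 0 < t by rewrite sqrtr_gt0.
have ss : s ^+ 2 = r by rewrite sqr_sqrtr// ltW.
have tt : t ^+ 2 = s by rewrite sqr_sqrtr// ltW.
have s1 : s < 1 by rewrite -(ltr_pXn2r (n := 2))// ?nnegrE ?ltW// ss expr1n.
have t1 : t < 1 by rewrite -(ltr_pXn2r (n := 2))// ?nnegrE ?ltW// tt expr1n.
(* (n+1) t^n <= sum of t^i <= 1 / (1 - t), and r^n = t^n t^n s^n *)
have b (n : nat) : n.+1%:R * t ^+ n <= (1 - t)^-1.
  apply: le_trans (sum_geometric_le n.+1 _); last by rewrite ltW.
  rewrite mulr_natl -[X in _ *+ X]subn0 -sumr_const_nat big_nat [leRHS]big_nat.
  apply: ler_sum => i /andP[_ iln]; rewrite ler_wiXn2l// ltW//.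
apply: (summ_le (g := fun n => s ^+ n * (1 - t)^-1 ^+ 2)); last first.
  by apply: summZr; apply: summ_geometric; rewrite (ltW s0).
move=> n; rewrite !ger0_norm ?mulr_ge0 ?exprn_ge0 ?invr_ge0 ?subr_ge0 ?(ltW t1) ?(ltW s0) ?(ltW r0)//.
have -> : n.+1%:R ^+ 2 * r ^+ n = s ^+ n * (n.+1%:R * t ^+ n) ^+ 2.
  by rewrite -ss -exprM mul2n -addnn exprD exprMn -(exprM t) mulnC exprM tt; ring.
rewrite ler_wpM2l ?exprn_ge0 ?(ltW s0)// lerXn2r ?nnegrE ?b ?mulr_ge0 ?exprn_ge0 ?invr_ge0 ?subr_ge0 ?ltW//.
Qed.

Lemma Re_scale (x : R) (z : R[i]) : complex.Re (x%:C * z) = x * complex.Re z.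
Proof. by case: z => a b /=; rewrite mul0r subr0. Qed.

(** All complex roots lie outside the closed disk, so [roots_inverse] applies. Real parts of the
    complex inverse still form an inverse because the coefficients of [p] are real. *)
Lemma poly_inverse p : no_zero_in_closed_disk p -> exists u : int -> R,
  [/\ causal u, wsumm u & conv (pseq p) u = delta].
Proof.
move=> hp; set P := map_poly (real_complex R) p.
have p0 : P != 0.
  apply/eqP => P0; have := hp 0; rewrite /modulus ComplexField.Normc.normc0 ler01 => /(_ isT).
  by rewrite /ceval -/P P0 horner0 eqxx.
have [rs Prs] := closed_field_poly_normal P.
have l0 : lead_coef P != 0 by rewrite lead_coef_eq0.
have hrs z : z \in rs -> 1 < modulus z.
  move=> zrs; rewrite ltNge; apply/negP => /hp; rewrite /ceval -/P Prs hornerZ.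
  by rewrite horner_prod (big_rem z)//= hornerXsubC subrr mul0r mulr0 eqxx.
have [u [K [r [K0 hr hu uK]]]] := roots_inverse hrs.
have [r0 r1] : 0 < r /\ r < 1 by case/andP: hr.
pose v n := complex.Re (u n / lead_coef P).
pose w (k : int) := if k is Posz n then v n else 0.
exists w; split.
- by case.
- apply/(@summ_causal R (fun k => wt k ^+ 2 * w k)) => [[]//n _|]; first by rewrite mulr0.
  apply: (summ_le (g := fun n : nat => (K / modulus (lead_coef P)) * (n.+1%:R ^+ 2 * r ^+ n))); last first.
    exact/summZ/summ_sq_geometric.
  move=> n; rewrite [leRHS]ger0_norm; last first.
    by rewrite !mulr_ge0 ?invr_ge0 ?modulus_ge0 ?exprn_ge0 ?(ltW r0).
  rewrite normrM ger0_norm ?exprn_ge0 ?wt_ge0// wtN_nat mulrCA ler_wpM2l ?exprn_ge0//.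
  apply: le_trans (Re_le_modulus _) _; rewrite modulusM modulusV mulrAC.
  by rewrite ler_wpM2r ?invr_ge0 ?modulus_ge0.
- apply/funext => -[n|n]; last by rewrite conv_causal// => -[].
  rewrite conv_causalE; [|exact: pseq_causal|by case].
  have -> : delta n = complex.Re (\sum_(0 <= i < n.+1) P`_i * (u (n - i)%N / lead_coef P)) :> R.
    have -> : \sum_(0 <= i < n.+1) P`_i * (u (n - i)%N / lead_coef P) =
        \sum_(0 <= i < n.+1) (\prod_(z <- rs) ('X - z%:P))`_i * u (n - i)%N.
      by apply: eq_bigr => i _; rewrite {1}Prs coefZ; field.
    by rewrite hu /delta; case: n.
  rewrite (@big_morph _ _ (@complex.Re R) 0 +%R 0 +%R)//; last by move=> [x y] [x' y'].
  by apply: eq_bigr => i _; rewrite coef_map /= Re_scale.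
Qed.

End poly_sequences.

(** * Causal factor and phase of the FARIMA density *)

Section farima_coefficients.
Context {R : realType}.
Implicit Types x y z w : int -> R.

Lemma convA_l1 x y z : summ x -> summ y -> summ z ->
  conv (conv x y) z = conv x (conv y z).
Proof. by move=> hx hy hz; rewrite convA_left//; exact: summ_l2. Qed.

Lemma convACA x y z w : summ x -> summ y -> summ z -> summ w ->
  conv (conv x y) (conv z w) = conv (conv x z) (conv y w).
Proof.
move=> hx hy hz hw; rewrite !convA_l1//; try exact: summ_conv.
by congr conv; rewrite -!convA_l1// (convC y z).
Qed.

Lemma tsum_conv x y : summ x -> summ y -> tsum (conv x y) = tsum x * tsum y.
Proof.
move=> hx hy; have h := summ_prod hx hy.
have h' : summ (fun p : int * int => x p.2 * y (p.1 - p.2)).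
  exact: (summ_bij _ (@shear_bij)).1 h.
rewrite /conv (tsum_exchange h').
have E i : tsum (fun k => x i * y (k - i)) = x i * tsum y.
  rewrite -tsumZ// [RHS](tsum_bij _ (shift_bij (- i))) //.
under eq_tsum do rewrite E.
under eq_tsum do rewrite mulrC.
by rewrite tsumZ// mulrC.
Qed.

Variables (d : R) (t t' : int -> R).
Hypothesis hd : 0 < d < 1 / 2.
Hypotheses (ct : causal t) (ct' : causal t') (wt_t : wsumm t) (wt_t' : wsumm t').
Hypothesis tt' : conv t t' = delta.
Let d0 : 0 < d. Proof. by case/andP: hd. Qed.
Let d2 : d < 1 / 2. Proof. by case/andP: hd. Qed.
Let hd1 : 0 < d < 1. Proof. by move: d0 d2 => *; apply/andP; split; lra. Qed.
Let st : summ t := wsumm_summ wt_t.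
Let st' : summ t' := wsumm_summ wt_t'.
Let srt : summ (rev t) := summ_rev st.
Let lc0 : l2 (binc d) := binc_l2 hd.
Let lrc0 : l2 (rev (binc d)) := l2_rev lc0.
Let sa0 : summ (binc (- d)) := summ_bincN hd1.
Let la0 : l2 (binc (- d)) := bincN_l2 hd.

(** With [t] in the role of Theta / Phi and [t'] of its reciprocal, [gen_c] is the causal factor (1
    - z)^-d t and [gen_a] its inverse. *)
Definition gen_c := conv (binc d) t.
Definition gen_a := conv (binc (- d)) t'.

Lemma gen_c_causal : causal gen_c.
Proof. by apply: conv_causal => //; exact: binc_causal. Qed.

Lemma gen_a_causal : causal gen_a.
Proof. by apply: conv_causal => //; exact: binc_causal. Qed.

Lemma gen_a_summ : summ gen_a. Proof. exact: summ_conv. Qed.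

Lemma gen_c_dec : dec (1 - d) gen_c.
Proof.
apply: dec_conv; [|exact: binc_dec|exact: wsumm_wt].
by move: d0 d2 => *; apply/andP; split; lra.
Qed.

Let lc : l2 gen_c.
Proof. by apply: (dec_l2 _ gen_c_dec); move: d2 => *; lra. Qed.

Lemma gen_ac : conv gen_a gen_c = delta.
Proof.
rewrite /gen_a convA_left//; last exact: summ_l2.
rewrite /gen_c (convC t') convA_right//; last exact: summ_l2.
by rewrite tt' (convC (binc d)) conv_delta conv_binc.
Qed.

Definition tau := conv (rev t) t'.

Lemma wsumm_tau : wsumm tau.
Proof. by apply: wsumm_conv => //; exact: wsumm_rev. Qed.

Let stau : summ tau := wsumm_summ wsumm_tau.

Lemma gen_phase : conv (rev gen_c) gen_a = conv (phase0 d) tau.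
Proof.
rewrite /gen_c rev_conv convA_right//; [|exact: summ_l2|exact: gen_a_summ].
have -> : conv (rev t) gen_a = conv (binc (- d)) tau.
  rewrite /gen_a -convA_l1// (convC (rev t)) convA_l1//.
by rewrite -convA_right.
Qed.

Lemma gen_phase_dec : dec 1 (conv (rev gen_c) gen_a).
Proof.
rewrite gen_phase; apply: dec_conv; [|exact: dec_phase0|exact/wsumm_wt/wsumm_tau].
by rewrite ler01 lexx.
Qed.

(** The value at z = 1 of the phase of [t], which is real there, so that conjugation has no
    effect. *)
Lemma tsum_tau : tsum tau = 1.
Proof.
rewrite /tau tsum_conv//.
have -> : tsum (rev t) = tsum t by rewrite [RHS](tsum_bij _ opp_bij).
rewrite -tsum_conv// tt' (@tsum1 _ _ _ 0) /delta ?eqxx// => i /negPf ->.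
by [].
Qed.

(** As [tau] sums to 1, the difference is the sum of tau j times phase0 (k - j) - phase0 k, and 1 /
    (k - j - d) - 1 / (k - d) = j / ((k - j - d) (k - d)). The weights on [tau] allow both
    denominators to be replaced by k. *)
Lemma gen_phase_sub : exists2 C, 0 <= C & forall k : nat, (0 < k)%N ->
  `|conv (rev gen_c) gen_a k - phase0 d k| <= C / k%:R ^+ 2.
Proof.
have s0 : 0 < hilb d := hilb_gt0 hd.
pose M := 2 / d + 2 / (1 - d).
have M0 : 0 <= M by move: d0 d2 => *; rewrite addr_ge0// divr_ge0//; lra.
have wtau := summ_norm wsumm_tau.
exists (hilb d * M ^+ 2 * tsum (fun j => `|wt j ^+ 2 * tau j|)).
  apply: mulr_ge0; last exact: tsum_ge0.
  by rewrite mulr_ge0 ?sqr_ge0 ?(ltW s0).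
move=> k k0; rewrite gen_phase convC.
have s1 : summ (fun i => tau i * phase0 d (k%:Z - i)).
  by apply: summ_conv_term; [exact: summ_l2|apply: dec_l2 (dec_phase0 hd); lra].
have -> : conv tau (phase0 d) k - phase0 d k =
    tsum (fun i => tau i * phase0 d (k%:Z - i) - phase0 d k * tau i).
  by rewrite tsumB ?tsumZ ?tsum_tau ?mulr1//; exact: summZ.
have kk : (0 : R) < k%:R by rewrite ltr0n.
have s2 := summB s1 (summZ (phase0 d k) stau).
apply: le_trans (tsum_norm s2) _.
rewrite mulrAC -tsumZ//; apply: le_tsum; [exact: summ_norm|exact: summZ|].
move=> j; rewrite norm_wt2 (mulrC (phase0 d k)) -mulrBr normrM.
rewrite [leRHS](_ : _ = `|tau j| * (hilb d * M ^+ 2 / k%:R ^+ 2 * wt j ^+ 2)); last by ring.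
rewrite ler_wpM2l//.
have n1 := intr_neq (k%:Z - j) hd1; have n2 := intr_neq k%:Z hd1.
rewrite !phase0E//.
move: (hilb d) s0 => H s0.
set A := (k%:Z - j)%:~R - d in n1 *; set B := k%:~R - d in n2 *.
have -> : - H / A - - H / B = - (H * (j%:~R / (A * B))).
  have -> : j%:~R = B - A :> R by rewrite /A /B intrD mulrNz; ring.
  by field; rewrite n1 n2.
rewrite normrN normrM (gtr0_norm s0) -!mulrA ler_wpM2l ?(ltW s0)//.
have a0 : 0 < `|A| by rewrite normr_gt0.
have b0 : 0 < `|B| by rewrite normr_gt0.
have hA : wt (k%:Z - j) <= M * `|A| by exact: wt_le_sub.
have hB : wt k <= M * `|B| by exact: wt_le_sub.
have hj : `|j%:~R| <= wt j :> R by rewrite /wt -intr_norm lerDr.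
have kw : k%:R <= wt k%:Z :> R by rewrite wtN_nat ler_nat.
have hk : wt k <= wt j * wt (k%:Z - j) :> R.
  by rewrite {1}(_ : k%:Z = j + (k%:Z - j)) ?wtM//; ring.
rewrite normrM normfV normrM ler_pdivrMr ?mulr_gt0//.
rewrite (_ : _ * (`|A| * `|B|) = ((M * `|A|) * wt j) * (M * `|B|) * wt j / k%:R ^+ 2); last ring.
rewrite ler_pdivlMr ?exprn_gt0//.
have w0 := wt_ge0 (R := R) j.
have h1 : k%:R <= (M * `|A|) * wt j.
  apply: le_trans kw _; apply: le_trans hk _; rewrite mulrC ler_wpM2r//.
have h2 : k%:R <= M * `|B| by apply: le_trans kw hB.
rewrite expr2 mulrC ler_pM ?mulr_ge0 ?ler_pM ?(ltW kk)//.
Qed.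

Lemma gen_acov : conv (rev gen_c) gen_c = conv (conv t (rev t)) (acov0 d).
Proof.
rewrite {1}/gen_c rev_conv convA_mid//.
have -> : conv (rev t) gen_c = conv (binc d) (conv t (rev t)).
  rewrite /gen_c -convA_left//; last exact: summ_l2.
  by rewrite (convC (rev t)) convA_right// ?(convC (rev t))//; exact: summ_l2.
by rewrite -convA_right// 1?convC//; exact: summ_conv.
Qed.

End farima_coefficients.

Section spectral_factor.
Context {R : realType}.
Variables (d : R) (P Q iP : int -> R) (g : int -> R) (K M : R).
Hypothesis hd : 0 < d < 1 / 2.
Hypotheses (sP : summ P) (wQ : wsumm Q) (wiP : wsumm iP).
Hypothesis PiP : conv P iP = delta.
Hypothesis gM : forall k, `|g k| <= M.
Hypothesis hg : forall k, conv (conv P (rev P)) g k = K * conv (conv Q (rev Q)) (acov0 d) k.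

(** Convolution with [II], the coefficients of 1 / |P|^2, inverts the hypothesis. As [g] is merely
    bounded, it is reassociated only with two summable kernels. *)
Lemma spectral_factor k :
  g k = K * conv (rev (gen_c d (conv Q iP))) (gen_c d (conv Q iP)) k.
Proof.
have sQ := wsumm_summ wQ; have siP := wsumm_summ wiP.
have srP := summ_rev sP; have srQ := summ_rev sQ; have sriP := summ_rev siP.
have wt : wsumm (conv Q iP) by exact: wsumm_conv.
have lc := binc_l2 hd; have lrc := l2_rev lc.
have [L hL] := conv_bounded lrc lc.
pose II := conv iP (rev iP).
have sII : summ II by exact: summ_conv.
rewrite (gen_acov hd wt) rev_conv.
have -> : conv (conv Q iP) (conv (rev Q) (rev iP)) = conv II (conv Q (rev Q)).
  by rewrite convACA// convC.
rewrite (convA_l1_bounded (M := L))//; last exact: summ_conv.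
have -> : g = conv II (conv (conv P (rev P)) g).
  rewrite -(convA_l1_bounded (M := M))//; last exact: summ_conv.
  rewrite convACA// (convC iP) PiP -rev_conv (convC iP) PiP.
  rewrite (_ : rev delta = delta) ?conv_delta//.
  by apply/funext => i; rewrite /rev /delta oppr_eq0.
rewrite (_ : conv (conv P (rev P)) g = fun k => K * conv (conv Q (rev Q)) (acov0 d) k); last exact/funext.
rewrite convZr//; apply: (@summ_mul_bounded _ _ _ _ (tsum (fun i => `|conv Q (rev Q) i|) * L)) => // i.
have sQQ : summ (conv Q (rev Q)) by exact: summ_conv.
have s : summ (fun j => conv Q (rev Q) j * acov0 d (k - i - j)).
  by apply: (summ_mul_bounded (M := L)) => // j; exact: hL.
apply: le_trans (tsum_norm s) _; rewrite mulrC -tsumZ; last exact: summ_norm.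
apply: le_tsum; [exact: summ_norm|exact/summZ/summ_norm|].
by move=> j; rewrite normrM mulrC ler_wpM2r//; exact: hL.
Qed.

End spectral_factor.

(** * Moments of the spectral density *)

Section fisher_hartwig.
Context {R : realType}.
Implicit Types (t e d : R).

(* |1 - e^(it)|^2 *)
Definition uu t : R := 2 - 2 * cos t.

Lemma uu_ge0 t : 0 <= uu t.
Proof. by rewrite subr_ge0 -[leRHS]mulr1 ler_pM2l// cos_le1. Qed.

Lemma is_derive_sinZ (c t : R) : is_derive t 1 (fun t => sin (c * t)) (c * cos (c * t)).
Proof.
have h : is_derive t 1 (fun t => c * t) c.
  by have := is_deriveZ c (is_derive_id t (1 : R)); rewrite scaler1.
by rewrite mulrC; exact: (is_derive1_comp (is_derive_sin (c * t)) h).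
Qed.

Lemma is_derive_cosZ (c t : R) : is_derive t 1 (fun t => cos (c * t)) (- c * sin (c * t)).
Proof.
have h : is_derive t 1 (fun t => c * t) c.
  by have := is_deriveZ c (is_derive_id t (1 : R)); rewrite scaler1.
by rewrite mulNr mulrC -mulNr; exact: (is_derive1_comp (is_derive_cos (c * t)) h).
Qed.

Lemma is_derive_uu e t : is_derive t 1 (fun t => uu t + e) (2 * sin t).
Proof.
have h1 := is_deriveB (is_derive_cst (2 : R) t 1) (is_deriveZ 2 (is_derive_cos t)).
have h2 := is_deriveD h1 (is_derive_cst e t 1).
apply: is_derive_eq h2 _; rewrite addr0 sub0r.
by rewrite scalerN opprK.
Qed.

Lemma is_derive_powuu (a e t : R) : 0 < e ->
  is_derive t 1 (fun t => (uu t + e) `^ a) (a * (uu t + e) `^ (a - 1) * (2 * sin t)).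
Proof.
move=> e0; have p : 0 < uu t + e by rewrite ltr_wpDl// uu_ge0.
exact: (@is_derive1_comp _ _ (fun t => uu t + e) t _ _ (is_derive1_powR a p) (is_derive_uu e t)).
Qed.

Definition ss (n : nat) t : R := sin (n.+1%:R * t) - sin (n%:R * t).

Lemma is_derive_ss n t :
  is_derive t 1 (ss n) (n.+1%:R * cos (n.+1%:R * t) - n%:R * cos (n%:R * t)).
Proof. exact: (is_deriveB (is_derive_sinZ _ _) (is_derive_sinZ _ _)). Qed.

(* The shift by [e] regularizes the singularity of [uu t `^ (- d)] at 0; [hh] is
   the derivative of a function vanishing at both ends of [-pi, pi], and its
   vanishing integral gives the recursion for the moments as [e] tends to 0. *)
Definition hh d n e t : R :=
  (n.+1%:R * cos (n.+1%:R * t) - n%:R * cos (n%:R * t)) * (uu t + e) `^ (- d) +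
  ss n t * (- d * (uu t + e) `^ (- d - 1) * (2 * sin t)).

Lemma is_derive_reg d n e t : 0 < e ->
  is_derive t 1 (fun t => ss n t * (uu t + e) `^ (- d)) (hh d n e t).
Proof.
move=> e0; have := is_deriveM (is_derive_ss n t) (is_derive_powuu (- d) t e0).
move=> h; apply: is_derive_eq h _; rewrite /hh /GRing.scale /=; ring.
Qed.

Lemma is_derive_continuous (f : R -> R) (df : R -> R) : (forall t, is_derive t 1 f (df t)) ->
  continuous f.
Proof.
by move=> h t; have [d1 _] := h t; exact/differentiable_continuous/derivable1_diffP.
Qed.

Lemma hh_continuous d n e : 0 < e -> continuous (hh d n e).
Proof.
move=> e0.
have c1 c : continuous (fun t : R => cos (c * t)).
  exact: is_derive_continuous (is_derive_cosZ c).
have c2 a : continuous (fun t : R => (uu t + e) `^ a).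
  by apply: is_derive_continuous => t; exact: is_derive_powuu.
have c3 : continuous (ss n) by exact: is_derive_continuous (is_derive_ss n).
move=> t; apply: cvgD; apply: cvgM.
- by apply: cvgB; apply: cvgM; [exact: cvg_cst|exact: c1|exact: cvg_cst|exact: c1].
- exact: c2.
- exact: c3.
- apply: cvgM; first by apply: cvgM; [exact: cvg_cst|exact: c2].
  by apply: cvgM; [exact: cvg_cst|exact: continuous_sin].
Qed.

(** [ss] is chosen for this: times the derivative 2 sin t of [uu] it contains the factor [uu], which
    compensates the extra negative power produced by differentiation. *)
Lemma ss_sin n t : ss n t * (2 * sin t) = (cos (n.+1%:R * t) + cos (n%:R * t)) * uu t.
Proof.
rewrite /ss /uu.
have -> : n.+1%:R * t = n%:R * t + t by rewrite -natr1 mulrDl mul1r.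
rewrite sinD cosD.
have := cos2Dsin2 t; move: (cos t) (sin t) (cos (n%:R * t)) (sin (n%:R * t)) => C S c s h.
transitivity (2 * s * S * (C - 1) + 2 * c * S ^+ 2); first by ring.
by rewrite (_ : S ^+ 2 = 1 - C ^+ 2); [ring|rewrite -h; ring].
Qed.

Lemma hhE d n e t : 0 < e -> hh d n e t =
  (n.+1%:R * cos (n.+1%:R * t) - n%:R * cos (n%:R * t)
   - d * (cos (n.+1%:R * t) + cos (n%:R * t)) * (uu t / (uu t + e))) * (uu t + e) `^ (- d).
Proof.
move=> e0; have p : 0 < uu t + e by rewrite ltr_wpDl// uu_ge0.
rewrite /hh.
have -> : (uu t + e) `^ (- d - 1) = (uu t + e) `^ (- d) / (uu t + e).
  rewrite powRD ?powR_inv1 ?(ltW p)//; apply/implyP => _; exact: lt0r_neq0.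
transitivity ((n.+1%:R * cos (n.+1%:R * t) - n%:R * cos (n%:R * t)) * (uu t + e) `^ (- d)
  + - d * ((uu t + e) `^ (- d) / (uu t + e)) * (ss n t * (2 * sin t))); first by ring.
rewrite ss_sin; ring.
Qed.

Lemma sin_natpi (n : nat) : sin (n%:R * pi) = 0 :> R.
Proof.
elim: n => [|n ih]; first by rewrite mul0r sin0.
by rewrite -natr1 mulrDl mul1r sinDpi ih oppr0.
Qed.

Lemma int_hh d n e : 0 < e ->
  (\int[lebesgue_measure]_(t in `[(- pi)%R, pi]) (hh d n e t)%:E = 0)%E.
Proof.
move=> e0; have c := @hh_continuous d n e e0.
have cF : continuous (fun t => ss n t * (uu t + e) `^ (- d)).
  by apply: is_derive_continuous => t; exact: is_derive_reg.
rewrite (@continuous_FTC2 _ _ (fun t => ss n t * (uu t + e) `^ (- d))).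
- have z : ss n (- pi) = 0 by rewrite /ss !mulrN !sinN !sin_natpi oppr0 subrr.
  by rewrite z /ss !sin_natpi subrr !mul0r -EFinB subrr.
- by have := pi_gt0 R; lra.
- exact: continuous_subspaceT.
- split.
  + by move=> t _; have [] := @is_derive_reg d n e t e0.
  + exact/cvg_at_right_filter/cF.
  + exact/cvg_at_left_filter/cF.
- move=> t _; rewrite derive1E; have h := @is_derive_reg d n e t e0.
  by rewrite derive_val.
Qed.

Lemma uu_gt0 t : t \in `[- pi, pi] -> t != 0 -> 0 < uu t.
Proof.
rewrite in_itv /= => /andP[t1 t2] t0; rewrite lt_neqAle uu_ge0 andbT eq_sym.
apply: contra t0 => /eqP; rewrite /uu => u0.
have c1 : cos t = 1 by lra.
have H (s : R) : 0 <= s <= pi -> cos s = 1 -> s = 0.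
  move=> /andP[s0 s1] cs; apply: cos_inj; rewrite ?in_itv/= ?s0 ?lexx ?pi_ge0//.
  by rewrite cs cos0.
apply/eqP; have [t3|t3] := leP 0 t; first by apply: H => //; rewrite t3.
have := H (- t); rewrite cosN oppr_ge0 (ltW t3) lerNl t1 => /(_ isT c1); lra.
Qed.

Lemma modulus_1expi t : modulus (1 - expi t) = uu t `^ (1 / 2).
Proof.
rewrite mul1r powR12_sqrt ?uu_ge0// /modulus /=; congr Num.sqrt; rewrite /uu.
have := cos2Dsin2 t; nra.
Qed.

End fisher_hartwig.

Section fisher_hartwig_moments.
Context {R : realType}.
Local Notation mu := (@lebesgue_measure R).
Local Notation circ := (@circle R).

Definition fhw (d t : R) : R := modulus (1 - expi t) `^ (- 2 * d).

Lemma fhwE d t : fhw d t = uu t `^ (- d).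
Proof. by rewrite /fhw modulus_1expi -powRrM; congr (uu t `^ _); field. Qed.

Definition fhm d (n : nat) : R := \int[mu]_(t in circ) (cos (n%:R * t) * fhw d t).

Lemma measurable_circle : measurable (circle : set (measurableTypeR R)).
Proof. exact: measurable_itv. Qed.

Lemma integrable_cosM (F : R -> R) (c a : R) : mu.-integrable circ (EFin \o F) ->
  mu.-integrable circ (EFin \o (fun t => a * cos (c * t) * F t)).
Proof.
move=> iF.
have cc : continuous (fun t : R => a * cos (c * t)).
  move=> t; apply: cvgM; first exact: cvg_cst.
  by have := is_derive_continuous (is_derive_cosZ c); apply.
have := @integrableMr _ _ R mu circ measurable_circle (fun t => a * cos (c * t)) (EFin \o F).
apply => //.
- by apply: measurable_funTS; exact: continuous_measurable_fun.
- exists `|a|; split; first exact: num_real.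
  move=> x ax t _ /=; apply: le_trans (ltW ax).
  by rewrite normrM -[leRHS]mulr1 ler_wpM2l// ler_norml cos_geN1 cos_le1.
Qed.

(** The regularized integrals all vanish. By [hhE] their integrands are dominated by a multiple of
    the weight, since uu / (uu + e) <= 1, and they converge off t = 0, so dominated convergence
    rests on the assumed integrability of the weight. *)
Lemma fh_recursion d (n : nat) : 0 < d < 1 -> mu.-integrable circ (EFin \o fhw d) ->
  (n.+1%:R - d) * fhm d n.+1 = (n%:R + d) * fhm d n.
Proof.
move=> /andP[d0 d1] iw.
pose c1 t : R := cos (n.+1%:R * t); pose c0 t : R := cos (n%:R * t).
pose h t := (n.+1%:R - d) * c1 t * fhw d t - (n%:R + d) * c0 t * fhw d t.
pose M : R := n.+1%:R + n%:R + d * 2.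
have ih : mu.-integrable circ (EFin \o h).
  have -> : EFin \o h = ((EFin \o (fun t => (n.+1%:R - d) * c1 t * fhw d t)%R) \-
      (EFin \o (fun t => (n%:R + d) * c0 t * fhw d t)%R))%E by [].
  by apply: integrableB => //; [exact: measurable_circle|exact: integrable_cosM..].
have ig : mu.-integrable circ (fun t => (M * fhw d t)%:E).
  by have := integrableZl measurable_circle M iw; apply.
have e0 (m : nat) : (0 : R) < m.+1%:R^-1 by rewrite invr_gt0.
pose f_ (m : nat) t := (hh d n m.+1%:R^-1 t)%:E.
have trig (c : R) : `|cos c| <= 1 by rewrite ler_norml cos_geN1 cos_le1.
have [_ _] : [/\ mu.-integrable circ (EFin \o h),
  (fun m : nat => \int[mu]_(x in circ) `|f_ m x - (EFin \o h) x|)%E @ \oo --> 0%E &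
  (fun m : nat => \int[mu]_(x in circ) (f_ m x))%E @ \oo --> (\int[mu]_(x in circ) (EFin \o h) x)%E].
  apply: (@dominated_convergence _ _ _ mu circ measurable_circle f_ (EFin \o h) (fun t => (M * fhw d t)%:E)).
  - move=> m; apply/measurable_EFinP; apply: measurable_funTS.
    by apply: continuous_measurable_fun; exact: hh_continuous.
  - exact: measurable_int ih.
  - exists [set 0]; split; [exact: measurable_set1|exact: lebesgue_measure_set1|].
    move=> t /=; apply: contra_notP => /eqP t0 ct.
    have ut : 0 < uu t.
      apply: uu_gt0 => //; move: ct; rewrite /circle /= !in_itv /= => /andP[t1 ->].
      by rewrite (ltW t1).
    have einv : (fun m : nat => (m.+1%:R : R)^-1) @ \oo --> 0 by exact: cvg_harmonic.
    have eu : (fun m : nat => uu t + (m.+1%:R : R)^-1) @ \oo --> uu t.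
      by rewrite -[X in _ --> X]addr0; apply: cvgD => //; exact: cvg_cst.
    have ep : (fun m : nat => (uu t + (m.+1%:R : R)^-1) `^ (- d)) @ \oo --> uu t `^ (- d).
      have cp : {for uu t, continuous (fun x : R => x `^ (- d))}.
        have [dp _] := is_derive1_powR (- d) ut.
        exact/differentiable_continuous/derivable1_diffP.
      exact: continuous_cvg cp eu.
    have eq1 : (fun m : nat => uu t / (uu t + (m.+1%:R : R)^-1)) @ \oo --> (1 : R).
      rewrite [X in _ --> X](_ : 1 = uu t / uu t); last by rewrite divff// gt_eqF.
      apply: cvgMr.
      by apply: cvgV => //; rewrite gt_eqF.
    apply: cvg_EFin; first by apply: nearW.
    rewrite [X in X @ _](_ : _ = (fun m : nat =>
      (n.+1%:R * c1 t - n%:R * c0 t - d * (c1 t + c0 t) * (uu t / (uu t + m.+1%:R^-1))) *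
       (uu t + m.+1%:R^-1) `^ (- d))); last by apply/funext => m; rewrite /f_ /= hhE.
    have -> : h t = (n.+1%:R * c1 t - n%:R * c0 t - d * (c1 t + c0 t) * 1) * uu t `^ (- d).
      rewrite /h fhwE; ring.
    apply: cvgM => //; apply: cvgB; first exact: cvg_cst.
    by apply: cvgMr.
  - exact: ig.
  - exists [set 0]; split; [exact: measurable_set1|exact: lebesgue_measure_set1|].
    move=> t /=; apply: contra_notP => /eqP t0 m ct.
    have ut : 0 < uu t.
      apply: uu_gt0 => //; move: ct; rewrite /circle /= !in_itv /= => /andP[t1 ->].
      by rewrite (ltW t1).
    have em := e0 m; rewrite /f_ /= lee_fin hhE//; set e := m.+1%:R^-1 in em *.
    rewrite fhwE normrM; apply: ler_pM => //.
      have q1 : `|uu t / (uu t + e)| <= 1.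
        rewrite ger0_norm; last by rewrite divr_ge0// ltW// addr_gt0.
        have ue : 0 < uu t + e by exact: addr_gt0.
        by rewrite (ler_pdivrMr _ _ ue) mul1r lerDl ltW.
      apply: le_trans (ler_normB _ _) _; apply: lerD.
        apply: le_trans (ler_normB _ _) _; apply: lerD.
          by rewrite normrM normr_nat -[leRHS]mulr1 ler_wpM2l.
        by rewrite normrM normr_nat -[leRHS]mulr1 ler_wpM2l.
      rewrite normrM [X in X * _]normrM (gtr0_norm d0) -mulrA ler_pM2l// -[leRHS]mulr1 ler_pM//.
      by apply: le_trans (ler_normD _ _) _; rewrite (_ : 2 = 1 + 1)// lerD.
    rewrite ger0_norm ?powR_ge0// !powRN lef_pV2 ?posrE ?powR_gt0 ?(addr_gt0 ut em)//.
    by rewrite ge0_ler_powR ?nnegrE ?(ltW d0) ?(ltW ut) ?(ltW (addr_gt0 ut em)) ?lerDl ?(ltW em).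
move=> lim0.
have /esym E : (\int[mu]_(x in circ) (EFin \o h) x)%E = 0%E.
  apply: (cvg_unique _ lim0) => //; apply: cvg_near_cst; apply: nearW => m.
  rewrite /= -[RHS](int_hh d n (e0 m)) /circle.
  rewrite integral_itv_obnd_cbnd//; apply/measurable_EFinP; apply: measurable_funTS.
  by apply: continuous_measurable_fun; exact: hh_continuous.
have Z : \int[mu]_(t in circ) h t = 0 by rewrite /Rintegral -E.
move: Z; rewrite /h RintegralB//; [|exact: measurable_circle|exact: integrable_cosM..].
have lin (a c : R) : \int[mu]_(t in circ) (a * cos (c * t) * fhw d t) =
    a * \int[mu]_(t in circ) (cos (c * t) * fhw d t).
  rewrite -RintegralZl//; first by apply: eq_Rintegral => t _; rewrite mulrA.
    exact: measurable_circle.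
  by have := integrable_cosM c 1 iw; apply: eq_integrable => //= [|t _]; rewrite ?mul1r//; exact: measurable_circle.
by rewrite !lin => /eqP; rewrite subr_eq0 => /eqP.
Qed.

End fisher_hartwig_moments.

(** * Cosine moments and multiplication by squared moduli *)

Section trig_moments.
Local Open Scope complex_scope.
Context {R : realType}.
Local Notation mu := (@lebesgue_measure R).
Local Notation circ := (@circle R).

Lemma expiX (t : R) (n : nat) : expi t ^+ n = expi (n%:R * t).
Proof.
elim: n => [|n ih]; first by rewrite expr0 mul0r /expi cos0 sin0.
rewrite exprS ih -natr1 mulrDl mul1r addrC /expi cosD sinD.
by apply/eqP; rewrite eq_complex /=; apply/andP; split; apply/eqP; ring.
Qed.

Definition cosP (P : {poly R}) (t : R) : R := \sum_(0 <= j < (size P).+1) P`_j * cos (j%:R * t).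
Definition sinP (P : {poly R}) (t : R) : R := \sum_(0 <= j < (size P).+1) P`_j * sin (j%:R * t).

Lemma ceval_expi (P : {poly R}) t : ceval P (expi t) = cosP P t +i* sinP P t.
Proof.
have E : ceval P (expi t) = \sum_(0 <= j < (size P).+1) (P`_j)%:C * expi (j%:R * t).
  rewrite /ceval horner_coef size_map_poly big_nat_recr//= nth_default// mul0r addr0 big_mkord.
  by apply: eq_bigr => i _; rewrite coef_map expiX.
rewrite E /cosP /sinP; elim: (size P).+1 => [|n ih]; first by rewrite !big_geq.
rewrite !big_nat_recr//= ih /expi.
by apply/eqP; rewrite eq_complex /=; apply/andP; split; apply/eqP; ring.
Qed.

Lemma modulus_ceval (P : {poly R}) t :
  modulus (ceval P (expi t)) ^+ 2 = cosP P t ^+ 2 + sinP P t ^+ 2.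
Proof. by rewrite ceval_expi /modulus /= sqr_sqrtr// addr_ge0 ?sqr_ge0. Qed.

(** The real part of e^(i x t) P (e^(- i t)) P (e^(i t)), expanded through the addition formulas. *)
Lemma cosP_sinP (P : {poly R}) (x t : R) :
  \sum_(0 <= i < (size P).+1) P`_i * \sum_(0 <= j < (size P).+1) P`_j * cos ((x - i%:R + j%:R) * t)
  = cos (x * t) * (cosP P t ^+ 2 + sinP P t ^+ 2).
Proof.
have H i : \sum_(0 <= j < (size P).+1) P`_j * cos ((x - i%:R + j%:R) * t) =
    cos ((x - i%:R) * t) * cosP P t - sin ((x - i%:R) * t) * sinP P t.
  rewrite /cosP /sinP !mulr_sumr -sumrB; apply: eq_bigr => j _.
  rewrite mulrDl cosD; ring.
under eq_bigr do rewrite H.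
transitivity (\sum_(0 <= i < (size P).+1)
   ((cos (x * t) * cosP P t - sin (x * t) * sinP P t) * (P`_i * cos (i%:R * t)) +
    (sin (x * t) * cosP P t + cos (x * t) * sinP P t) * (P`_i * sin (i%:R * t)))).
  apply: eq_bigr => i _; rewrite mulrBl cosD sinD cosN sinN; ring.
rewrite big_split /= -!mulr_sumr -/(cosP P t) -/(sinP P t); ring.
Qed.

Variable F : R -> R.
Hypothesis iF : mu.-integrable circ (EFin \o F).

Definition mom (k : int) : R := \int[mu]_(t in circ) (cos (k%:~R * t) * F t).

Lemma integrable_cos (c : R) : mu.-integrable circ (EFin \o (fun t => cos (c * t) * F t)).
Proof.
have := integrable_cosM c 1 iF; congr (mu.-integrable _ _).
by apply/funext => t /=; rewrite mul1r.
Qed.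

Lemma mom_bounded : exists M, forall k, `|mom k| <= M.
Proof.
exists (\int[mu]_(t in circ) `|F t|) => k.
have iN : mu.-integrable circ (EFin \o (fun t => `|F t|)).
  by have := integrable_norm iF; apply.
apply: le_trans (le_normr_Rintegral measurable_circle (integrable_cos _)) _.
apply: le_Rintegral => //.
- exact: measurable_circle.
- by have := integrable_norm (integrable_cos k%:~R); apply.
- by move=> t _; rewrite normrM ler_piMl// ler_norml cos_geN1 cos_le1.
Qed.

Lemma Rintegral_sum (n : nat) (G : nat -> R -> R) :
  (forall i, mu.-integrable circ (EFin \o G i)) ->
  mu.-integrable circ (EFin \o (fun t => \sum_(0 <= i < n) G i t)) /\
  \int[mu]_(t in circ) (\sum_(0 <= i < n) G i t) = \sum_(0 <= i < n) \int[mu]_(t in circ) G i t.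
Proof.
move=> iG; elim: n => [|n [i1 i2]].
  split.
    have := integrable_cosM 0 0 iF; congr (mu.-integrable _ _).
    by apply/funext => t /=; rewrite big_geq// !mul0r.
  rewrite big_geq// -[RHS](mul0r (fine (mu circ))) -Rintegral_cst//; last exact: measurable_circle.
  by apply: eq_Rintegral => t _; rewrite big_geq// mul0r.
split.
  have := integrableD measurable_circle i1 (iG n); congr (mu.-integrable _ _).
  by apply/funext => t /=; rewrite big_nat_recr.
transitivity (\int[mu]_(t in circ) (\sum_(0 <= i < n) G i t + G n t)).
  by apply: eq_Rintegral => t _; rewrite big_nat_recr.
by rewrite RintegralD ?i2 ?big_nat_recr//; exact: measurable_circle.
Qed.

End trig_moments.

Section trig_moment_convolution.
Context {R : realType}.
Local Notation mu := (@lebesgue_measure R).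
Local Notation circ := (@circle R).
Variable F : R -> R.
Hypothesis iF : mu.-integrable circ (EFin \o F).

Lemma mom_conv (P : {poly R}) (k : int) :
  conv (conv (pseq P) (rev (pseq P))) (mom F) k =
  mom (fun t => modulus (ceval P (expi t)) ^+ 2 * F t) k.
Proof.
have [M hM] := mom_bounded iF.
have fP : finsupp (size P) (pseq P) := @pseq_finsupp R P; have sP := summ_finsupp1 fP.
rewrite (convA_l1_bounded (M := M))//; last exact: summ_rev.
rewrite /conv (tsum_finsupp _ fP).
pose G i j (t : R) := P`_i * (P`_j * cos ((k%:~R - i%:R + j%:R) * t) * F t).
have iG i j : mu.-integrable circ (EFin \o G i j).
  have := integrable_cosM (k%:~R - i%:R + j%:R) (P`_i * P`_j) iF.
  by congr (mu.-integrable _ _); apply/funext => t /=; rewrite /G !mulrA.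
have inner (i : nat) : pseq P i * tsum (fun j => rev (pseq P) j * mom F (k - i%:Z - j)) =
    \int[mu]_(t in circ) \sum_(0 <= j < (size P).+1) G i j t.
  have [_ ->] := Rintegral_sum iF (size P).+1 (iG i).
  rewrite (tsum_bij _ opp_bij).
  rewrite (eq_tsum (g := fun j => pseq P j * mom F (k - i%:Z + j))); last first.
    by move=> j; rewrite /rev !opprK.
  rewrite (tsum_finsupp _ fP) mulr_sumr; apply: eq_bigr => j _.
  rewrite /mom /= -!RintegralZl; do ?[exact: measurable_circle|exact: integrable_cos].
    by apply: eq_Rintegral => t _; rewrite /G !intrD mulrNz -!pmulrn !mulrA.
  have := integrable_cosM (k - i%:Z + j%:Z)%:~R (P`_j) iF.
  by congr (mu.-integrable _ _); apply/funext => t /=; rewrite mulrA.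
rewrite (eq_bigr _ (fun i _ => inner i)).
have iG' i : mu.-integrable circ (EFin \o (fun t => \sum_(0 <= j < (size P).+1) G i j t)).
  by have [] := Rintegral_sum iF (size P).+1 (iG i).
have [_ <-] := Rintegral_sum iF (size P).+1 iG'.
apply: eq_Rintegral => t _.
rewrite modulus_ceval mulrA -cosP_sinP mulr_suml; apply: eq_bigr => i _.
by rewrite mulr_sumr mulr_suml; apply: eq_bigr => j _; rewrite /G mulrA.
Qed.

End trig_moment_convolution.

(** * Moments of the FARIMA density *)

Section density.
Local Open Scope complex_scope.
Context {R : realType}.
Local Notation mu := (@lebesgue_measure R).
Local Notation circ := (@circle R).
Variables (d : R) (Phi Theta : {poly R}).
Hypothesis hd : 0 < d < 1 / 2.
Hypotheses (hPhi : no_zero_in_closed_disk Phi) (hTheta : no_zero_in_closed_disk Theta).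

Let msq (P : {poly R}) t : R := modulus (ceval P (expi t)) ^+ 2.

Lemma msq_continuous P : continuous (msq P).
Proof.
have -> : msq P = fun t => cosP P t ^+ 2 + sinP P t ^+ 2.
  by apply/funext => t; exact: modulus_ceval.
have s (f : nat -> R -> R) n : (forall i, continuous (f i)) ->
    continuous (fun t => \sum_(0 <= i < n) f i t).
  move=> cf; elim: n => [|n ih] t.
    by under eq_fun do rewrite big_geq//; exact: cvg_cst.
  under eq_fun do rewrite big_nat_recr//=.
  by apply: cvgD; [exact: ih|exact: cf].
have c1 : continuous (cosP P).
  apply: s => i t; apply: cvgM; first exact: cvg_cst.
  by have := is_derive_continuous (is_derive_cosZ i%:R); apply.
have c2 : continuous (sinP P).
  apply: s => i t; apply: cvgM; first exact: cvg_cst.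
  by have := is_derive_continuous (is_derive_sinZ i%:R); apply.
by move=> t; apply: cvgD; [exact: (cvgM (c1 t) (c1 t))|exact: (cvgM (c2 t) (c2 t))].
Qed.

Lemma msq_gt0 P t : no_zero_in_closed_disk P -> 0 < msq P t.
Proof.
move=> hP; rewrite exprn_gt0// lt_neqAle modulus_ge0 andbT eq_sym.
have e1 : modulus (expi t) <= 1 by rewrite /modulus /= cos2Dsin2 sqrtr1.
apply: contra (hP _ e1) => /eqP h.
by apply/eqP; exact: ComplexField.Normc.eq0_normc.
Qed.

Hypothesis iDelta : mu.-integrable circ (EFin \o farima_density d Phi Theta).

Let Delta := farima_density d Phi Theta.

Lemma DeltaE t : Delta t = (2 * pi)^-1 * (msq Theta t / msq Phi t) * fhw d t.
Proof. by []. Qed.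

Lemma integrable_continuousM (h F : R -> R) : continuous h ->
  mu.-integrable circ (EFin \o F) -> mu.-integrable circ (EFin \o (fun t => h t * F t)).
Proof.
move=> ch iF.
have pi2 : - pi <= pi :> R by have := pi_ge0 R; lra.
have [M hM] : exists M, forall t, circ t -> `|h t| <= M.
  have ca : {within `[- pi, pi], continuous (fun t => `|h t|)}.
    apply: continuous_subspaceT => t; apply: (cvg_comp _ _ (ch t)); exact: norm_continuous.
  have [c _ hc] := EVT_max pi2 ca; exists `|h c| => t.
  rewrite /circle /= in_itv /= => /andP[t1 t2]; apply: hc.
  by rewrite in_itv /= t2 ltW.
have := @integrableMr _ _ R mu circ measurable_circle h (EFin \o F).
apply => //.
- by apply: measurable_funTS; exact: continuous_measurable_fun.
- exists M; split; first exact: num_real.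
  by move=> x Mx t ct /=; apply: le_trans (hM t ct) (ltW Mx).
Qed.

(** The weight is the density times 2 pi |Phi|^2 / |Theta|^2, which is continuous and hence bounded
    on the circle; integrability is inherited, without an estimate at the singularity. *)
Lemma fhw_integrable : mu.-integrable circ (EFin \o fhw d).
Proof.
pose h t : R := 2 * pi * (msq Phi t / msq Theta t).
have ch : continuous h.
  move=> t; apply: cvgM; first exact: cvg_cst.
  apply: cvgM; first exact: msq_continuous.
  apply: cvgV; last exact: msq_continuous.
  by rewrite gt_eqF// msq_gt0.
have := integrable_continuousM ch iDelta; congr (mu.-integrable _ _).
apply/funext => t /=; rewrite -/(Delta t) DeltaE /h; congr (_%:E).
by move: (@pi R) (pi_gt0 R) => p p0; field; rewrite !gt_eqF ?msq_gt0.
Qed.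

Lemma acov0_gt0 : 0 < acov0 d 0.
Proof.
rewrite /acov0 conv_rev_nat; last exact: binc_causal.
have s : summ (fun n : nat => binc d n * binc d (0 + n)).
  apply: (summ_sub_inj (h := Posz) (f := fun i : int => binc d i * binc d (0 + i))) => [i i' []//|].
  by apply: summ_mul_l2; [exact: binc_l2|under eq_fun do rewrite add0r; exact: binc_l2].
apply: lt_le_trans (term_le_tsum 0%N s _).
  by rewrite addr0 !binc0 mulr1.
by move=> i; rewrite add0r -expr2 sqr_ge0.
Qed.

Lemma mom_even F (k : int) : @mom R F (- k) = mom F k.
Proof. by apply: eq_Rintegral => t _; rewrite mulrNz mulNr cosN. Qed.

(** Both sides satisfy the same first-order recursion, whose leading coefficient n + 1 - d is
    nonzero, and both are even. The constant stays implicit since it cancels later. *)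
Lemma mom_fhw : exists K, forall k, mom (fhw d) k = K * acov0 d k.
Proof.
have hd1 : 0 < d < 1 by case/andP: hd => *; apply/andP; split; lra.
have A0 := acov0_gt0.
exists (mom (fhw d) 0 / acov0 d 0).
have pos (n : nat) : mom (fhw d) n = mom (fhw d) 0 / acov0 d 0 * acov0 d n.
  elim: n => [|n ih]; first by rewrite divfK// gt_eqF.
  have nd : n.+1%:R - d != 0 :> R by exact: (intr_neq n.+1 hd1).
  have r1 := fh_recursion n hd1 fhw_integrable.
  have r2 := acov0S hd n%:Z.
  have e : n%:Z + 1 = n.+1 by lia.
  rewrite e in r2; apply: (mulfI nd).
  rewrite [RHS]mulrCA [X in _ = _ * X]r2 mulrCA -ih; exact: r1.
case=> n; first exact: pos.
by rewrite NegzE mom_even /acov0 acov_even; exact: pos.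
Qed.

Lemma momZ F (x : R) k : mu.-integrable circ (EFin \o F) ->
  mom (fun t => x * F t) k = x * mom F k.
Proof.
move=> iF; rewrite /mom -RintegralZl; [|exact: measurable_circle|exact: integrable_cos].
by apply: eq_Rintegral => t _; rewrite mulrCA.
Qed.

Lemma density_coef : mom Delta 0 != 0 -> exists (a c : int -> R) (K C1 : R),
  [/\ causal a, causal c, summ a, dec (1 - d) c & conv a c = delta] /\
  [/\ dec 1 (conv (rev c) a), 0 <= C1,
   (forall k : nat, (0 < k)%N -> `|conv (rev c) a k - phase0 d k| <= C1 / k%:R ^+ 2),
   K != 0 & forall k, mom Delta k = K * conv (rev c) c k].
Proof.
move=> m0.
have [iP [ciP wiP PiP]] := poly_inverse hPhi.
have [iQ [ciQ wiQ QiQ]] := poly_inverse hTheta.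
have fP : finsupp (size Phi) (pseq Phi) := @pseq_finsupp R Phi.
have fQ : finsupp (size Theta) (pseq Theta) := @pseq_finsupp R Theta.
have wP := wsumm_finsupp fP; have wQ := wsumm_finsupp fQ.
have sP := wsumm_summ wP; have sQ := wsumm_summ wQ.
have siP := wsumm_summ wiP; have siQ := wsumm_summ wiQ.
pose t := conv (pseq Theta) iP; pose t' := conv (pseq Phi) iQ.
have tt' : conv t t' = delta.
  rewrite /t /t' (convC (pseq Phi)) convACA// QiQ conv_delta convC; exact: PiP.
have ct : causal t by apply: conv_causal => //; exact: pseq_causal.
have ct' : causal t' by apply: conv_causal => //; exact: pseq_causal.
have wt : wsumm t by exact: wsumm_conv.
have wt' : wsumm t' by exact: wsumm_conv.
have [K0 hK0] := mom_fhw.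
have [M hM] := mom_bounded iDelta.
pose K := (2 * pi)^-1 * K0.
have [L hL] := conv_bounded (l2_rev (binc_l2 hd)) (binc_l2 hd).
have gE k : mom Delta k = K * conv (rev (gen_c d t)) (gen_c d t) k.
  (* Multiplying the density by |Phi|^2 leaves |Theta|^2 times the weight, up to 1 / (2 pi); in
     terms of moments this is the convolution identity that [spectral_factor] requires. *)
  apply: (spectral_factor hd sP wQ wiP PiP hM) => {}k.
  rewrite (mom_conv iDelta).
  have -> : (fun s => modulus (ceval Phi (expi s)) ^+ 2 * Delta s) =
      (fun s => (2 * pi)^-1 * (msq Theta s * fhw d s)).
    apply/funext => s; rewrite DeltaE -/(msq Phi s).
    by move: (@pi R) (pi_gt0 R) => p p0; field; rewrite !gt_eqF ?msq_gt0.
  have iT : mu.-integrable circ (EFin \o (fun s => msq Theta s * fhw d s)).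
    exact: integrable_continuousM (@msq_continuous Theta) fhw_integrable.
  rewrite momZ// -(mom_conv fhw_integrable) /K -mulrA; congr (_ * _).
  have -> : mom (fhw d) = (fun k => K0 * acov0 d k) by apply/funext.
  rewrite convZr//; apply: (summ_mul_bounded (M := L)) => [|i]; last exact: hL.
  by apply: summ_conv => //; exact: summ_rev.
exists (gen_a d t'), (gen_c d t), K.
have [C1 C10 hC1] := gen_phase_sub hd wt wt' tt'.
exists C1; split.
  split.
  - exact: gen_a_causal.
  - exact: gen_c_causal.
  - exact: gen_a_summ.
  - exact: gen_c_dec.
  - exact: gen_ac.
split => //.
- exact: gen_phase_dec.
- by apply: contraNneq m0 => K0'; rewrite gE K0' mul0r.
Qed.

End density.

(** * Verblunsky coefficients and predictors *)

Section L2_geometry.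
Context {disp : measure_display} {T : measurableType disp} {R : realType}.
Variable P : probability T R.
Implicit Types Y Z W : T -> R.
Local Notation L2 Y := (Y \in Lfun P 2%:E).

Lemma innerE Y Z : inner P Y Z = \int[P]_(w in setT) (Y w * Z w).
Proof. by rewrite /inner unlock. Qed.

Lemma innerC Y Z : inner P Y Z = inner P Z Y.
Proof. by rewrite !innerE; apply: eq_Rintegral => w _; rewrite mulrC. Qed.

Lemma L2_integrable Y Z : L2 Y -> L2 Z -> P.-integrable setT (EFin \o (fun w => Y w * Z w)).
Proof. by move=> hY hZ; apply/Lfun1_integrable; exact: Lfun2_mul_Lfun1. Qed.

Lemma L2D Y Z : L2 Y -> L2 Z -> L2 (fun w => Y w + Z w).
Proof. by move=> hY hZ; apply: (Lfun_addr_closed _ _).2 => //; rewrite lee_fin ler1n. Qed.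

Lemma L2Z Y (c : R) : L2 Y -> L2 (fun w => c * Y w).
Proof.
have h1 : 1 <= 2 :> R by rewrite ler1n.
move=> hY; rewrite (_ : (fun w => c * Y w) = c \o* Y); first exact: Lfun_scale.
by apply/funext => w /=; rewrite mulrC.
Qed.

Lemma innerDl Y Z W : L2 Y -> L2 Z -> L2 W ->
  inner P (fun w => Y w + Z w) W = inner P Y W + inner P Z W.
Proof.
move=> hY hZ hW; rewrite !innerE -RintegralD//; try exact: L2_integrable.
by apply: eq_Rintegral => w _; rewrite mulrDl.
Qed.

Lemma innerZl Y W (c : R) : L2 Y -> L2 W ->
  inner P (fun w => c * Y w) W = c * inner P Y W.
Proof.
move=> hY hW; rewrite !innerE -RintegralZl//; last exact: L2_integrable.
by apply: eq_Rintegral => w _; rewrite mulrA.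
Qed.

Lemma L2B Y Z : L2 Y -> L2 Z -> L2 (Y \- Z).
Proof.
move=> hY hZ; rewrite (_ : Y \- Z = fun w => Y w + -1 * Z w); first by apply: L2D => //; exact: L2Z.
by apply/funext => w /=; rewrite mulN1r.
Qed.

Lemma innerBl Y Z W : L2 Y -> L2 Z -> L2 W ->
  inner P (Y \- Z) W = inner P Y W - inner P Z W.
Proof.
move=> hY hZ hW; rewrite -[in RHS]mulN1r -innerZl// -innerDl//; last exact: L2Z.
by congr inner; apply/funext => w /=; rewrite mulN1r.
Qed.

Lemma innerBr Y Z W : L2 Y -> L2 Z -> L2 W ->
  inner P W (Y \- Z) = inner P W Y - inner P W Z.
Proof. by move=> hY hZ hW; rewrite innerC innerBl// ![inner P W _]innerC. Qed.

Lemma inner_ge0 Y : 0 <= inner P Y Y.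
Proof. by rewrite innerE; apply: Rintegral_ge0 => w _; rewrite -expr2 sqr_ge0. Qed.

Lemma inner_CS Y Z : L2 Y -> L2 Z -> inner P Y Z ^+ 2 <= inner P Y Y * inner P Z Z.
Proof.
move=> hY hZ.
have q (s t : R) : 0 <= s ^+ 2 * inner P Y Y + 2 * s * t * inner P Y Z + t ^+ 2 * inner P Z Z.
  have := inner_ge0 (fun w => s * Y w + t * Z w).
  have h1 := L2Z s hY; have h2 := L2Z t hZ; have h3 := L2D h1 h2.
  rewrite innerDl// !innerZl// ![inner P _ (fun w => _ + _)]innerC !innerDl// !innerZl//.
  rewrite (innerC Z Y); congr (_ <= _); ring.
set a := inner P Y Y in q *; set b := inner P Y Z in q *; set c := inner P Z Z in q *.
have a0 : 0 <= a by exact: inner_ge0.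
have c0 : 0 <= c by exact: inner_ge0.
have [a1|a1] := eqVneq a 0.
  (* For a = 0 the form at this point is - (c + 2) b^2, which forces b = 0. *)
  have := q (- (c + 1)) b; rewrite a1 mulr0 add0r mul0r; nra.
have := q (- b) a; have : 0 < a by rewrite lt_neqAle eq_sym a1.
nra.
Qed.

Lemma inner_null Y W : L2 Y -> L2 W -> inner P Y Y = 0 -> inner P Y W = 0.
Proof.
move=> hY hW h; have := inner_CS hY hW; rewrite h mul0r => h2.
by apply/eqP; rewrite -sqrf_eq0; apply/eqP/le_anti; rewrite h2 sqr_ge0.
Qed.

Lemma l2norm_ge0 Y : 0 <= l2norm P Y. Proof. exact: sqrtr_ge0. Qed.

Lemma l2norm_sqr Y : l2norm P Y ^+ 2 = inner P Y Y.
Proof. by rewrite sqr_sqrtr// inner_ge0. Qed.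

Variable X : int -> {RV P >-> R}.
Hypothesis hX : weakly_stationary X.
Let LX k : L2 (X k : T -> R). Proof. by case: hX. Qed.

Definition lc (s : seq int) (c : int -> R) (w : T) : R := \sum_(k <- s) c k * X k w.

Lemma L2_lc s c : L2 (lc s c).
Proof.
elim: s => [|k s ih].
  rewrite (_ : lc [::] c = fun w => 0 * X 0 w); first exact: L2Z.
  by apply/funext => w; rewrite /lc big_nil mul0r.
rewrite (_ : lc (k :: s) c = fun w => c k * X k w + lc s c w); first by apply: L2D => //; exact: L2Z.
by apply/funext => w; rewrite /lc big_cons.
Qed.

Lemma inner_lc s c W : L2 W -> inner P (lc s c) W = \sum_(k <- s) c k * inner P (X k) W.
Proof.
move=> hW; elim: s => [|k s ih].
  rewrite big_nil -(mul0r (inner P (X 0) W)) -innerZl//; congr inner.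
  by apply/funext => w; rewrite /lc big_nil mul0r.
rewrite big_cons -ih -innerZl// -innerDl//; [|exact: L2Z|exact: L2_lc].
by congr inner; apply/funext => w; rewrite /lc big_cons.
Qed.

Lemma lc_closed (I : set int) s c : (forall k, k \in s -> I k) -> closed_span X I (lc s c).
Proof.
move=> sI; split; first exact: L2_lc.
move=> e e0; exists (lc s c); first by exists s, c.
rewrite /l2norm (_ : inner P _ _ = 0) ?sqrtr0// innerE.
rewrite (eq_Rintegral _ (g := cst 0)); last by move=> w _ /=; rewrite subrr mul0r.
by rewrite Rintegral_cst// mul0r.
Qed.

Lemma orth_closed (I : set int) Z V : L2 Z -> (forall k, I k -> inner P Z (X k) = 0) ->
  closed_span X I V -> inner P Z V = 0.
Proof.
move=> hZ ZI [hV hd]; apply/eqP; rewrite -normr_le0.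
apply/ler_addgt0Pr => e e0; rewrite add0r.
have z0 : 0 < l2norm P Z + 1 by rewrite ltr_wpDl// l2norm_ge0.
have [U [s [c [sI UE]]] hU] := hd (e / (l2norm P Z + 1)) ltac:(by rewrite divr_gt0).
have hU2 : L2 U by rewrite UE; exact: L2_lc.
have ZU : inner P Z U = 0.
  rewrite innerC UE (inner_lc s c hZ) big_seq big1// => k /sI /ZI.
  by rewrite innerC => ->; rewrite mulr0.
have -> : inner P Z V = inner P Z (V \- U) by rewrite innerBr// ZU subr0.
have := inner_CS hZ (L2B hV hU2); rewrite -!l2norm_sqr -exprMn => h.
have {}h : `|inner P Z (V \- U)| <= l2norm P Z * l2norm P (V \- U).
  by rewrite -(ler_pXn2r (n := 2)) ?nnegrE ?mulr_ge0 ?l2norm_ge0// real_normK ?num_real.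
apply: le_trans h _; apply: (@le_trans _ _ ((l2norm P Z + 1) * (e / (l2norm P Z + 1)))).
  by rewrite ler_pM ?l2norm_ge0 ?lerDl// ltW.
by rewrite mulrC divfK// gt_eqF.
Qed.

(** [Pperp] is a chosen representative, known only up to null functions. It and the finite
    combination are both projections of [Y], so their difference is orthogonal to itself, and
    Cauchy--Schwarz transfers all inner products. *)
Lemma Pperp_inner (I : set int) s c (Y : T -> R) : L2 Y ->
  (forall k, I k -> inner P (lc s c) (X k) = 0) ->
  closed_span X I (Y \- lc s c) ->
  L2 (Pperp X I Y) /\ forall W, L2 W -> inner P (Pperp X I Y) W = inner P (lc s c) W.
Proof.
move=> hY hI hcl; set Z := lc s c.
have hZ : L2 Z by exact: L2_lc.
have MZ : orth_compl X I Z.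
  split; first by exact: lc_closed.
  by move=> V hV; exact: (orth_closed hZ hI hV).
have oZ : orth_proj P (orth_compl X I) Y Z.
  by split => // V [_ hV]; rewrite innerC; exact: hV.
have := xgetI (cst 0) oZ; rewrite -/(Pperp X I Y) => -[[[hZ' _] _] oZ'].
have [_ oZ2] := oZ.
set Z' := Pperp X I Y in hZ' oZ' *; split => //.
have MZ' : orth_compl X I Z'.
  by have := xgetI (cst 0) oZ => -[].
have n0 : inner P (Z' \- Z) (Z' \- Z) = 0.
  have e1 := oZ' _ MZ; have e2 := oZ' _ MZ'; have e3 := oZ2 _ MZ; have e4 := oZ2 _ MZ'.
  have LD := L2B hZ' hZ.
  move: e1 e2 e3 e4; rewrite !innerBl// !innerBr//; lra.
move=> W hW; have := inner_null (L2B hZ' hZ) hW n0.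
by rewrite innerBl// => /eqP; rewrite subr_eq0 => /eqP.
Qed.

Lemma inner_gamma (k m : int) : inner P (X k) (X m) = gamma X (k - m).
Proof.
by have [_ h] := hX; have := h (k - m) 0 m; rewrite subrK add0r.
Qed.

Lemma gamma_even k : gamma X (- k) = gamma X k.
Proof. by rewrite -[- k]sub0r -inner_gamma innerC inner_gamma subr0. Qed.

(** The same coefficients [p] give both residuals: that of [X 0] directly and that of [X n] after
    the time reversal l -> n - l, because [gamma] is even. In each inner product only the term with
    coefficient p 0 = 1 survives, by the normal equations. *)
Lemma verblunsky_formula (n : nat) (p : int -> R) : (1 < n)%N -> finsupp n.-1 p -> p 0 = 1 ->
  (forall k : int, 0 < k -> k < n%:Z -> conv (gamma X) p k = 0) ->
  verblunsky X n = conv (gamma X) p n%:Z / conv (gamma X) p 0.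
Proof.
move=> n1 hp p0 Hz.
have cE k : conv (gamma X) p k = \sum_(0 <= l < n) p l%:Z * gamma X (k - l%:Z).
  by rewrite convC /conv (tsum_finsupp _ hp) prednK//; lia.
pose s0 := [seq (l%:Z : int) | l <- iota 0 n].
pose sn := [seq (n%:Z - l%:Z : int) | l <- iota 0 n].
pose cn k := p (n%:Z - k).
pose I := [set k : int | 1 <= k <= n%:Z - 1].
have in0 k : inner P (lc s0 p) (X k) = conv (gamma X) p k.
  rewrite inner_lc// cE big_map /index_iota subn0; apply: eq_bigr => l _.
  by rewrite inner_gamma -gamma_even opprB.
have inn k : inner P (lc sn cn) (X k) = conv (gamma X) p (n%:Z - k).
  rewrite inner_lc// cE big_map /index_iota subn0; apply: eq_bigr => l _.
  by rewrite inner_gamma /cn subKr addrAC.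
have i0 : iota 0 n = 0%N :: iota 1 n.-1 by case: (n) n1.
have cl0 : closed_span X I ((X 0 : T -> R) \- lc s0 p).
  have -> : (X 0 : T -> R) \- lc s0 p = lc [seq (l%:Z : int) | l <- iota 1 n.-1] (fun k => - p k).
    apply/funext => w; rewrite /lc /s0 i0 /= big_cons p0 mul1r opprD addrA subrr add0r.
    by rewrite -sumrN; apply: eq_bigr => k _; rewrite mulNr.
  apply: lc_closed => k /mapP[l]; rewrite mem_iota => hl ->; rewrite /I /=; lia.
have cln : closed_span X I ((X n%:Z : T -> R) \- lc sn cn).
  have -> : (X n%:Z : T -> R) \- lc sn cn = lc [seq (n%:Z - l%:Z : int) | l <- iota 1 n.-1] (fun k => - cn k).
    apply/funext => w; rewrite /lc /sn i0 /= big_cons subr0 /cn subrr p0 mul1r opprD addrA subrr add0r.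
    by rewrite -sumrN; apply: eq_bigr => k _; rewrite mulNr.
  apply: lc_closed => k /mapP[l]; rewrite mem_iota => hl ->; rewrite /I /=; lia.
have h0 k : I k -> inner P (lc s0 p) (X k) = 0.
  by rewrite /I /= => hk; rewrite in0 Hz//; lia.
have hn k : I k -> inner P (lc sn cn) (X k) = 0.
  by rewrite /I /= => hk; rewrite inn Hz//; lia.
have [L0 E0] := Pperp_inner (LX 0) h0 cl0.
have [Ln En] := Pperp_inner (LX n%:Z) hn cln.
have -> : verblunsky X n = inner P (Pperp X I (X n%:Z)) (Pperp X I (X 0))
           / l2norm P (Pperp X I (X n%:Z)) ^+ 2.
  by case: n n1 {hp Hz cE s0 sn cn in0 inn i0 cl0 cln h0 hn L0 E0 Ln En} @I => [|[|n]].
have ls0 := L2_lc s0 p; have lsn := L2_lc sn cn.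
have N : inner P (Pperp X I (X n%:Z)) (Pperp X I (X 0)) = conv (gamma X) p n%:Z.
  rewrite En// innerC E0// (inner_lc _ _ lsn) /s0 i0 /= big_cons p0 mul1r innerC inn subr0.
  rewrite big1_seq ?addr0// => k /andP[_ /mapP[l]]; rewrite mem_iota => hl ->.
  by rewrite innerC inn Hz ?mulr0//; lia.
have D : l2norm P (Pperp X I (X n%:Z)) ^+ 2 = conv (gamma X) p 0.
  rewrite l2norm_sqr En// innerC En// (inner_lc _ _ lsn).
  under eq_bigr do rewrite innerC inn.
  rewrite /sn i0 /= big_cons !subr0 /cn !subrr p0 mul1r.
  rewrite big1_seq ?addr0// => k /andP[_ /mapP[l]]; rewrite mem_iota => hl ->.
  by rewrite subKr Hz ?mulr0//; lia.
by rewrite N D.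
Qed.

End L2_geometry.

Section process_density.
Context {R : realType} {disp : measure_display} {T : measurableType disp}.
Variables (P : probability T R) (X : int -> {RV P >-> R}).

Lemma gamma_mom Delta : has_spectral_density X Delta ->
  (@lebesgue_measure R).-integrable circle (EFin \o Delta) /\ gamma X = mom Delta.
Proof.
move=> [iD hD]; split => //; apply/funext => n.
have /(congr1 (@complex.Re R)) /= -> := hD n.
by apply: eq_Rintegral => t _ /=; rewrite mulr0 subr0.
Qed.

(** [gamma X 0] is the total mass of the spectral measure, and a zero measure is supported by the
    empty set, which is finite. *)
Lemma gamma0_neq0 : stationary_process X -> gamma X 0 != 0.
Proof.
move=> [_ _ [mu [mu0 hmu] nfin]]; apply: contra_notN nfin => /eqP g0.
have /(congr1 (@complex.Re R)) /= := hmu 0; rewrite g0.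
rewrite (eq_Rintegral _ (g := cst 1)); last by move=> t _ /=; rewrite mul0r cos0.
rewrite Rintegral_cst ?mul1r; last exact: measurable_circle.
have mc : measurable (circle : set (measurableTypeR R)) by exact: measurable_circle.
move=> /esym m0.
have mC : mu circle = 0%E.
  by rewrite -[LHS]fineK ?m0// fin_num_measure.
exists set0; first exact: finite_set0.
rewrite setC0 -(setUv circle) measureU//; [|exact: measurableC|by rewrite setICr].
by rewrite [X in (X + _)%E]mC [X in (_ + X)%E]mu0 adde0.
Qed.

End process_density.

Theorem theorem4p3 (R : realType) (disp : measure_display)
    (T : measurableType disp) (P : probability T R)
    (d : R) (p q : nat) (X : int -> {RV P >-> R})
    (hd : 0 < d < 2^-1) (hX : farima p d q X) :
  (fun n : nat => n%:R * verblunsky X n : R^o)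
    = cst (d : R^o) +O_\oo (fun n : nat => n%:R `^ (- d) : R^o).
Proof.
have hd' : 0 < d < 1 / 2 by rewrite mul1r.
have [d0 d2] : 0 < d /\ d < 1 / 2 by apply/andP.
have [_ sX [Phi [Th [_ _ hP hQ hdens]]]] := hX.
have [wX _ _] := sX.
have [iD gE] := gamma_mom hdens.
have g0 := gamma0_neq0 sX; rewrite gE in g0.
have [a [c [K [C1 [[ca cc sa hc ac] [hphi C10 hC1 K0 hK]]]]]] := density_coef hd' hP hQ iD g0.
have [C [N hN]] := predictor_asymptotics hd' ca cc sa hc ac hphi C10 hC1.
apply/eqaddOP; exists C; split; first exact: num_real.
move=> M CM; exists (maxn N 2) => // n /=; rewrite geq_max => /andP[nN n2].
have [u [hu u0 Hz bnd]] := hN n nN.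
have scale k : conv (gamma X) u k = K * conv (conv (rev c) c) u k.
  rewrite !(convC _ u) -convZr; last exact: (summ_finsupp _ hu).
  by rewrite gE (_ : mom _ = fun k => K * conv (rev c) c k)//; exact/funext.
change (`|n%:R * verblunsky X n - d| <= M * `|n%:R `^ (- d)|).
rewrite (verblunsky_formula wX n2 hu u0); last first.
  by move=> k k0 kn; rewrite scale Hz ?mulr0.
(* The unknown factor [K] of the covariance cancels in the ratio. *)
rewrite !scale invfM mulrACA divff// mul1r.
have n0 : (0 : R) < n%:R by rewrite ltr0n; lia.
have C0 : 0 <= C.
  have := le_trans (normr_ge0 _) bnd.
  by rewrite pmulr_lge0// invr_gt0.
apply: le_trans bnd _.
rewrite [X in _ <= _ * X]ger0_norm ?powR_ge0//.
have n1 : (1 : R) <= n%:R by rewrite ler1n -(ltr0n R).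
apply: (@le_trans _ _ (C * n%:R `^ (- d))); last first.
  by rewrite ler_wpM2r ?powR_ge0// ltW.
(* The bound C / n is stronger than required: n^-1 <= n^-d because d < 1 and n >= 1. *)
rewrite ler_wpM2l// -powR_inv1 ?(ltW n0)//.
by apply: ler_powR => //; lra.
Qed.
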